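(* Let $\{f_\theta:\theta\in\Theta\}$ be a family of non-decreasing functions $f_\theta:\mathbb{N}_+\to(0,\infty)$ with compact parameter space $\Theta\subset\mathbb{R}^d$, such that $\theta\mapsto f_\theta(k)$ is twice continuously differentiable for every $k$. Suppose the functions satisfy $f_\theta(k)\le Ck^\beta$ for some constants $C$ and $\beta<1$, or $f_\theta(k)=k+\alpha$ for some constant $\alpha>-1$, for every $k$ and every $\theta\in\Theta$. Let the true parameter $\theta_0\in\Theta$ be identifiable, in the sense that $f_\theta(k)=c f_{\theta_0}(k)$ for every $k\in\mathbb{N}_+$ and some constant $c$ if and only if $\theta=\theta_0$. Let $\tilde\theta_n$ be the pseudo maximum likelihood estimator, defined as the maximizer over $\theta\in\Theta$ of $$\tilde\iota_n(f_\theta)=\sum_{k=1}^\infty\log f_\theta(k)\,P_{>k}(n)-\log S_{f_\theta}(n),$$ or as a zero of $$\dot{\tilde\iota}_n(f_\theta)=\sum_{k=1}^\infty\frac{\dot f_\theta(k)}{f_\theta(k)}\,P_{>k}(n)-\frac{S_{\dot f_\theta}(n)}{S_{f_\theta}(n)}.$$ Then $\tilde\theta_n$ is consistent: as $n\to\infty$, $\tilde\theta_n\to\theta_0$ almost surely under $\theta_0$.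
   Context: Preferential attachment (PA) tree with PA function $f:\mathbb{N}_+\to(0,\infty)$: at time $1$ there is a single node $v_1$ of degree $1$ (a root with a loose edge). Given the tree at time $n$ with nodes $v_1,\dots,v_n$ of degrees $d_1(n),\dots,d_n(n)$, a new node $v_{n+1}$ of degree $1$ is attached by an edge to the existing node $v_i$ with conditional probability $f(d_i(n))/\sum_{j=1}^n f(d_j(n))$ given the past; the degree of the chosen node increases by $1$. ''Under $\theta_0$'' means that the tree is generated with PA function $f_{\theta_0}$. $N_k(n)$ is the number of nodes of degree $k$ at time $n$, $P_k(n)=N_k(n)/n$, $P_{>k}(n)=\sum_{l>k}P_l(n)$, and for a (scalar- or vector-valued) function $h$ on $\mathbb{N}_+$, $S_h(n)=\sum_{k=1}^\infty h(k)N_k(n)$. $\dot f_\theta(k)$ denotes the gradient of $f_\theta(k)$ with respect to $\theta$.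
   Formalization: For the estimator defined as a zero of the score, the theorem assumes that θ0 is interior to Θ and takes a zero at which the criterion is largest among all zeros in Θ; for arbitrary zeros the claim is false (f_θ(k)=k^{(θ³+2)/4} has the zero θ=0 for every n). The maximizer case is unchanged. *)

(* Defs.v *)
From HB Require Import structures.
From mathcomp Require Import all_boot all_order all_algebra.
From mathcomp Require Import all_classical all_reals all_analysis.
Set Implicit Arguments.
Unset Strict Implicit.
Unset Printing Implicit Defensive.
Import Order.TTheory GRing.Theory Num.Theory.
Import numFieldNormedType.Exports.
Local Open Scope classical_set_scope.
Local Open Scope ring_scope.

(* Nodes and times are numbered from 1.  A growing tree is encoded by its
   attachment sequence [a]: for n >= 1, [a n] is the index in {1, ..., n} of
   the node to which v_{n+1} is attached; [a 0] carries no information. *)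
Definition is_history (a : nat -> nat) (n : nat) : Prop :=
  forall m, (1 <= m < n)%N -> (1 <= a m <= m)%N.

(* The initial 1 is the edge from v_i to its parent, or the loose edge of the
   root; only [a 1], ..., [a (n - 1)] are used. *)
Definition deg (a : nat -> nat) (n i : nat) : nat :=
  1 + \sum_(1 <= m < n) (a m == i).

Definition nb_deg (a : nat -> nat) (n k : nat) : nat :=
  \sum_(1 <= i < n.+1) (deg a n i == k).

Section empirical.
Context {R : realType}.

Definition attach_prob (f : nat -> R) (a : nat -> nat) (n i : nat) : R :=
  f (deg a n i) / \sum_(1 <= j < n.+1) f (deg a n j).

Definition Pdeg (a : nat -> nat) (n k : nat) : R := (nb_deg a n k)%:R / n%:R.

Definition Pdeg_gt (a : nat -> nat) (n k : nat) : R :=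
  \big[+%R/0]_(k.+1 <= l <oo) Pdeg a n l.

Definition Sdeg {V : normedModType R} (h : nat -> V) (a : nat -> nat)
    (n : nat) : V :=
  \big[+%R/0]_(1 <= k <oo) ((nb_deg a n k)%:R *: h k).

Definition pseudo_loglik (g : nat -> R) (a : nat -> nat) (n : nat) : R :=
  \big[+%R/0]_(1 <= k <oo) (ln (g k) * Pdeg_gt a n k) - ln (Sdeg g a n).

End empirical.

Section process.
Context {R : realType} {disp : measure_display} {T : measurableType disp}.

(* Since the history is discrete, the prescribed conditional law of the
   attachment of v_{n+1} given the past is stated as the product rule
   P(past and choice) = P(past) * P(choice | past). *)
Definition PA_tree (P : probability T R) (f : nat -> R)
    (A : nat -> T -> nat) : Prop :=
  [/\ forall n, (1 <= n)%N -> measurable_fun setT (A n),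
      forall n w, (1 <= n)%N -> (1 <= A n w <= n)%N &
      forall (n : nat) (a : nat -> nat), (1 <= n)%N -> is_history a n.+1 ->
        P [set w | forall m, (1 <= m <= n)%N -> A m w = a m] =
        (P [set w | forall m, (1 <= m < n)%N -> A m w = a m] *
         (attach_prob f a n (a n))%:E)%E].

End process.

Section parametric.
Context {R : realType} {d : nat}.
Implicit Types (f : 'rV[R]_d -> nat -> R) (Theta U : set 'rV[R]_d).

Definition partial (i : 'I_d) (g : 'rV[R]_d -> R) (x : 'rV[R]_d) : R :=
  'D_('e_i) g x.

Definition C2_on U (g : 'rV[R]_d -> R) : Prop :=
  [/\ forall x, U x -> differentiable g x,
      forall i x, U x -> differentiable (partial i g) x &
      forall i j x, U x -> {for x, continuous (partial j (partial i g))}].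

Definition grad f (theta : 'rV[R]_d) (k : nat) : 'rV[R]_d :=
  \row_i partial i (f^~ k) theta.

Definition pseudo_score f (a : nat -> nat) (n : nat) (theta : 'rV[R]_d)
    : 'rV[R]_d :=
  \big[+%R/0]_(1 <= k <oo) (Pdeg_gt a n k *: ((f theta k)^-1 *: grad f theta k))
  - (Sdeg (f theta) a n)^-1 *: Sdeg (grad f theta) a n.

Definition is_maximizer f Theta (a : nat -> nat) (n : nat)
    (theta : 'rV[R]_d) : Prop :=
  Theta theta /\
  forall theta', Theta theta' ->
    pseudo_loglik (f theta') a n <= pseudo_loglik (f theta) a n.

(* The score may have spurious zeros, even at a fixed theta for all n (replace
   theta by theta ^+ 3 in a one-dimensional family); as usual for likelihood
   equations, the estimator is a zero at which the criterion is largest.  The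
   last clause holds trivially when the zero is unique. *)
Definition is_score_zero f Theta (a : nat -> nat) (n : nat)
    (theta : 'rV[R]_d) : Prop :=
  [/\ Theta theta, pseudo_score f a n theta = 0 &
      forall theta', Theta theta' -> pseudo_score f a n theta' = 0 ->
        pseudo_loglik (f theta') a n <= pseudo_loglik (f theta) a n].

End parametric.

(* Main.v *)
(* Each step of the tree contributes [ln g] of the degree that it chooses, so the
   criterion at [g] is a time average of [ln g] over the chosen degrees minus the
   logarithm of the total weight.  A strong law for square-integrable martingales
   (Chebyshev along the squares, then interpolation) compares the frequency of the
   chosen degrees with its compensator, for indicators of a degree and for a test
   function of order [k ^ eta] that controls the tails uniformly.

   The degree fractions converge by a contraction argument: with all degrees [>= K]
   lumped together, the degree counts perturb a linear birth system run in the clock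
   [sum 1 / S], and its deviation from the stationary profile decays in an l1 norm
   weighted by reproductive values, because the births, at a rate bounded below
   on small degrees, all restart from degree 1.  Hence the fractions form a Cauchy
   sequence, and the frequency of the choice of degree [k] is asymptotically its
   current weight.

   Gibbs' inequality, with a quantitative gap, now makes the criterion at [theta0]
   exceed its values near any [theta] with [f theta] not proportional to [f theta0],
   and compactness confines the maximizers to neighbourhoods of [theta0].  Once they
   are interior they are zeros of the score, so a zero that maximizes the criterion
   among the zeros is a maximizer. *)

Require Import Defs.
From HB Require Import structures.
From mathcomp Require Import all_boot all_order all_algebra.
From mathcomp Require Import all_classical all_reals all_analysis.
From mathcomp Require Import lra ring zify.
Set Implicit Arguments.
Unset Strict Implicit.
Unset Printing Implicit Defensive.
Import Order.TTheory GRing.Theory Num.Theory.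
Import numFieldNormedType.Exports.
Local Open Scope classical_set_scope.
Local Open Scope ring_scope.

(** Both growth regimes enter only through [f k <= a * k + b], a total weight of at least
    [s1 * n - s2], and [a < s1]. For small [eta] still [a * (1 + eta) < s1], and then a moment of
    order [1 + eta] of the degrees, averaged over the nodes, stays bounded in time; every truncation
    rests on it. In the sublinear case any slope below [f 1] can serve as [a]; in the affine case
    [a = 1] and the total weight is exactly [(2 + alpha) * n - 1], so that [alpha > -1] gives the
    gap. The obstacle is the truncation level [K]: the noise is negligible for fixed [K] only, the
    lumping error for large [K] only, and the contraction weakens on high states, whose reproductive
    value may grow while their birth rate does not. The contraction rate is therefore read off the
    states up to an intermediate [K0], independently of [K], at the price of a tail term beyond
    [K0]. Growth rate and profile depend on [K] and their limit is never identified; bounds on the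
    eigenvectors that are uniform in [K] suffice for the Cauchy property. *)

Definition node_sum {V : zmodType} (h : nat -> V) (a : nat -> nat) (n : nat) : V :=
  \sum_(1 <= i < n.+1) h (deg a n i).

Definition chosen_deg (a : nat -> nat) (n : nat) : nat := deg a n (a n).

(** * Sums over the nodes, and the criterion as a time average *)

Section trees.
Implicit Types (a : nat -> nat) (n k i : nat).

Lemma is_historyW a m n : (m <= n)%N -> is_history a n -> is_history a m.
Proof. by move=> mn ha i /andP[i1 im]; apply: ha; rewrite i1 (leq_trans im). Qed.

Lemma deg_gt0 a n i : (0 < deg a n i)%N.
Proof. by []. Qed.

Lemma deg_le a n i : (0 < n)%N -> (deg a n i <= n)%N.
Proof.
move=> n0; rewrite /deg addnC; case: n n0 => // n _; rewrite addn1 ltnS.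
apply: (@leq_trans (\sum_(1 <= m < n.+1) 1)).
  by apply: leq_sum => m _; case: eqP.
by rewrite sum_nat_const_nat muln1 subSS subn0.
Qed.

Lemma deg_new a n : is_history a n.+1 -> deg a n.+1 n.+1 = 1%N.
Proof.
move=> ha; rewrite /deg big_nat_cond big1 // => m; rewrite andbT => hm.
have /andP[_ am] := ha _ hm; case: eqP => // e; move: am; rewrite e => /leq_ltn_trans.
by move=> /(_ n.+1); case/andP: hm => _ mn /(_ mn); rewrite ltnn.
Qed.

Lemma degS a n i : (0 < n)%N -> deg a n.+1 i = (deg a n i + (a n == i))%N.
Proof. by move=> n0; rewrite /deg big_nat_recr //= addnA. Qed.

Lemma is_history_choice a n : (0 < n)%N -> is_history a n.+1 -> (1 <= a n <= n)%N.
Proof. by move=> n0 ha; apply: ha; rewrite n0 leqnn. Qed.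

Section node_sum.
Context {V : zmodType}.
Implicit Types h : nat -> V.

Lemma node_sum_step h a n : (0 < n)%N -> is_history a n.+1 ->
  node_sum h a n.+1 =
  node_sum h a n + (h 1%N + (h (chosen_deg a n).+1 - h (chosen_deg a n))).
Proof.
move=> n0 ha; rewrite /node_sum big_nat_recr //= deg_new // (addrC (h 1%N)) addrA.
have hn := is_history_choice n0 ha; congr (_ + _).
apply/eqP; rewrite addrC -subr_eq -sumrB; apply/eqP.
rewrite (bigD1_seq (a n)) ?iota_uniq ?mem_index_iota //=.
rewrite degS // eqxx addn1 big1 ?addr0 // => i ian.
by rewrite degS // eq_sym (negbTE ian) addn0 subrr.
Qed.

Lemma node_sum1 h a : node_sum h a 1 = h 1%N.
Proof. by rewrite /node_sum big_nat1 /deg big_geq. Qed.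

Lemma eq_node_sum h h' a n : (forall k, (0 < k)%N -> h k = h' k) ->
  node_sum h a n = node_sum h' a n.
Proof. by move=> e; apply: eq_bigr => i _; apply: e. Qed.

Lemma node_sumD h h' a n :
  node_sum (fun k => h k + h' k) a n = node_sum h a n + node_sum h' a n.
Proof. exact: big_split. Qed.

Lemma node_sumB h h' a n :
  node_sum (fun k => h k - h' k) a n = node_sum h a n - node_sum h' a n.
Proof. exact: sumrB. Qed.

(** A step at a node of degree [k] replaces [H k] by [H k.+1] and adds a leaf worth [H 1 = 0], so
    the sum over the nodes grows by [h] of the chosen degree. This is the bridge between degree
    counts and time sums used throughout. *)
Lemma node_sum_telescope (H h : nat -> V) a n : (0 < n)%N -> is_history a n ->
  H 1%N = 0 -> (forall k, (0 < k)%N -> H k.+1 - H k = h k) ->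
  node_sum H a n = \sum_(1 <= i < n) h (chosen_deg a i).
Proof.
move=> + + H1 HS; elim: n => // -[_ _ _|n IHn _ ha].
  by rewrite node_sum1 H1 big_geq.
rewrite node_sum_step // IHn //; last exact: is_historyW (leqnSn _) ha.
by rewrite [in RHS]big_nat_recr //= H1 add0r HS.
Qed.

End node_sum.

Section real_sums.
Context {R : realType}.
Implicit Types h : nat -> R.

Lemma node_sum_cst (c : R) a n : node_sum (fun=> c) a n = n%:R * c.
Proof. by rewrite /node_sum sumr_const_nat subn1 mulr_natl. Qed.

Lemma node_sumZ (c : R) h a n : node_sum (fun k => c * h k) a n = c * node_sum h a n.
Proof. by rewrite /node_sum mulr_sumr. Qed.

Lemma node_sum_id a n : (0 < n)%N -> is_history a n ->
  node_sum (fun k => k%:R) a n = 2 * n%:R - 1 :> R.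
Proof.
elim: n => // -[_ _ _|n IHn _ ha]; first by rewrite node_sum1; ring.
rewrite node_sum_step // IHn //; last exact: is_historyW (leqnSn _) ha.
by rewrite -!natr1; ring.
Qed.

Lemma ler_node_sum h h' a n : (forall k, (0 < k)%N -> h k <= h' k) ->
  node_sum h a n <= node_sum h' a n.
Proof. by move=> hh; apply: ler_sum => i _; apply: hh. Qed.

Lemma node_sum_ge0 h a n : (forall k, (0 < k)%N -> 0 <= h k) -> 0 <= node_sum h a n.
Proof. by move=> h0; apply: sumr_ge0 => i _; apply: h0. Qed.

Lemma node_sum_gt0 h a n : (0 < n)%N -> (forall k, (0 < k)%N -> 0 < h k) ->
  0 < node_sum h a n.
Proof.
move=> n0 h0; rewrite /node_sum big_nat_recl //.
by rewrite ltr_pwDl ?h0 //; apply: sumr_ge0 => i _; apply/ltW/h0.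
Qed.

Lemma sum_node_sum_indicator (c : nat -> R) a m n :
  \sum_(1 <= k < m) c k * node_sum (fun d => (d == k)%:R) a n =
  node_sum (fun d => if (d < m)%N then c d else 0) a n.
Proof.
under eq_bigr do rewrite -node_sumZ; rewrite exchange_big /=; apply: eq_bigr => i _.
set d := deg a n i; case: ltnP => dm.
  rewrite (bigD1_seq d) ?mem_index_iota ?iota_uniq //= eqxx mulr1 big1 ?addr0 //.
  by move=> j; rewrite eq_sym => /negbTE ->; rewrite mulr0.
rewrite big_nat_cond big1 // => j /andP[/andP[_ jm] _].
by case: eqP => [dj|_]; rewrite ?mulr0 //; move: jm; rewrite -dj ltnNge dm.
Qed.

Lemma nb_degE a n k : (nb_deg a n k)%:R = node_sum (fun d => (d == k)%:R) a n :> R.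
Proof. by rewrite /nb_deg natr_sum. Qed.

End real_sums.

Section series.
Context {R : realType} {V : normedModType R}.
Implicit Types (u h : nat -> V).

Lemma series_finite_support u m N : (m <= N)%N -> (forall k, (N <= k)%N -> u k = 0) ->
  \big[+%R/0]_(m <= k <oo) u k = \sum_(m <= k < N) u k.
Proof.
move=> mN u0; apply/norm_lim_near_cst => //; exists N => // n /= Nn.
rewrite (@big_cat_nat _ _ _ N) //= [X in _ + X]big_nat_cond [X in _ + X]big1 ?addr0 //.
by move=> i /andP[/andP[/u0]].
Qed.

Lemma node_sum_scale h a n m N :
  \sum_(m <= k < N) ((nb_deg a n k)%:R : R) *: h k =
  node_sum (fun d => if (m <= d < N)%N then h d else 0) a n.
Proof.
under eq_bigr do rewrite nb_degE scaler_suml.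
rewrite exchange_big /=; apply: eq_bigr => i _.
set d := deg a n i; case: ifP => hd.
  rewrite (bigD1_seq d) ?iota_uniq ?mem_index_iota //= eqxx scale1r big1 ?addr0 //.
  by move=> k; rewrite eq_sym => /negbTE ->; rewrite scale0r.
rewrite big_nat_cond big1 // => k; rewrite andbT; case: eqP => [<-|]; rewrite ?hd //.
by rewrite scale0r.
Qed.

Lemma Sdeg_node_sum h a n : (0 < n)%N -> Sdeg h a n = node_sum h a n.
Proof.
move=> n0; rewrite /Sdeg (@series_finite_support _ _ n.+1) //.
  rewrite node_sum_scale; apply: eq_bigr => i _.
  by rewrite deg_gt0 ltnS deg_le.
move=> k nk; rewrite nb_degE /node_sum big1 ?scale0r // => i _.
case: eqP => // e; have := deg_le a i n0; rewrite e => /leq_trans/(_ (leqnn _)).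
by rewrite leqNgt nk.
Qed.

End series.

Section empirical_series.
Context {R : realType}.

Lemma Pdeg_gtE a n k : (0 < n)%N ->
  Pdeg_gt a n k = node_sum (fun d => (k < d)%N%:R) a n / n%:R :> R.
Proof.
move=> n0; rewrite /Pdeg_gt (@series_finite_support _ _ _ _ (maxn n k).+1).
- rewrite -mulr_suml; congr (_ / _).
  transitivity (\sum_(k.+1 <= l < (maxn n k).+1) (nb_deg a n l)%:R *: (1 : R)).
    by apply: eq_bigr => l _; rewrite /GRing.scale /= mulr1.
  rewrite node_sum_scale; apply: eq_bigr => i _.
  by rewrite ltnS (leq_trans (deg_le a i n0)) ?leq_maxl // andbT; case: ifP.
- by rewrite ltnS leq_maxr.
- move=> l hl; rewrite /Pdeg nb_degE /node_sum big1 ?mul0r // => i _.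
  case: eqP => // e; have := deg_le a i n0; rewrite e leqNgt.
  by rewrite (leq_trans _ hl) // ltnS leq_maxl.
Qed.

Lemma Pdeg_gt_chosen a n k : (0 < n)%N -> is_history a n -> (0 < k)%N ->
  Pdeg_gt a n k = (\sum_(1 <= i < n) (chosen_deg a i == k)%:R) / n%:R :> R.
Proof.
move=> n0 ha k0; rewrite Pdeg_gtE //; congr (_ / _).
apply: (node_sum_telescope (h := fun d => (d == k)%:R)) => //.
  by rewrite ltnNge k0.
move=> d d0; rewrite ltnS; case: (ltngtP d k) => h; rewrite ?subrr ?subr0 //.
Qed.

(** Telescoping with [H d] the sum of [v k] over [k < d]. Vector values of [v] let one statement
    serve the criterion and the score. *)
Lemma Pdeg_gt_series {V : normedModType R} (v : nat -> V) a n :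
  (0 < n)%N -> is_history a n ->
  \big[+%R/0]_(1 <= k <oo) (Pdeg_gt a n k *: v k) =
  n%:R^-1 *: \sum_(1 <= i < n) v (chosen_deg a i).
Proof.
move=> n0 ha; rewrite (@series_finite_support _ _ _ _ n.+1) //; last first.
  move=> k nk; rewrite Pdeg_gtE // /node_sum big1 ?mul0r ?scale0r // => i _.
  by rewrite ltnNge (leq_trans (deg_le a i n0)) // ltnW.
rewrite -(@node_sum_telescope _ (fun d => \sum_(1 <= k < d) v k)) //; last 2 first.
- by rewrite big_geq.
- by move=> k k0; rewrite big_nat_recr //= addrAC subrr add0r.
under eq_bigr do rewrite Pdeg_gtE // mulrC -scalerA.
rewrite -scaler_sumr; congr (_ *: _); under eq_bigr do rewrite scaler_suml.
rewrite exchange_big /=; apply: eq_bigr => i _.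
have dn := leqW (deg_le a i n0).
rewrite (@big_cat_nat _ _ _ (deg a n i)) //= [X in _ + X]big_nat_cond [X in _ + X]big1 ?addr0.
  apply: eq_big_nat => k /andP[_ ->].
  by rewrite scale1r.
by move=> k /andP[/andP[dk _] _]; rewrite ltnNge dk scale0r.
Qed.

Lemma pseudo_loglikE (g : nat -> R) a n : (0 < n)%N -> is_history a n ->
  pseudo_loglik g a n =
  n%:R^-1 * \sum_(1 <= i < n) ln (g (chosen_deg a i)) - ln (node_sum g a n).
Proof.
move=> n0 ha; rewrite /pseudo_loglik Sdeg_node_sum //; congr (_ - _).
rewrite -[RHS](Pdeg_gt_series (fun k => ln (g k) : R^o)) //.
by congr (lim _); congr (_ @ \oo); apply/funext => m; apply: eq_bigr => i _; rewrite mulrC.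
Qed.

End empirical_series.
End trees.

(** * Conditional expectations along histories, and their link with [P] *)

Definition set_choice (a : nat -> nat) (n j : nat) : nat -> nat :=
  fun m => if m == n then j else a m.

(* Given that the first [m] attachments are those of [a], this is the conditional
   expectation of [F], a function of the first [m + k] attachments. *)
Fixpoint history_mean {R : realType} (f : nat -> R) (F : (nat -> nat) -> R)
    (k m : nat) (a : nat -> nat) : R :=
  if k is k'.+1 then
    \sum_(j < m.+1) attach_prob f a m.+1 j.+1 *
      history_mean f F k' m.+1 (set_choice a m.+1 j.+1)
  else F a.

Section history_mean.
Context {R : realType}.
Context (f : nat -> R) (f_gt0 : forall k, (0 < k)%N -> 0 < f k).
Implicit Types (a b : nat -> nat) (F : (nat -> nat) -> R).

Lemma set_choice_history a m j : is_history a m.+1 -> (1 <= j <= m.+1)%N ->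
  is_history (set_choice a m.+1 j) m.+2.
Proof.
move=> ha hj i /andP[i1 im]; rewrite /set_choice; case: eqP => [->//|/eqP ne].
by apply: ha; rewrite i1 ltn_neqAle ne -ltnS.
Qed.

Lemma attach_prob_ge0 a n i : 0 <= attach_prob f a n i.
Proof.
by rewrite /attach_prob divr_ge0 ?sumr_ge0// => *; exact/ltW/f_gt0.
Qed.

Lemma history_mean_le F F' k m a : is_history a m.+1 ->
  (forall b, is_history b (m + k).+1 -> F b <= F' b) ->
  history_mean f F k m a <= history_mean f F' k m a.
Proof.
elim: k m a => [|k IHk] m a ha hF /=; first by apply: hF; rewrite addn0.
apply: ler_sum => j _; apply: ler_wpM2l; first exact: attach_prob_ge0.
apply: IHk => [|b]; last by rewrite addSnnS; apply: hF.
by apply: set_choice_history; rewrite //= ltn_ord.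
Qed.

Lemma history_meanD F F' k m a :
  history_mean f (fun b => F b + F' b) k m a =
  history_mean f F k m a + history_mean f F' k m a.
Proof.
elim: k m a => //= k IHk m a; rewrite -big_split /=.
by apply: eq_bigr => j _; rewrite IHk mulrDr.
Qed.

Lemma history_meanZ (c : R) F k m a :
  history_mean f (fun b => c * F b) k m a = c * history_mean f F k m a.
Proof.
elim: k m a => //= k IHk m a; rewrite mulr_sumr.
by apply: eq_bigr => j _; rewrite IHk mulrCA.
Qed.

Lemma sum_attach_prob (h : nat -> R) a n :
  \sum_(j < n) attach_prob f a n j.+1 * h (deg a n j.+1) =
  node_sum (fun k => h k * f k) a n / node_sum f a n.
Proof.
rewrite /node_sum big_add1 /= big_mkord mulr_suml; apply: eq_bigr => j _.
by rewrite /attach_prob mulrAC (mulrC (f _)).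
Qed.

Lemma sum_attach_prob1 a n : (0 < n)%N -> \sum_(j < n) attach_prob f a n j.+1 = 1.
Proof.
move=> n0; rewrite -(eq_bigr _ (fun _ _ => mulr1 _)) (sum_attach_prob (fun=> 1)).
under eq_node_sum do rewrite mul1r.
by rewrite divff // gt_eqF // node_sum_gt0.
Qed.

Lemma history_mean_cst (c : R) k m a : history_mean f (fun=> c) k m a = c.
Proof.
elim: k m a => //= k IHk m a; under eq_bigr do rewrite IHk.
by rewrite -mulr_suml sum_attach_prob1 // mul1r.
Qed.

(** Iterates a one-step inequality. The factors [b] are kept because the drift of the degree moments
    is multiplicative; the squared martingale has factor 1. *)
Lemma history_mean_supermartingale (Z : nat -> (nat -> nat) -> R) (b : nat -> R) :
  (forall m, 0 <= b m) ->
  (forall m a, is_history a m.+1 ->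
    \sum_(j < m.+1) attach_prob f a m.+1 j.+1 * Z m.+1 (set_choice a m.+1 j.+1)
      <= b m * Z m a) ->
  forall k m a, is_history a m.+1 ->
  history_mean f (Z (m + k)%N) k m a <= (\prod_(m <= i < m + k) b i) * Z m a.
Proof.
move=> b0 hZ; elim=> [|k IHk] m a ha.
  by rewrite /= addn0 big_geq // mul1r.
rewrite /= big_ltn ?addnS ?ltnS ?leq_addr // (mulrC (b m)) -mulrA.
have b0' : 0 <= \prod_(m.+1 <= i < (m + k).+1) b i by apply: prodr_ge0.
apply: le_trans (ler_wpM2l b0' (hZ m a ha)); rewrite mulr_sumr; apply: ler_sum => j _.
rewrite mulrCA; apply: ler_wpM2l; first exact: attach_prob_ge0.
by rewrite -addSn; apply: IHk; apply: set_choice_history; rewrite //= ltn_ord.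
Qed.

End history_mean.

Section history_probability.
Context {R : realType} {disp : measure_display} {T : measurableType disp}.
Context (P : probability T R) (f : nat -> R) (A : nat -> T -> nat)
  (A_PA : PA_tree P f A).

Let cylinder m (a : nat -> nat) : set T :=
  [set w | forall i, (1 <= i < m.+1)%N -> A i w = a i].

Let measurable_choice n j : (1 <= n)%N -> measurable [set w | A n w = j].
Proof.
move=> n1; have [mA _ _] := A_PA.
have -> : [set w | A n w = j] = setT `&` A n @^-1` [set j].
  by apply/seteqP; split => w /=; [move=> ->|case].
exact: mA.
Qed.

Let measurable_cylinder m a : measurable (cylinder m a).
Proof.
elim: m => [|m IHm].
  have -> : cylinder 0 a = setT; last exact: measurableT.
  by apply/seteqP; split => w //= _ [|i].
have -> : cylinder m.+1 a = cylinder m a `&` [set w | A m.+1 w = a m.+1].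
  apply/seteqP; split => w /=.
    move=> h; split; last by apply: h; rewrite ltnS leqnn.
    by move=> i /andP[i1 im]; apply: h; rewrite i1 ltnW.
  move=> [h e] i /andP[i1]; rewrite ltnS leq_eqVlt => /predU1P[->//|im].
  by apply: h; rewrite i1.
exact/measurableI/measurable_choice.
Qed.

Let cylinder_step m (a : nat -> nat) j : is_history a m.+1 -> (1 <= j <= m.+1)%N ->
  P (cylinder m.+1 (set_choice a m.+1 j)) =
  (P (cylinder m a) * (attach_prob f a m.+1 j)%:E)%E.
Proof.
move=> ha hj; have [_ _ /(_ m.+1 (set_choice a m.+1 j) isT)] := A_PA.
move=> /(_ (set_choice_history ha hj)); rewrite /cylinder.
have low i : (i < m.+1)%N -> set_choice a m.+1 j i = a i.
  by rewrite /set_choice; case: eqP => // ->; rewrite ltnn.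
have dlow i : deg (set_choice a m.+1 j) m.+1 i = deg a m.+1 i.
  by congr addn; apply: eq_big_nat => l /andP[_ lm]; rewrite low.
rewrite /attach_prob dlow.
under eq_bigr do rewrite dlow.
rewrite {3}/set_choice eqxx => ->; congr (P _ * _)%E.
by apply/seteqP; split => w /= h i hi; rewrite h // low //; case/andP: hi.
Qed.

(** Splitting the cylinder by the next choice reproduces the recursion of [history_mean], since each
    piece is again a cylinder, with probability given by the product rule. Measurability is carried
    along because it comes from the same finite union. *)
Lemma measure_history (Q : (nat -> nat) -> bool) k :
  forall m, (forall b b', (forall i, (1 <= i <= m + k)%N -> b i = b' i) -> Q b = Q b') ->
  forall a, is_history a m.+1 ->
  measurable ([set w | Q (A^~ w)] `&` cylinder m a) /\
  P ([set w | Q (A^~ w)] `&` cylinder m a) =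
  (P (cylinder m a) * (history_mean f (fun b => (Q b)%:R) k m a)%:E)%E.
Proof.
elim: k => [|k IHk] m hQ a ha /=.
  have QE w : cylinder m a w -> Q (A^~ w) = Q a.
    by move=> cw; apply: hQ => i; rewrite addn0 => hi; apply: cw; rewrite ltnS.
  case Qa: (Q a) QE => QE.
    rewrite mule1 (_ : _ `&` _ = cylinder m a); first by split.
    by apply/seteqP; split => w /= => [[]//|cw]; rewrite QE.
  rewrite mule0 (_ : _ `&` _ = set0) ?measure0; first by split.
  by apply/seteqP; split => w //= -[Qw /QE]; rewrite Qw.
pose F (j : 'I_m.+1) := [set w | Q (A^~ w)] `&` cylinder m.+1 (set_choice a m.+1 j.+1).
have IH (j : 'I_m.+1) : measurable (F j) /\ P (F j) =
   (P (cylinder m a) * (attach_prob f a m.+1 j.+1 *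
      history_mean f (fun b => (Q b)%:R) k m.+1 (set_choice a m.+1 j.+1))%:E)%E.
  have hj : (1 <= j.+1 <= m.+1)%N by rewrite /= ltn_ord.
  have hb := set_choice_history ha hj.
  have [|mF ->] := IHk m.+1 _ _ hb.
    by move=> b b' e; apply: hQ => i; rewrite -addSnnS; apply: e.
  by split=> //; rewrite (cylinder_step ha hj) [in RHS]EFinM muleA.
have cupE : [set w | Q (A^~ w)] `&` cylinder m a = \big[setU/set0]_(j < m.+1) F j.
  rewrite -(bigcup_mkord_ord F); apply/seteqP; split => w /=.
    move=> [Qw cw]; have [_ Ale _] := A_PA.
    have /andP[A1 Am] := Ale m.+1 w isT.
    have jlt : ((A m.+1 w).-1 < m.+1)%N by rewrite prednK.
    exists (A m.+1 w).-1 => //; rewrite /F inordK //; split => // i /andP[i1 im].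
    rewrite /set_choice; case: eqP => [->|/eqP ne]; first by rewrite prednK.
    by apply: cw; rewrite i1 ltn_neqAle ne -ltnS.
  move=> [j jm [Qw cw]]; split => // i /andP[i1 im].
  rewrite cw; last by rewrite i1 ltnW.
  by rewrite /set_choice; case: eqP im => // ->; rewrite ltnn.
rewrite cupE; split; first by apply: bigsetU_measurable => j _; case: (IH j).
rewrite measure_bigsetU_ord => [|j|]; last 2 first.
- by case: (IH j).
- move=> i j _ _ [w [[_ ci] [_ cj]]].
  have := ci m.+1; rewrite ltnS leqnn => /(_ isT); rewrite cj ?ltnS ?leqnn //.
  by rewrite /set_choice eqxx => -[] ij; apply: val_inj.
transitivity (\sum_(j < m.+1) P (F j))%E; first by [].
rewrite (eq_bigr _ (fun j _ => (IH j).2)).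
have /fineK <- : P (cylinder m a) \is a fin_num by apply: fin_num_measure.
by under eq_bigr do rewrite -EFinM; rewrite sumEFin -EFinM mulr_sumr.
Qed.

End history_probability.

(** * The compensated sums and their second moment *)

Definition attach_mean {R : realType} (f h : nat -> R) (a : nat -> nat) (n : nat) : R :=
  node_sum (fun k => h k * f k) a n / node_sum f a n.

Definition compensated {R : realType} (f h : nat -> R) (a : nat -> nat) (n : nat) : R :=
  \sum_(1 <= i < n) (h (chosen_deg a i) - attach_mean f h a i).

Section compensated.
Context {R : realType} (f : nat -> R) (f_gt0 : forall k, (0 < k)%N -> 0 < f k).
Implicit Types (a b : nat -> nat) (h : nat -> R).

Lemma eq_deg a b n i : (forall l, (1 <= l < n)%N -> a l = b l) -> deg a n i = deg b n i.
Proof. by move=> ab; congr addn; apply: eq_big_nat => l /ab ->. Qed.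

Lemma eq_node_sum_path {V : zmodType} (h : nat -> V) a b n :
  (forall l, (1 <= l < n)%N -> a l = b l) -> node_sum h a n = node_sum h b n.
Proof. by move=> ab; apply: eq_bigr => i _; rewrite (eq_deg _ ab). Qed.

Lemma eq_chosen_deg a b n : (forall l, (1 <= l <= n)%N -> a l = b l) -> (0 < n)%N ->
  chosen_deg a n = chosen_deg b n.
Proof.
move=> ab n0; rewrite /chosen_deg ab ?n0 ?leqnn //; apply: eq_deg => l /andP[l1 ln].
by rewrite ab // l1 ltnW.
Qed.

Lemma eq_attach_mean h a b n :
  (forall l, (1 <= l < n)%N -> a l = b l) -> attach_mean f h a n = attach_mean f h b n.
Proof. by move=> ab; rewrite /attach_mean !(eq_node_sum_path _ ab). Qed.

Lemma eq_compensated h a b n :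
  (forall l, (1 <= l < n)%N -> a l = b l) -> compensated f h a n = compensated f h b n.
Proof.
move=> ab; apply: eq_big_nat => i /andP[i1 im].
rewrite (@eq_chosen_deg a b) // => [|l /andP[l1 li]]; last first.
  by rewrite ab // l1 (leq_ltn_trans li).
by rewrite (@eq_attach_mean _ a b) // => l /andP[l1 li]; rewrite ab // l1 (ltn_trans li).
Qed.

Lemma set_choice_lt a n j l : (l < n)%N -> set_choice a n j l = a l.
Proof. by rewrite /set_choice; case: eqP => // ->; rewrite ltnn. Qed.

Lemma chosen_deg_set_choice a n j : chosen_deg (set_choice a n j) n = deg a n j.
Proof.
rewrite /chosen_deg {2}/set_choice eqxx; apply: eq_deg => l /andP[_].
exact: set_choice_lt.
Qed.

Lemma attach_mean_ge0 h a n : (forall k, (0 < k)%N -> 0 <= h k) -> 0 <= attach_mean f h a n.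
Proof.
move=> h0; rewrite /attach_mean divr_ge0 //; apply: node_sum_ge0 => k k0.
  by rewrite mulr_ge0 ?h0 // ltW // f_gt0.
by rewrite ltW // f_gt0.
Qed.

Context (h h2 H2 : nat -> R) (kappa c : R).
Context (H2_1 : H2 1%N = 0) (H2S : forall k, (0 < k)%N -> H2 k.+1 - H2 k = h2 k).
Context (h_le : forall k, (0 < k)%N -> h k ^+ 2 <= h2 k).
Context (kappa_ge0 : 0 <= kappa) (kappa_lt1 : kappa < 1) (c_ge0 : 0 <= c).
Context (drift : forall a n, (0 < n)%N -> is_history a n ->
  attach_mean f h2 a n <= kappa / n%:R * node_sum H2 a n + c).

Let node_sum_choice a m (j : 'I_m.+1) : is_history a m.+1 ->
  node_sum H2 (set_choice a m.+1 j.+1) m.+2 = node_sum H2 a m.+1 + h2 (deg a m.+1 j.+1).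
Proof.
move=> ha; rewrite node_sum_step //; last first.
  by apply: set_choice_history; rewrite //= ltn_ord.
rewrite H2_1 add0r chosen_deg_set_choice H2S ?deg_gt0 //; congr (_ + _).
by apply: eq_node_sum_path => l /andP[_]; apply: set_choice_lt.
Qed.

(** [C = c / (1 - kappa)] solves [C = kappa * C + c], so subtracting [C * m.+1] turns the drift
    bound into a purely multiplicative one. The initial value is [- C <= 0], hence the product of
    the factors need not be estimated. *)
Lemma history_mean_node_sum_le k a : is_history a 1 ->
  history_mean f (fun b => node_sum H2 b k.+1) k 0 a <= c / (1 - kappa) * k.+1%:R.
Proof.
move=> ha; have k1 : 0 < 1 - kappa by rewrite subr_gt0.
set C := c / (1 - kappa).
pose Z (m : nat) b := node_sum H2 b m.+1 - C * m.+1%:R.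
have := @history_mean_supermartingale _ f f_gt0 Z (fun m => 1 + kappa / m.+1%:R) _ _ k 0 a ha.
have C0 : 0 <= C by rewrite divr_ge0 // ltW.
rewrite add0n => Zle.
have : history_mean f (Z k) k 0 a <= 0.
  apply: le_trans (Zle _ _) _.
  - by move=> m; rewrite addr_ge0 ?divr_ge0.
  - move=> m b hb.
    under eq_bigr => j _ do rewrite {1}/Z node_sum_choice // -addrA mulrDr.
    rewrite big_split /= -mulr_suml sum_attach_prob1 // mul1r.
    under eq_bigr => j _ do rewrite mulrBr.
    rewrite sumrB -mulr_suml sum_attach_prob1 // mul1r sum_attach_prob.
    have := drift (isT : 0 < m.+1)%N hb; rewrite /attach_mean /Z.
    set W := node_sum H2 b m.+1; set X := _ / node_sum f b m.+1 => hX.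
    have -> : m.+2%:R = m.+1%:R + 1 :> R by rewrite -natr1.
    have Cc : C * (1 - kappa) = c by rewrite /C divfK // gt_eqF.
    have -> : (1 + kappa / m.+1%:R) * (W - C * m.+1%:R) =
      W + kappa / m.+1%:R * W - C * m.+1%:R - C * kappa.
      have : m.+1%:R != 0 :> R by rewrite pnatr_eq0.
      by move: (m.+1%:R : R) => n n0; field.
    by move: hX Cc; move: (kappa / m.+1%:R * W) (m.+1%:R : R) => q n; lra.
  - apply: mulr_ge0_le0; first by apply: prodr_ge0 => i _; rewrite addr_ge0 ?divr_ge0.
    by rewrite /Z node_sum1 H2_1; lra.
rewrite (_ : Z k = fun b => node_sum H2 b k.+1 + - (C * k.+1%:R)) //.
rewrite (history_meanD f (fun b => node_sum H2 b k.+1) (fun=> - (C * k.+1%:R))).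
by rewrite history_mean_cst // subr_le0.
Qed.

(** The conditional variance of a step is at most the mean of [h ^+ 2], hence of [h2], which is the
    mean increment of [node_sum H2]. So the square minus [node_sum H2] is a supermartingale;
    choosing [H2] as a primitive of [h2] is what makes the variance a sum over the nodes. *)
Lemma history_mean_compensated_sqr k a : is_history a 1 ->
  history_mean f (fun b => compensated f h b k.+1 ^+ 2) k 0 a <= c / (1 - kappa) * k.+1%:R.
Proof.
move=> ha; apply: le_trans (history_mean_node_sum_le k ha).
pose Z (m : nat) b := compensated f h b m.+1 ^+ 2 - node_sum H2 b m.+1.
have := @history_mean_supermartingale _ f f_gt0 Z (fun=> 1) _ _ k 0 a ha.
rewrite add0n => Zle.
have : history_mean f (Z k) k 0 a <= 0.
  apply: le_trans (Zle _ _) _ => // [m b hb|]; last first.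
    by rewrite /Z node_sum1 H2_1 [compensated _ _ _ _]big_geq // expr0n /= subr0 mulr0.
  rewrite mul1r; pose mu := attach_mean f h b m.+1; pose M := compensated f h b m.+1.
  pose p (j : 'I_m.+1) := attach_prob f b m.+1 j.+1.
  pose x (j : 'I_m.+1) := h (deg b m.+1 j.+1).
  have ME (j : 'I_m.+1) :
      compensated f h (set_choice b m.+1 j.+1) m.+2 = M + (x j - mu).
    rewrite /compensated big_nat_recr //= chosen_deg_set_choice.
    rewrite (@eq_attach_mean _ (set_choice b m.+1 j.+1) b); last first.
      by move=> l /andP[_]; apply: set_choice_lt.
    by congr (_ + _); apply: eq_compensated => l /andP[_]; apply: set_choice_lt.
  have p1 : \sum_j p j = 1 by exact: sum_attach_prob1.
  have pmu : \sum_j p j * x j = mu by exact: sum_attach_prob.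
  have -> : Z m b = \sum_j p j * (M ^+ 2 + 2 * M * (x j - mu) - node_sum H2 b m.+1).
    under eq_bigr => j _.
      rewrite (_ : p j * _ =
        p j * (M ^+ 2 - node_sum H2 b m.+1 - 2 * M * mu) + 2 * M * (p j * x j)); last by ring.
      over.
    by rewrite big_split /= -mulr_suml -mulr_sumr p1 pmu /Z -/M; ring.
  rewrite -subr_ge0 -sumrB.
  under eq_bigr => j _.
    rewrite /Z ME node_sum_choice // (_ : _ - _ =
      p j * (h2 (deg b m.+1 j.+1) - x j ^+ 2) + (2 * mu * (p j * x j) - mu ^+ 2 * p j)).
      over.
    by rewrite /p; ring.
  rewrite big_split /= sumrB -!mulr_sumr p1 pmu.
  have -> : 2 * mu * mu - mu ^+ 2 * 1 = mu ^+ 2 by ring.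
  rewrite addr_ge0 ?sqr_ge0 ?sumr_ge0 // => j _.
  by rewrite mulr_ge0 ?attach_prob_ge0 // subr_ge0 h_le // deg_gt0.
rewrite (_ : Z k = fun b => compensated f h b k.+1 ^+ 2 + - 1 * node_sum H2 b k.+1); last first.
  by apply/funext => b; rewrite mulN1r.
rewrite (history_meanD f (fun b => compensated f h b k.+1 ^+ 2)
  (fun b => - 1 * node_sum H2 b k.+1)).
by rewrite (history_meanZ f (- 1) (fun b => node_sum H2 b k.+1)) mulN1r subr_le0.
Qed.

End compensated.

Section strong_law.
Context {R : realType} {disp : measure_display} {T : measurableType disp}.
Context (P : probability T R) (f : nat -> R) (f_gt0 : forall k, (0 < k)%N -> 0 < f k).
Context (A : nat -> T -> nat) (A_PA : PA_tree P f A).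
Context (h h2 H2 : nat -> R) (kappa c : R).
Context (H2_1 : H2 1%N = 0) (H2S : forall k, (0 < k)%N -> H2 k.+1 - H2 k = h2 k).
Context (h_le : forall k, (0 < k)%N -> h k ^+ 2 <= h2 k).
Context (kappa_ge0 : 0 <= kappa) (kappa_lt1 : kappa < 1) (c_ge0 : 0 <= c).
Context (drift : forall a n, (0 < n)%N -> is_history a n ->
  attach_mean f h2 a n <= kappa / n%:R * node_sum H2 a n + c).

Lemma compensated_chebyshev (e : R) k : 0 < e ->
  measurable [set w | e * k.+1%:R <= `|compensated f h (A^~ w) k.+1|] /\
  (P [set w | (e * k.+1%:R <= `|compensated f h (A^~ w) k.+1|)%R] <=
    (c / (1 - kappa) / e ^+ 2 / k.+1%:R)%:E)%E.
Proof.
move=> e0; pose a0 := fun _ : nat => 1%N.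
have ha0 : is_history a0 1 by move=> m /andP[/leq_trans/[apply]].
pose Q b := e * k.+1%:R <= `|compensated f h b k.+1|.
have Qdep b b' : (forall i, (1 <= i <= 0 + k)%N -> b i = b' i) -> Q b = Q b'.
  by move=> bb; rewrite /Q (@eq_compensated _ _ _ b b') // => i; rewrite ltnS; apply: bb.
have [] := measure_history A_PA Qdep ha0.
have -> : [set w | forall i, (1 <= i < 1)%N -> A i w = a0 i] = setT.
  by apply/seteqP; split => // w _ i /andP[/leq_trans/[apply]].
rewrite setIT probability_setT mul1e => mQ PQ; split => //.
rewrite PQ lee_fin.
have k0 : 0 < k.+1%:R :> R by rewrite ltr0n.
have ek : 0 < (e * k.+1%:R) ^+ 2 by rewrite exprn_gt0 // mulr_gt0.
apply: (@le_trans _ _ (history_mean f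
  (fun b => ((e * k.+1%:R) ^+ 2)^-1 * compensated f h b k.+1 ^+ 2) k 0 a0)).
  apply: history_mean_le => // b _; case: (boolP (Q b)) => [Qb|_] /=; last first.
    by rewrite mulr_ge0 ?invr_ge0 ?sqr_ge0.
  rewrite mulrC ler_pdivlMr // mul1r -[leRHS]real_normK ?num_real //.
  by rewrite lerXn2r // nnegrE ltW // mulr_gt0.
rewrite history_meanZ.
have M2 := history_mean_compensated_sqr f_gt0 H2_1 H2S h_le kappa_ge0 kappa_lt1 c_ge0
  drift k ha0.
apply: le_trans (ler_wpM2l _ M2) _; first by rewrite invr_ge0 ltW.
rewrite le_eqVlt; apply/orP; left; apply/eqP.
have := lt0r_neq0 k0; move: (k.+1%:R : R) => n n0.
by field; rewrite n0 !gt_eqF // subr_gt0.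
Qed.

End strong_law.

(** * The strong law: Chebyshev along the squares, then interpolation *)

Lemma between_squares n : exists m, (m ^ 2 <= n < m.+1 ^ 2)%N.
Proof.
elim: n => [|n [m /andP[mn nm]]]; first by exists 0%N.
case: (ltnP n.+1 (m.+1 ^ 2)) => h; first by exists m; rewrite h leqW.
exists m.+1; rewrite h /=; apply: (leq_ltn_trans nm).
by rewrite ltn_exp2r.
Qed.

Section interpolation.
Context {R : realType}.

Lemma cvg0_of_small (u : nat -> R) (C : R) : 0 < C ->
  (forall e, 0 < e -> \forall n \near \oo, `|u n| <= C * e) -> u @ \oo --> 0.
Proof.
move=> C0 hu; apply/cvgrPdist_le => e e0.
have := hu (e / C) (divr_gt0 e0 C0); apply: filterS => n.
by rewrite sub0r normrN mulrC divfK // gt_eqF.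
Qed.

Lemma nearN_ge (e : R) : 0 < e -> \forall n \near \oo, 1 <= e * n%:R.
Proof.
move=> e0; near=> n; rewrite mulrC -ler_pdivrMr // mul1r.
near: n; exact: nbhs_infty_ger.
Unshelve. all: by end_near. Qed.

Lemma near_sum_norm_le (u : nat -> nat -> R) m (s : R) :
  (forall k, (0 < k)%N -> u k @ \oo --> 0) -> 0 < s ->
  \forall n \near \oo, \sum_(1 <= k < m) `|u k n| <= s.
Proof.
move=> hu; elim: m s => [|m IHm] s s0.
  by apply: nearW => n; rewrite big_geq // ltW.
case: m IHm => [|m] IHm; first by apply: nearW => n; rewrite big_geq // ltW.
have s2 : 0 < s / 2 by rewrite divr_gt0.
have /cvgrPdist_le/(_ _ s2) := hu m.+1 isT.
apply: filterS2 (IHm _ s2) => n h1; rewrite sub0r normrN => h2.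
by rewrite big_nat_recr //= [s]splitr lerD.
Qed.

(** As [x] and [mu] are nonnegative, inside a block from [p ^ 2] to [p.+1 ^ 2] the sum [M] can drop
    by at most the total of [mu] over the block. This bounds [M n] from below by its value at the
    left end and from above by its value at the right end. The fourth-root bound makes the total at
    most [2 * p + 1] times the square root of [p.+1], which is negligible against [p ^ 2]. *)
Lemma cvg0_between_squares (x mu : nat -> R) :
  (forall i, (0 < i)%N -> 0 <= x i) -> (forall i, (0 < i)%N -> 0 <= mu i) ->
  (forall i, (0 < i)%N -> mu i <= Num.sqrt (Num.sqrt i%:R)) ->
  let M n := \sum_(1 <= i < n) (x i - mu i) in
  (forall e, 0 < e -> exists m0, forall m, (m0 <= m)%N ->
     `|M (m.+1 ^ 2)%N| <= e * (m.+1 ^ 2)%:R) ->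
  (fun n => M n / n%:R) @ \oo --> 0.
Proof.
move=> x0 mu0 mu_le M hM; apply: (@cvg0_of_small _ 5) => // e e0.
have [m0 hm0] := hM e e0.
(* From [1 <= e ^+ 2 / 18 * p] and [p + 1 <= 2 * p] the square root of [p + 1] is at most
   [e / 3 * p], so the block total is at most [e * p ^ 2]. The constant 5 adds the factor 4 by which
   [p.+1 ^ 2] may exceed [p ^ 2]. *)
have e2 : 0 < e ^+ 2 / 18 by rewrite divr_gt0 // exprn_gt0.
have [m1 _ hm1] := nearN_ge e2.
exists ((maxn m0 m1).+2 ^ 2)%N => // n /= hn.
have [p /andP[pn np]] := between_squares n.
have pm : (maxn m0 m1 < p)%N.
  by have := leq_ltn_trans hn np; rewrite ltn_exp2r // ltnS => /ltnW.
have p0 : (0 < p)%N by exact: leq_trans pm.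
have n0 : 0 < n%:R :> R by rewrite ltr0n (leq_trans _ pn) // expn_gt0 p0.
rewrite normrM [X in _ * X]gtr0_norm ?invr_gt0 // ler_pdivrMr //.
have pR : 1 <= e ^+ 2 / 18 * p%:R :> R.
  by apply: hm1 => /=; apply: leq_trans (ltnW pm); apply: leq_maxr.
have pR1 : 1 <= p%:R :> R by rewrite ler1n.
have Mlo : `|M (p ^ 2)%N| <= e * p%:R ^+ 2.
  have := hm0 p.-1; rewrite prednK // -natrX; apply.
  by rewrite -ltnS prednK // (leq_ltn_trans (leq_maxl m0 m1)).
have Mhi : `|M (p.+1 ^ 2)%N| <= e * (4 * p%:R ^+ 2).
  have := hm0 p; rewrite natrX => /(_ (leq_trans (leq_maxl _ _) (ltnW pm))).
  move/le_trans; apply; rewrite ler_pM2l // -natr1; nra.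
pose B := \sum_((p ^ 2)%N <= i < (p.+1 ^ 2)%N) mu i.
have p2 : (0 < p ^ 2)%N by rewrite expn_gt0 p0.
have B_le : B <= e * p%:R ^+ 2.
  apply: (@le_trans _ _ (\sum_((p ^ 2)%N <= i < (p.+1 ^ 2)%N) Num.sqrt p.+1%:R)).
    apply: ler_sum_nat => i /andP[i1 i2].
    apply: le_trans (mu_le i (leq_trans p2 i1)) _.
    rewrite ler_sqrt ?ler0n // -(@ger0_norm _ p.+1%:R) ?ler0n // -sqrtr_sqr.
    by rewrite ler_sqrt ?sqr_ge0 // -natrX ler_nat ltnW.
  rewrite sumr_const_nat (_ : (p.+1 ^ 2 - p ^ 2 = 2 * p + 1)%N); last by lia.
  rewrite -[leLHS]mulr_natl natrD natrM.
  have sq : Num.sqrt p.+1%:R <= e / 3 * p%:R :> R.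
    rewrite -[leRHS]ger0_norm; last by rewrite mulr_ge0 ?divr_ge0 // ltW.
    rewrite -sqrtr_sqr ler_sqrt ?sqr_ge0 // -natr1; nra.
  have s0 : 0 <= Num.sqrt p.+1%:R :> R by exact: sqrtr_ge0.
  apply: (@le_trans _ _ (3 * p%:R * (e / 3 * p%:R))).
    by apply: ler_pM => //; lra.
  by rewrite le_eqVlt; apply/orP; left; apply/eqP; field.
have pieces i j : (0 < i)%N -> (i <= j)%N -> M j = M i + \sum_(i <= l < j) (x l - mu l).
  by move=> i0 ij; rewrite /M (@big_cat_nat _ _ _ i).
have block_le i j : (p ^ 2 <= i)%N -> (i <= j)%N -> (j <= p.+1 ^ 2)%N ->
    - B <= \sum_(i <= l < j) (x l - mu l).
  move=> pi ij jp; have i0 := leq_trans p2 pi.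
  have sum_ge0 (g : nat -> R) k l : (0 < k)%N -> (forall i, (0 < i)%N -> 0 <= g i) ->
      0 <= \sum_(k <= i < l) g i.
    move=> k0 g0; rewrite big_nat_cond; apply: sumr_ge0 => t /andP[/andP[kt _] _].
    exact/g0/(leq_trans k0).
  have := sum_ge0 x i j i0 x0; have := sum_ge0 mu (p ^ 2)%N i p2 mu0.
  have := sum_ge0 mu j (p.+1 ^ 2)%N (leq_trans i0 ij) mu0.
  have -> : B = \sum_((p ^ 2)%N <= l < i) mu l +
      (\sum_(i <= l < j) mu l + \sum_(j <= l < (p.+1 ^ 2)%N) mu l).
    by rewrite -!big_cat_nat // (leq_trans ij).
  by rewrite sumrB; lra.
have b1 := block_le _ _ (leqnn _) pn (ltnW np).
have b2 := block_le _ _ pn (ltnW np) (leqnn _).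
have pnR : p%:R ^+ 2 <= n%:R :> R by rewrite -natrX ler_nat.
have := pieces _ _ p2 pn; have := pieces _ _ (leq_trans p2 pn) (ltnW np).
have epn := ler_wpM2l (ltW e0) pnR.
move: Mlo Mhi; rewrite !ler_norml => /andP[l1 l2] /andP[h1 h2] eq1 eq2.
by apply/andP; split; nra.
Qed.

End interpolation.

Section strong_law.
Context {R : realType} {disp : measure_display} {T : measurableType disp}.
Context (P : probability T R) (f : nat -> R) (f_gt0 : forall k, (0 < k)%N -> 0 < f k).
Context (A : nat -> T -> nat) (A_PA : PA_tree P f A).
Context (h h2 H2 : nat -> R) (kappa c : R).
Context (H2_1 : H2 1%N = 0) (H2S : forall k, (0 < k)%N -> H2 k.+1 - H2 k = h2 k).
Context (h_le : forall k, (0 < k)%N -> h k ^+ 2 <= h2 k).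
Context (kappa_ge0 : 0 <= kappa) (kappa_lt1 : kappa < 1) (c_ge0 : 0 <= c).
Context (drift : forall a n, (0 < n)%N -> is_history a n ->
  attach_mean f h2 a n <= kappa / n%:R * node_sum H2 a n + c).
Context (h_ge0 : forall k, (0 < k)%N -> 0 <= h k).
Context (h_root : forall k, (0 < k)%N -> h k <= Num.sqrt (Num.sqrt k%:R)).

Lemma PA_history w n : is_history (A^~ w) n.
Proof. by case: A_PA => _ Ale _ m /andP[m1 _]; apply: Ale. Qed.

Lemma sum_inv_squares n : \sum_(0 <= m < n) (m.+1 ^ 2)%:R^-1 <= 2 :> R.
Proof.
case: n => [|n]; first by rewrite big_geq.
suff : \sum_(0 <= m < n.+1) (m.+1 ^ 2)%:R^-1 <= 2 - n.+1%:R^-1 :> R.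
  by move=> /le_trans; apply; rewrite gerBl invr_ge0.
elim: n => [|n IHn]; first by rewrite big_nat1 invr1; lra.
rewrite big_nat_recr //=.
have n1 : 0 < n.+1%:R :> R by rewrite ltr0n.
apply: le_trans (lerD IHn (lexx _)) _; rewrite natrX -[n.+2%:R]natr1.
move: (n.+1%:R : R) n1 => t t0; rewrite -subr_ge0.
have -> : 2 - (t + 1)^-1 - (2 - t^-1 + ((t + 1) ^+ 2)^-1) = (t * (t + 1) ^+ 2)^-1.
  by field; apply/andP; split; lra.
by rewrite invr_ge0 mulr_ge0 ?sqr_ge0 // ltW.
Qed.

(** Borel-Cantelli: at time [m.+1 ^ 2] the Chebyshev bound is a multiple of the summable
    [1 / m.+1 ^ 2]. *)
Lemma compensated_squares e : 0 < e ->
  {ae P, forall w, exists m0, forall m, (m0 <= m)%N ->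
     `|compensated f h (A^~ w) (m.+1 ^ 2)| <= e * (m.+1 ^ 2)%:R}.
Proof.
move=> e0; pose F m := [set w | e * (m.+1 ^ 2)%:R <= `|compensated f h (A^~ w) (m.+1 ^ 2)|].
have FE m := compensated_chebyshev f_gt0 A_PA H2_1 H2S h_le kappa_ge0 kappa_lt1 c_ge0
  drift (m.+1 ^ 2).-1 e0.
have mF m : measurable (F m) by have := (FE m).1; rewrite prednK // expn_gt0.
have PF m : (P (F m) <= (c / (1 - kappa) / e ^+ 2 * (m.+1 ^ 2)%:R^-1)%:E)%E.
  by have := (FE m).2; rewrite prednK // expn_gt0.
have K0 : 0 <= c / (1 - kappa) / e ^+ 2.
  by rewrite divr_ge0 ?sqr_ge0 // divr_ge0 // subr_ge0 ltW.
exists (lim_sup_set F); split.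
- by apply: bigcap_measurable => // n _; apply: bigcup_measurable => k _; exact: mF.
- apply: lim_sup_set_cvg0 => //.
  apply: (@le_lt_trans _ _ (c / (1 - kappa) / e ^+ 2 * 2)%:E); last exact: ltry.
  apply: lime_le; first exact: is_cvg_nneseries.
  apply: nearW => n; apply: (@le_trans _ _
    (\sum_(0 <= m < n) (c / (1 - kappa) / e ^+ 2 * (m.+1 ^ 2)%:R^-1)%:E)%E).
    by apply: lee_sum => m _; exact: PF.
  by rewrite sumEFin lee_fin -mulr_sumr ler_wpM2l // sum_inv_squares.
- move=> w /= nw n _; apply: contrapT => nF; apply: nw; exists n => m nm.
  rewrite leNgt; apply/negP => /ltW hm; apply: nF; exists m => //.
Qed.

Theorem compensated_strong_law :
  {ae P, forall w, (fun n => compensated f h (A^~ w) n / n%:R) @ \oo --> 0}.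
Proof.
have : {ae P, forall w, forall q, exists m0, forall m, (m0 <= m)%N ->
     `|compensated f h (A^~ w) (m.+1 ^ 2)| <= q.+1%:R^-1 * (m.+1 ^ 2)%:R}.
  by apply: ae_foralln => q; apply: compensated_squares; rewrite invr_gt0 ltr0n.
apply: filterS => w hw; have hA := PA_history w.
pose mu i := attach_mean f h (A^~ w) i.
apply: (@cvg0_between_squares _ (fun i => h (chosen_deg (A^~ w) i)) mu).
- by move=> i i0; apply: h_ge0.
- by move=> i i0; apply: attach_mean_ge0.
- move=> i i0; have S0 : 0 < node_sum f (A^~ w) i by exact: node_sum_gt0.
  rewrite /mu /attach_mean ler_pdivrMr // -node_sumZ.
  rewrite /node_sum; apply: ler_sum_nat => j _.
  have d0 := deg_gt0 (A^~ w) i j; rewrite ler_pM2r ?f_gt0 //.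
  apply: (le_trans (h_root d0)); rewrite !ler_sqrt ?sqrtr_ge0 ?ler0n // ler_nat.
  exact: deg_le.
move=> e e0; have [q _ /(_ q (leqnn _)) hq] := nearN_ge e0.
have [m0 hm0] := hw q; exists m0 => m /hm0 /le_trans; apply.
rewrite ler_wpM2r // -[_^-1]mul1r ler_pdivrMr ?ltr0n //.
by apply: (le_trans hq); rewrite ler_pM2l // ler_nat.
Qed.

End strong_law.

(* A Gamma-function ratio, of order [k ^ eta]; unlike the power it has the exact
   primitive given by [mul_weight]. *)
Definition weight {R : realType} (eta : R) (k : nat) : R :=
  \prod_(1 <= j < k) (1 + eta / j%:R).

Definition cum_weight {R : realType} (eta : R) (k : nat) : R :=
  \sum_(1 <= j < k) weight eta j.

(** * Gamma-ratio weights as test functions for the tails *)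

Section weight.
Context {R : realType}.
Implicit Types (eta : R) (k : nat).

Lemma weight1 eta : weight eta 1 = 1.
Proof. by rewrite /weight big_geq. Qed.

Lemma weightS eta k : (0 < k)%N -> weight eta k.+1 = weight eta k * (1 + eta / k%:R).
Proof. by move=> k0; rewrite /weight big_nat_recr. Qed.

Lemma cum_weight1 eta : cum_weight eta 1 = 0.
Proof. by rewrite /cum_weight big_geq. Qed.

Lemma cum_weightS eta k : (0 < k)%N -> cum_weight eta k.+1 - cum_weight eta k = weight eta k.
Proof. by move=> k0; rewrite /cum_weight big_nat_recr //= addrAC subrr add0r. Qed.

Lemma weight_ge1 eta k : 0 <= eta -> 1 <= weight eta k.
Proof.
move=> e0; rewrite /weight; elim/big_rec: _ => // j x _ x1.
have : 0 <= eta / j%:R by rewrite divr_ge0.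
by nra.
Qed.

Lemma cum_weight_ge0 eta k : 0 <= eta -> 0 <= cum_weight eta k.
Proof.
move=> e0; apply: sumr_ge0 => j _; exact: le_trans ler01 (weight_ge1 j e0).
Qed.

(* Telescoping: [k w(k+1) - (k-1) w(k) = (1 + eta) w(k)]. *)
Lemma mul_weight eta k : (0 < k)%N ->
  k%:R * weight eta k = (1 + eta) * cum_weight eta k + weight eta k.
Proof.
elim: k => // -[_ _|k IHk _]; first by rewrite weight1 cum_weight1 mulr0 add0r mulr1.
have k0 : k.+1%:R != 0 :> R by rewrite pnatr_eq0.
have := IHk isT; have := cum_weightS eta (isT : 0 < k.+1)%N.
rewrite (weightS eta (ltn0Sn k)) (_ : k.+2%:R = k.+1%:R + 1 :> R); last by rewrite natr1.
move: (k.+1%:R : R) k0 (weight eta k.+1) (cum_weight eta k.+1) (cum_weight eta k.+2).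
move=> n n0 w c c' e1 e2; have -> : c' = w + c by rewrite -e1 subrK.
have e3 : n * w - w = (1 + eta) * c by rewrite e2; ring.
rewrite [(1 + eta) * _]mulrDr -e3; field.
by rewrite n0.
Qed.

Lemma weight_le eta eta' k : 0 <= eta -> eta <= eta' -> weight eta k <= weight eta' k.
Proof.
move=> e0 ee; rewrite /weight; apply: ler_prod => j _.
by rewrite addr_ge0 ?divr_ge0 //= lerD2l ler_wpM2r ?invr_ge0.
Qed.

(** Factor by factor, [(1 + x) ^+ 2 <= 1 + 3 * x] on the unit interval. Squares of weights thus stay
    within the family, and no real power is needed. *)
Lemma weight_sqr eta k : 0 <= eta -> eta <= 1 -> weight eta k ^+ 2 <= weight (3 * eta) k.
Proof.
move=> e0 e1; rewrite /weight -prodrXl [leLHS]big_nat_cond [leRHS]big_nat_cond.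
apply: ler_prod => j.
move=> /andP[/andP[j1 _] _]; rewrite sqr_ge0 /= -mulrA.
have : eta / j%:R <= 1 by rewrite ler_pdivrMr ?ltr0n // mul1r (le_trans e1) // ler1n.
have : 0 <= eta / j%:R by rewrite divr_ge0.
by move: (eta / j%:R) => x; nra.
Qed.

Lemma weight_one k : (0 < k)%N -> weight 1 k = k%:R :> R.
Proof.
elim: k => // -[_ _|k IHk _]; first by rewrite weight1.
rewrite weightS // IHk // mulrDr mulr1 mul1r divff ?pnatr_eq0 //.
by rewrite natr1.
Qed.

Lemma weight_le_id eta k : 0 <= eta -> eta <= 1 -> (0 < k)%N -> weight eta k <= k%:R.
Proof. by move=> e0 e1 k0; rewrite -weight_one // weight_le. Qed.

(** Two applications of [weight_sqr] bound the fourth power by [weight (9 * eta)], which is at most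
    [k]; hence the condition on [9 * eta]. *)
Lemma weight_root eta k : 0 <= eta -> 9 * eta <= 1 -> (0 < k)%N ->
  weight eta k <= Num.sqrt (Num.sqrt k%:R).
Proof.
move=> e0 e9 k0.
have w0 (e : R) : 0 <= e -> 0 <= weight e k by move=> he; exact: le_trans ler01 (weight_ge1 k he).
have e3 : 0 <= 3 * eta by lra.
have e1 : eta <= 1 by lra.
have e31 : 3 * eta <= 1 by lra.
rewrite -(ger0_norm (w0 _ e0)) -sqrtr_sqr ler_sqrt ?sqrtr_ge0 //.
apply: le_trans (weight_sqr k e0 e1) _.
rewrite -(ger0_norm (w0 _ e3)) -sqrtr_sqr ler_sqrt ?ler0n //.
apply: le_trans (weight_sqr k e3 e31) _; apply: weight_le_id => //; lra.
Qed.

Lemma ln_le_weight eta k : 0 <= eta -> (0 < k)%N -> 1 + eta * ln k%:R <= weight eta k.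
Proof.
move=> e0; elim: k => // -[_ _|k IHk _]; first by rewrite ln1 mulr0 addr0 weight1.
have w1 := weight_ge1 k.+1 e0.
have k0 : 0 < k.+1%:R :> R by rewrite ltr0n.
have l : ln k.+2%:R - ln k.+1%:R <= k.+1%:R^-1 :> R.
  rewrite -ln_div ?posrE ?ltr0n //.
  have -> : k.+2%:R / k.+1%:R = 1 + k.+1%:R^-1 :> R.
    have -> : k.+2%:R = k.+1%:R + 1 :> R by rewrite natr1.
    by rewrite mulrDl divff ?gt_eqF // mul1r.
  by apply: le_ln1Dx; apply: lt_trans (ltrN10 R) _; rewrite invr_gt0.
have x0 : 0 <= eta / k.+1%:R by rewrite divr_ge0.
have el := ler_wpM2l e0 l.
have := IHk isT; rewrite (weightS eta (ltn0Sn k)); move: el x0.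
rewrite mulrBr; move: (eta / k.+1%:R) (weight eta k.+1) w1 => x w w1; nra.
Qed.

Lemma ln_nat_infty (M : R) : exists K, forall k, (K <= k)%N -> M <= ln k%:R.
Proof.
have [K _ hK] := nearN_ge (expR_gt0 (- M)).
exists K.+1 => k Kk; rewrite -[M]expRK ler_ln ?posrE ?expR_gt0 ?ltr0n ?(leq_trans _ Kk) //.
by have := hK k (ltnW Kk); rewrite expRN mulrC ler_pdivlMr ?expR_gt0 // mul1r.
Qed.

(** [weight eta] dominates the square of [weight (eta / 3)], itself at least linear in the
    logarithm, and a quadratic in [ln k] beats [1 + ln k]. *)
Lemma weight_dominates_ln eta (e : R) : 0 < eta -> eta <= 1 -> 0 < e ->
  exists K, forall k, (K <= k)%N -> 1 + ln k%:R <= e * weight eta k.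
Proof.
move=> eta0 eta1 e0; pose t := eta / 3.
have t0 : 0 < t by rewrite divr_gt0.
have [K hK] := ln_nat_infty (1 + 2 / (e * t ^+ 2)).
exists K.+1 => k Kk; have k0 : (0 < k)%N by exact: leq_ltn_trans Kk.
have := hK _ (ltnW Kk); set l := ln _ => hl.
have tl : 1 + t * l <= weight t k by apply: ln_le_weight => //; exact: ltW.
have et : 0 < e * t ^+ 2 by rewrite mulr_gt0 // exprn_gt0.
have l1 : 1 <= l by apply: le_trans hl; rewrite lerDl divr_ge0 // ltW.
have w2 : weight t k ^+ 2 <= weight eta k.
  apply: le_trans (weight_sqr _ (ltW t0) _) _; first by rewrite /t; lra.
  by rewrite /t mulrC divfK.
apply: (@le_trans _ _ (e * (t * l) ^+ 2)).
  have : 2 <= e * t ^+ 2 * l.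
    by rewrite mulrC -ler_pdivrMr //; apply: le_trans hl; rewrite lerDr.
  move/(ler_wpM2r (le_trans ler01 l1)); have -> : e * (t * l) ^+ 2 = e * t ^+ 2 * l * l by ring.
  by apply: le_trans; lra.
rewrite ler_pM2l // (le_trans _ w2) // lerXn2r ?nnegrE //.
- by rewrite mulr_ge0 ?ltW // (lt_le_trans _ l1).
- by rewrite (le_trans ler01) // weight_ge1 // ltW.
- by apply: le_trans tl; rewrite lerDr.
Qed.

(** By [mul_weight] the primitive is of order [k * weight eta k], and the weight is unbounded. *)
Lemma cum_weight_dominates_id eta (e : R) : 0 < eta -> eta <= 1 -> 0 < e ->
  exists K, forall k, (K <= k)%N -> k%:R <= e * cum_weight eta k.
Proof.
move=> eta0 eta1 e0.
have e4 : 0 < e / 4 by rewrite divr_gt0.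
have [K hK] := weight_dominates_ln eta0 eta1 e4.
exists K.+2 => k Kk; have k2 : (1 < k)%N by exact: leq_ltn_trans Kk.
have k0 := ltnW k2.
have := hK k (ltnW (ltnW Kk)); have := mul_weight eta k0.
have l0 : 0 <= ln k%:R :> R by rewrite ln_ge0 // ler1n.
have k2R : 2 <= k%:R :> R by rewrite ler_nat.
have c0 := cum_weight_ge0 k (ltW eta0).
move: (weight eta k) (cum_weight eta k) (k%:R : R) k2R l0 c0 => w c n n2 l0 c0 e1 e2.
have h1 : 1 <= e / 4 * w by lra.
have w0 : 0 <= w by rewrite -(pmulr_rge0 _ e4) (le_trans ler01).
have nw : 0 <= (n - 2) * w by rewrite mulr_ge0 // subr_ge0.
have ec : 0 <= (1 - eta) * c by rewrite mulr_ge0 // subr_ge0.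
have h2 : n / 2 * w <= 2 * c by lra.
have h3 : n / 2 * 1 <= n / 2 * (e / 4 * w) by apply: ler_wpM2l => //; lra.
have := ler_wpM2l (ltW e4) h2; lra.
Qed.

(** Origin of the constant [a * (1 + eta)]: by [mul_weight], multiplying the weight by an affine
    bound returns its own primitive up to a term linear in [k], and the degrees have a bounded
    average. *)
Lemma weight_affine_le eta (a b : R) k : 0 <= eta -> eta <= 1 -> 0 <= a -> 0 <= b ->
  (0 < k)%N ->
  weight eta k * (a * k%:R + b) <= a * (1 + eta) * cum_weight eta k + (a + b) * k%:R.
Proof.
move=> e0 e1 a0 b0 k0; have := weight_le_id e0 e1 k0; have := mul_weight eta k0.
move: (weight eta k) (cum_weight eta k) (k%:R : R) => w cw x h2 h3.
have -> : w * (a * x + b) = a * (x * w) + b * w by ring.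
have -> : a * (1 + eta) * cw + (a + b) * x = a * ((1 + eta) * cw + x) + b * x by ring.
by apply: lerD; apply: ler_wpM2l => //; rewrite h2 lerD2l.
Qed.

End weight.

(** * Almost sure linear bounds for sums of the primitive weights *)

Section drift.
Context {R : realType} (f : nat -> R) (f_gt0 : forall k, (0 < k)%N -> 0 < f k).
Context (f_nd : forall k l, (0 < k)%N -> (k <= l)%N -> f k <= f l).
Context (a b s1 s2 : R) (a_ge0 : 0 <= a) (b_ge0 : 0 <= b).
Context (f_le : forall k, (0 < k)%N -> f k <= a * k%:R + b).
Context (S_ge : forall p n, (0 < n)%N -> is_history p n -> s1 * n%:R - s2 <= node_sum f p n).

Lemma node_sum_f_ge p n : f 1%N * n%:R <= node_sum f p n.
Proof.
rewrite mulrC -(node_sum_cst (f 1%N) p n); apply: ler_node_sum => k k0.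
exact: f_nd.
Qed.

(** The numerator of the mean is at most [a * (1 + eta)] times the node sum plus a linear term, and
    the total weight is at least [s1 * n - s2]; the strict gap leaves room for a [kappa] below 1. *)
Lemma weight_drift eta : 0 <= eta -> eta <= 1 -> a * (1 + eta) < s1 ->
  exists kappa c : R, [/\ 0 <= kappa, kappa < 1, 0 <= c &
    forall p n, (0 < n)%N -> is_history p n ->
    attach_mean f (weight eta) p n <=
      kappa / n%:R * node_sum (cum_weight eta) p n + c].
Proof.
move=> eta0 eta1 as1; have [a' a'E] : exists a', a' = a * (1 + eta) by exists (a * (1 + eta)).
rewrite -a'E in as1.
have a'0 : 0 <= a' by rewrite a'E mulr_ge0 // addr_ge0.
have s10 : 0 < s1 by exact: le_lt_trans as1.
(* The midpoint of [a' / s1] and 1. The slack [kappa * s1 - a'] absorbs [s2] from the time [n0]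
   on. *)
pose kappa := (a' / s1 + 1) / 2.
have q1 : a' / s1 < 1 by rewrite ltr_pdivrMr // mul1r.
have q0 : 0 <= a' / s1 by rewrite divr_ge0 // ltW.
have kap0 : 0 < kappa by rewrite /kappa; lra.
have kap1 : kappa < 1 by rewrite /kappa; lra.
have gap : a' < kappa * s1.
  rewrite -ltr_pdivrMr // /kappa; lra.
have gap0 : 0 < kappa * s1 - a' by rewrite subr_gt0.
clearbody kappa.
have d0 : 0 < kappa * `|s2| + 1 by rewrite ltr_wpDl // mulr_ge0 // ltW.
have [n0 _ hn0] := nearN_ge (divr_gt0 gap0 d0).
have f1 : 0 < f 1%N by exact: f_gt0.
have ab0 : 0 <= a + b by rewrite addr_ge0.
(* [c1] covers the times before [n0], where the node sum is at most [n0 ^ 3]; [c2] covers the linear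
   remainder, through [f 1 * n <= S]. *)
pose c1 := a' * n0%:R ^+ 3 / f 1%N; pose c2 := 2 * (a + b) / f 1%N.
have c10 : 0 <= c1 by rewrite /c1 divr_ge0 ?mulr_ge0 ?exprn_ge0 // ltW.
have c20 : 0 <= c2 by rewrite /c2 divr_ge0 ?mulr_ge0 // ltW.
exists kappa, (c1 + c2); split => //; first exact: ltW.
  by rewrite addr_ge0.
move=> p n n_gt0 hp; set W := node_sum (cum_weight eta) p n; pose S := node_sum f p n.
have nR : 1 <= n%:R :> R by rewrite ler1n.
have nR0 : 0 < n%:R :> R by rewrite ltr0n.
have S1 : f 1%N * n%:R <= S by exact: node_sum_f_ge.
have Sf1 : f 1%N <= S by apply: le_trans S1; rewrite ler_peMr // ltW.
have S0 : 0 < S by exact: lt_le_trans Sf1.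
have W0 : 0 <= W by apply: node_sum_ge0 => k _; exact: cum_weight_ge0.
rewrite /attach_mean ler_pdivrMr // -/S !mulrDl.
have num : node_sum (fun k => weight eta k * f k) p n <= a' * W + (a + b) * (2 * n%:R).
  apply: (@le_trans _ _ (node_sum (fun k => a' * cum_weight eta k + (a + b) * k%:R) p n)).
    apply: ler_node_sum => k k0; have w0 := le_trans ler01 (weight_ge1 k eta0).
    apply: le_trans (ler_wpM2l w0 (f_le k0)) _; rewrite a'E.
    exact: weight_affine_le.
  rewrite node_sumD !node_sumZ node_sum_id // lerD2l ler_wpM2l //; lra.
apply: le_trans num _; rewrite addrA; apply: lerD; last first.
  rewrite /c2 mulrAC ler_pdivlMr //.
  have -> : (a + b) * (2 * n%:R) * f 1%N = 2 * (a + b) * (f 1%N * n%:R) by ring.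
  by rewrite ler_wpM2l // mulr_ge0.
have [n0n|nn0] := leqP n0 n.
  have gn : kappa * `|s2| + 1 <= (kappa * s1 - a') * n%:R.
    by have := hn0 n n0n; rewrite mulrAC ler_pdivlMr // mul1r.
  have ks : a' * n%:R <= kappa * S.
    apply: (@le_trans _ _ (kappa * (s1 * n%:R - s2))); last first.
      by rewrite ler_pM2l //; exact: S_ge.
    have : kappa * s2 <= kappa * `|s2| by rewrite ler_pM2l // ler_norm.
    by lra.
  rewrite -[leLHS]addr0 lerD //; last by rewrite mulr_ge0 // ltW.
  have -> : kappa / n%:R * W * S = kappa * S / n%:R * W.
    by rewrite -!mulrA; congr (_ * _); ring.
  by rewrite ler_wpM2r // ler_pdivlMr.
rewrite -[leLHS]add0r lerD //.
  by rewrite !mulr_ge0 ?invr_ge0 ?ler0n // ltW.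
have Wn : W <= n0%:R ^+ 3.
  apply: (@le_trans _ _ (n%:R * n%:R ^+ 2)); last first.
    by rewrite -exprS lerXn2r ?nnegrE // ler_nat ltnW.
  rewrite -(node_sum_cst _ p n); rewrite /W /node_sum; apply: ler_sum => i _.
  have d := deg_le p i n_gt0; set k := deg p n i in d *.
  have k0 : (0 < k)%N by [].
  have := weight_le_id eta0 eta1 k0; have := mul_weight eta k0.
  have := cum_weight_ge0 k eta0; have := weight_ge1 k eta0.
  have : k%:R <= n%:R :> R by rewrite ler_nat.
  have : 1 <= k%:R :> R by rewrite ler1n.
  move: (weight eta k) (cum_weight eta k) (k%:R : R) => w cw x h1 h2 h3 h4 h5 h6.
  have e1 : 0 <= eta * cw by rewrite mulr_ge0.
  have e2 : x * w <= x * x by apply: ler_wpM2l => //; lra.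
  have e3 : x * x <= n%:R ^+ 2 by rewrite expr2; apply: ler_pM => //; lra.
  by lra.
rewrite /c1 mulrAC ler_pdivlMr // -mulrA -[leRHS]mulrA.
by rewrite ler_wpM2l // ler_pM // ltW.
Qed.

End drift.

(** What is kept of the randomness: from here to the final theorem the analysis is pathwise. The
    last clause bounds a moment of order [1 + eta] and gives tails uniform in time. *)
Definition regular_path {R : realType} (f : nat -> R) (eta : R) (a : nat -> nat) : Prop :=
  [/\ forall n, is_history a n,
      forall k, (0 < k)%N ->
        (fun n => compensated f (fun d => (d == k)%:R) a n / n%:R) @ \oo --> 0 &
      exists C, forall n, (0 < n)%N -> node_sum (cum_weight eta) a n <= C * n%:R].

Section regular.
Context {R : realType} {disp : measure_display} {T : measurableType disp}.
Context (P : probability T R) (f : nat -> R) (f_gt0 : forall k, (0 < k)%N -> 0 < f k).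
Context (f_nd : forall k l, (0 < k)%N -> (k <= l)%N -> f k <= f l).
Context (A : nat -> T -> nat) (A_PA : PA_tree P f A).

Lemma compensated_indicator_cvg k : (0 < k)%N ->
  {ae P, forall w, (fun n => compensated f (fun d => (d == k)%:R) (A^~ w) n / n%:R) @ \oo --> 0}.
Proof.
move=> k0.
apply: (@compensated_strong_law _ _ _ _ _ f_gt0 _ A_PA _ (fun=> 1) (fun d => d%:R - 1) 0 1).
- by rewrite subrr.
- by move=> d _; rewrite -natr1; ring.
- by move=> d _; case: eqP; rewrite ?expr1n ?expr0n.
- by [].
- exact: ltr01.
- exact: ler01.
- move=> a n n0 _; rewrite !mul0r add0r /attach_mean.
  rewrite (@eq_node_sum _ _ f) => [|d _]; last by rewrite mul1r.
  by rewrite divff // gt_eqF // node_sum_gt0.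
- by [].
- move=> d d0; apply: (@le_trans _ _ 1); first by case: eqP; rewrite /= ?ler01.
  have r1 (x : R) : 1 <= x -> 1 <= Num.sqrt x.
    by move=> x1; rewrite -[leLHS]sqrtr1 ler_sqrt // (le_trans ler01).
  by rewrite !r1 // ler1n.
Qed.

(** The node sum is the time sum of [weight eta] at the chosen degrees, that is, noise of at most
    [m0 * n] plus the means. Strong induction closes because [C = kappa * C + c + m0]. *)
Lemma cum_weight_linear_bound eta kappa c a : 0 <= kappa -> kappa < 1 -> 0 <= c ->
  (forall n, is_history a n) ->
  (forall n, (0 < n)%N -> attach_mean f (weight eta) a n <=
     kappa / n%:R * node_sum (cum_weight eta) a n + c) ->
  (fun n => compensated f (weight eta) a n / n%:R) @ \oo --> 0 ->
  exists C, forall n, (0 < n)%N -> node_sum (cum_weight eta) a n <= C * n%:R.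
Proof.
move=> kap0 kap1 c0 ha hd /cvgP/cvg_seq_bounded[m [_ hm]].
pose m0 := `|m| + 1; have hm0 n : (0 < n)%N -> compensated f (weight eta) a n <= m0 * n%:R.
  move=> n0; have n0R : 0 < n%:R :> R by rewrite ltr0n.
  rewrite -ler_pdivrMr //; apply: le_trans (ler_norm _) _.
  by apply: hm => //; rewrite /m0; apply: le_lt_trans (ler_norm m) _; rewrite ltrDl.
have m00 : 0 <= m0 by rewrite addr_ge0.
pose C := (m0 + c) / (1 - kappa).
have CE : C * (1 - kappa) = m0 + c by rewrite divfK // gt_eqF // subr_gt0.
have C0 : 0 <= C by rewrite /C divr_ge0 ?(addr_ge0 m00) ?subr_ge0 // ltW.
exists C; elim/ltn_ind => n IHn n0.
rewrite (node_sum_telescope n0 (ha n) (cum_weight1 eta) (@cum_weightS _ eta)).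
have -> : \sum_(1 <= i < n) weight eta (chosen_deg a i) =
   compensated f (weight eta) a n + \sum_(1 <= i < n) attach_mean f (weight eta) a i.
  by rewrite -big_split /=; apply: eq_bigr => i _; rewrite subrK.
have : \sum_(1 <= i < n) attach_mean f (weight eta) a i <= \sum_(1 <= i < n) (kappa * C + c).
  apply: ler_sum_nat => i /andP[i0 im]; apply: le_trans (hd i i0) _.
  rewrite lerD2r -mulrA ler_wpM2l // mulrC ler_pdivrMr ?ltr0n //.
  exact: IHn.
have kc0 : 0 <= kappa * C + c by rewrite addr_ge0 // mulr_ge0.
have : \sum_(1 <= i < n) (kappa * C + c) <= (kappa * C + c) * n%:R.
  by rewrite sumr_const_nat -[leLHS]mulr_natr ler_wpM2l // ler_nat leq_subr.
have := hm0 n n0; have -> : C * n%:R = (kappa * C + c) * n%:R + m0 * n%:R.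
  by rewrite -mulrDl -addrA (addrC c) -CE; congr (_ * _); ring.
by lra.
Qed.

Context (a b s1 s2 : R) (a_ge0 : 0 <= a) (b_ge0 : 0 <= b) (a_lt_s1 : a < s1).
Context (f_le : forall k, (0 < k)%N -> f k <= a * k%:R + b).
Context (S_ge : forall p n, (0 < n)%N -> is_history p n -> s1 * n%:R - s2 <= node_sum f p n).

Lemma ae_regular_path : exists eta, [/\ 0 < eta, eta <= 1, a * (1 + eta) < s1 &
  {ae P, forall w, regular_path f eta (A^~ w)}].
Proof.
(* The strong law for [weight eta] takes [weight (3 * eta)] for the squares, so the drift gap must
   survive at [3 * eta]; the bound 1/9 is for [weight_root]. *)
pose eta := Num.min (1 / 9) ((s1 - a) / (6 * (a + 1))).
have eta9 : eta <= 1 / 9 by rewrite ge_min lexx.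
have eta0 : 0 < eta.
  by rewrite lt_min !divr_gt0 ?subr_gt0 // mulr_gt0 // ltr_wpDl.
have aeta : a * (1 + 3 * eta) < s1.
  have : eta * (6 * (a + 1)) <= s1 - a.
    rewrite -ler_pdivlMr; last by rewrite mulr_gt0 // ltr_wpDl.
    by rewrite ge_min lexx orbT.
  have : 0 <= a * eta by rewrite mulr_ge0 // ltW.
  by move: a_lt_s1 eta0; lra.
have aeta1 : a * (1 + eta) < s1.
  have : 0 <= a * eta by rewrite mulr_ge0 // ltW.
  by move: aeta; lra.
exists eta; split => //; first by lra.
clearbody eta; have eta00 := ltW eta0; have eta1 : eta <= 1 by lra.
have [|//||kap3 [c3 [k30 k31 c30 hd3]]] :=
  @weight_drift _ f f_gt0 f_nd a b s1 s2 a_ge0 b_ge0 f_le S_ge (3 * eta); try lra.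
have [kap [c [k0 k1 c0 hd]]] :=
  @weight_drift _ f f_gt0 f_nd a b s1 s2 a_ge0 b_ge0 f_le S_ge eta eta00 eta1 aeta1.
have lawW : {ae P, forall w,
    (fun n => compensated f (weight eta) (A^~ w) n / n%:R) @ \oo --> 0}.
  apply: (@compensated_strong_law _ _ _ _ _ f_gt0 _ A_PA _ (weight (3 * eta))
    (cum_weight (3 * eta)) kap3 c3) => //.
  - exact: cum_weight1.
  - exact: cum_weightS.
  - by move=> k _; apply: weight_sqr.
  - by move=> k _; exact: le_trans ler01 (weight_ge1 k eta00).
  - by move=> k; apply: weight_root => //; lra.
have lawI : {ae P, forall w, forall k,
    (fun n => compensated f (fun d => (d == k.+1)%:R) (A^~ w) n / n%:R) @ \oo --> 0}.
  by apply: ae_foralln => k; apply: compensated_indicator_cvg.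
near=> w.
have hw := PA_history A_PA w.
split => //.
  by move=> [//|k] _; move: k; near: w; exact: lawI.
apply: (cum_weight_linear_bound k0 k1 c0 hw).
  by move=> n n0; apply: hd.
by near: w; exact: lawW.
Unshelve. all: by end_near. Qed.

End regular.

(** * The linear birth system on finitely many states *)

(* States [1, ..., K]: the degrees below [K], and "degree at least [K]".  Mass leaves
   state [j] for [j + 1] at rate [l j], and state [1] is fed by the births.
   [phi j] is the reproductive value of state [j], [lam] the growth rate, and
   [birth_rate] is the birth rate that makes [phi] a left eigenvector. *)
Section lumped_system.
Context {R : realType} (K : nat) (l phi : nat -> R) (lam : R).
Implicit Types (u x psi : nat -> R).

Definition inflow (G : R) x (j : nat) : R := (if j == 1%N then G else x j.-1) - x j.

Definition birth_rate (j : nat) : R := lam * phi j - (phi j.+1 - phi j) * l j.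

Definition total_birth u : R := \sum_(1 <= j < K.+1) birth_rate j * u j.

Definition generator u : nat -> R := inflow (total_birth u) (fun j => l j * u j).

Definition wnorm u : R := \sum_(1 <= j < K.+1) phi j * `|u j|.

Definition wsum u : R := \sum_(1 <= j < K.+1) phi j * u j.

Context (K_gt1 : (1 < K)%N) (lam_gt0 : 0 < lam).
Context (phi1 : phi 1%N = 1) (phi_gt0 : forall j, (1 <= j < K.+1)%N -> 0 < phi j).
Context (l_ge0 : forall j, (0 < j)%N -> 0 <= l j) (lK : l K = 0).
Context (rate_ge0 : forall j, (1 <= j < K.+1)%N -> 0 <= birth_rate j).

(** Summation by parts; the boundary term at the top vanishes because nothing leaves state [K]. *)
Lemma sum_inflow psi G x : x K = 0 ->
  \sum_(1 <= j < K.+1) psi j * inflow G x j =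
  psi 1%N * G + \sum_(1 <= j < K.+1) (psi j.+1 - psi j) * x j.
Proof.
move=> xK; case: K K_gt1 xK => // k k0 xK.
rewrite /inflow; under eq_bigr do rewrite mulrBr; rewrite sumrB.
rewrite big_ltn //= big_add1 /=.
under [X in _ + X - _]eq_big_nat => j /andP[j1 _].
  rewrite (_ : (j.+1 == 1)%N = false); last by case: j j1.
  over.
under [X in _ = _ + X]eq_bigr do rewrite mulrBl.
by rewrite sumrB addrA [in RHS]big_nat_recr //= xK mulr0 addr0.
Qed.

Lemma wsum_generator u : wsum (generator u) = lam * wsum u.
Proof.
rewrite /wsum sum_inflow ?lK ?mul0r // phi1 mul1r -big_split /= mulr_sumr.
by apply: eq_bigr => j _; rewrite /birth_rate; ring.
Qed.

Lemma wnorm_ge0 u : 0 <= wnorm u.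
Proof.
rewrite /wnorm big_nat_cond; apply: sumr_ge0 => j; rewrite andbT => hj.
by rewrite mulr_ge0 // ltW // phi_gt0.
Qed.

Lemma normr_wsum u : `|wsum u| <= wnorm u.
Proof.
apply: le_trans (ler_norm_sum _ _ _) _; apply: ler_sum_nat => j hj.
by rewrite normrM (gtr0_norm (phi_gt0 hj)).
Qed.

Lemma wnormD u x : wnorm (fun j => u j + x j) <= wnorm u + wnorm x.
Proof.
rewrite -big_split /=; apply: ler_sum_nat => j hj.
by rewrite -mulrDr ler_pM2l ?phi_gt0 // ler_normD.
Qed.

Lemma wnormZ (c : R) u : wnorm (fun j => c * u j) = `|c| * wnorm u.
Proof. by rewrite mulr_sumr; apply: eq_bigr => j _; rewrite normrM mulrCA. Qed.

(* Subtracting [kappa * wsum u = 0] from the birth functional lowers its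
   coefficients on the states up to [K0], where [kappa * phi <= birth_rate]. *)
Lemma total_birth_le u (kappa : R) K0 : 0 <= kappa -> (K0 <= K)%N ->
  (forall j, (1 <= j < K0.+1)%N -> kappa * phi j <= birth_rate j) -> wsum u = 0 ->
  `|total_birth u| <= \sum_(1 <= j < K.+1) birth_rate j * `|u j| - kappa * wnorm u
     + 2 * kappa * \sum_(K0.+1 <= j < K.+1) phi j * `|u j|.
Proof.
move=> k0 K0K hk u0.
have -> : total_birth u = \sum_(1 <= j < K.+1) (birth_rate j - kappa * phi j) * u j.
  under eq_bigr do rewrite mulrBl -mulrA; rewrite sumrB -mulr_sumr.
  by rewrite -/(wsum u) u0 mulr0 subr0.
apply: le_trans (ler_norm_sum _ _ _) _.
rewrite /wnorm mulr_sumr -sumrB !(@big_cat_nat _ _ _ K0.+1 1 K.+1) //=.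
rewrite -[leRHS]addrA lerD //.
  apply: ler_sum_nat => j hj; rewrite normrM ger0_norm ?subr_ge0 ?hk //.
  by rewrite mulrBl mulrA.
rewrite mulr_sumr -big_split /=; apply: ler_sum_nat => j /andP[j1 j2].
have hj : (1 <= j < K.+1)%N by rewrite j2 andbT (leq_trans _ j1).
have r0 := rate_ge0 hj; have p0 := mulr_ge0 k0 (ltW (phi_gt0 hj)).
have -> : birth_rate j * `|u j| - kappa * (phi j * `|u j|) + 2 * kappa * (phi j * `|u j|) =
  (birth_rate j + kappa * phi j) * `|u j| by ring.
rewrite normrM ler_wpM2r // (le_trans (ler_normB _ _)) //.
by rewrite !ger0_norm.
Qed.

(** [t * l j <= 1] keeps the coefficient of [u j] nonnegative, so the triangle inequality compares
    the step with the same step on absolute values, where [phi] alone gives the growth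
    [1 + t * lam]. The gain comes only from [total_birth u], in which [wsum u = 0] forces
    cancellation; the states beyond [K0] cost the last term. *)
Lemma generator_contracts u (t kappa : R) K0 : 0 <= kappa -> (K0 <= K)%N ->
  (forall j, (1 <= j < K0.+1)%N -> kappa * phi j <= birth_rate j) -> wsum u = 0 ->
  0 <= t -> (forall j, (1 <= j < K.+1)%N -> t * l j <= 1) ->
  wnorm (fun j => u j + t * generator u j) <=
  (1 + t * lam - t * kappa) * wnorm u
    + 2 * t * kappa * \sum_(K0.+1 <= j < K.+1) phi j * `|u j|.
Proof.
move=> k0 K0K hk u0 t0 tl.
apply: (@le_trans _ _ (wnorm u + t * (\sum_(1 <= j < K.+1)
    phi j * inflow `|total_birth u| (fun j => l j * `|u j|) j))).
  rewrite mulr_sumr -big_split /=; apply: ler_sum_nat => j hj.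
  rewrite mulrCA -mulrDr ler_pM2l ?phi_gt0 // /generator /inflow.
  have lj : 0 <= l j by apply: l_ge0; case/andP: hj.
  have tlj := tl j hj; set y := if _ then _ else _; set y' := if _ then _ else _.
  have yy : `|y| <= y'.
    rewrite /y /y'; case: eqP => // /eqP j1; rewrite normrM ger0_norm //.
    by apply: l_ge0; case/andP: hj; case: (j) j1 => // -[].
  have -> : u j + t * (y - l j * u j) = (1 - t * l j) * u j + t * y by ring.
  apply: le_trans (ler_normD _ _) _; rewrite !normrM (ger0_norm t0) ger0_norm ?subr_ge0 //.
  by have := ler_wpM2l t0 yy; lra.
rewrite sum_inflow ?lK ?mul0r // phi1 mul1r.
have tb := total_birth_le k0 K0K hk u0.
have -> : \sum_(1 <= j < K.+1) (phi j.+1 - phi j) * (l j * `|u j|) =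
   lam * wnorm u - \sum_(1 <= j < K.+1) birth_rate j * `|u j|.
  by rewrite /wnorm mulr_sumr -sumrB; apply: eq_bigr => j _; rewrite /birth_rate; ring.
have := ler_wpM2l t0 tb.
by lra.
Qed.

(** The stationary degree law of a preferential attachment tree with growth rate [lam], truncated:
    as [l K = 0], the last state carries the whole remaining mass. *)
Definition profile (j : nat) : R := if j is j'.+1 then
  \prod_(1 <= i < j) (l i / (lam + l i.+1)) * (lam / (lam + l 1)) else 0.

Lemma profile_ge0 j : 0 <= profile j.
Proof.
have lam0 := ltW lam_gt0; case: j => //= j; rewrite mulr_ge0 //; last first.
  by rewrite divr_ge0 // addr_ge0 // l_ge0.
rewrite big_nat_cond; apply: prodr_ge0 => i /andP[/andP[i1 _] _].
by rewrite divr_ge0 ?addr_ge0 ?l_ge0.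
Qed.

Lemma profile_inflow j : (0 < j)%N ->
  lam * profile j = inflow lam (fun j => l j * profile j) j.
Proof.
have ne i : (0 < i)%N -> lam + l i != 0.
  by move=> i0; rewrite gt_eqF // ltr_pwDl // l_ge0.
case: j => // -[_|j _]; rewrite /inflow /=.
  by rewrite big_geq // mul1r; field; rewrite ne.
rewrite ![\prod_(1 <= i < j.+2) _]big_nat_recr //=; move: (\prod_(1 <= i < j.+1) _) => q.
by field; rewrite !ne.
Qed.

Lemma sum_profile psi : lam * \sum_(1 <= j < K.+1) psi j * profile j =
  psi 1%N * lam + \sum_(1 <= j < K.+1) (psi j.+1 - psi j) * (l j * profile j).
Proof.
rewrite -sum_inflow ?lK ?mul0r // mulr_sumr; apply: eq_big_nat => j /andP[j0 _].
by rewrite -profile_inflow // mulrCA.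
Qed.

Lemma sum_profile1 : \sum_(1 <= j < K.+1) profile j = 1.
Proof.
apply: (mulfI (lt0r_neq0 lam_gt0)); have := sum_profile (fun=> 1).
under eq_bigr do rewrite mul1r; move=> ->.
by rewrite mul1r mulr1 big1 ?addr0 // => j _; rewrite subrr mul0r.
Qed.

Lemma total_birth_profile : total_birth profile = lam.
Proof.
have := sum_profile phi; rewrite phi1 mul1r.
suff -> : \sum_(1 <= j < K.+1) (phi j.+1 - phi j) * (l j * profile j) =
  lam * \sum_(1 <= j < K.+1) phi j * profile j - total_birth profile.
  by move=> h; apply/eqP; rewrite -subr_eq0; apply/eqP; lra.
rewrite mulr_sumr -sumrB; apply: eq_bigr => j _; rewrite /birth_rate; ring.
Qed.

Lemma generator_profile j : (0 < j)%N -> generator profile j = lam * profile j.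
Proof. by move=> j0; rewrite profile_inflow // /generator total_birth_profile. Qed.

End lumped_system.

(** * Decay of the deviation from the profile *)

Section recursion.
Context {R : realType}.

(** [weight b] is an integrating factor: [(1 - x) * (1 + x) <= 1] keeps the positive part of
    [(r n - q / b) * weight b n] bounded, and [weight b] tends to infinity at least
    logarithmically. *)
Lemma rate_recursion (r : nat -> R) (b q : R) : 0 < b ->
  (\forall n \near \oo, r n.+1 <= (1 - b / n%:R) * r n + q / n%:R) ->
  forall e, 0 < e -> \forall n \near \oo, r n <= q / b + e.
Proof.
move=> b0 [n1 _ hr] e e0.
have [n2 _ hn2] : \forall n \near \oo, b <= n%:R :> R by exact: nbhs_infty_ger.
pose n0 := (maxn n1 n2).+1; pose D n := (r n - q / b) * weight b n.
pose M := Num.max 0 (D n0).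
have w1 n := weight_ge1 n (ltW b0).
have DM n : (n0 <= n)%N -> D n <= M.
  elim: n => // n IHn; rewrite leq_eqVlt => /predU1P[<-|]; first by rewrite le_max lexx orbT.
  rewrite ltnS => n0n; have nR0 : 0 < n%:R :> R by rewrite ltr0n (leq_trans _ n0n).
  have n1n : (n1 <= n)%N by apply: leq_trans n0n; rewrite leqW // leq_maxl.
  have n2n : (n2 <= n)%N by apply: leq_trans n0n; rewrite leqW // leq_maxr.
  have := hr n n1n; have := IHn n0n; have M0 : 0 <= M by rewrite le_max lexx.
  rewrite /D weightS -?(ltr0n R) //.
  have x1 : b / n%:R <= 1 by rewrite ler_pdivrMr // mul1r; exact: hn2.
  have x0 : 0 <= b / n%:R by rewrite divr_ge0 // ltW.
  have -> : q / n%:R = q / b * (b / n%:R) by field; rewrite !gt_eqF.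
  move: (b / n%:R) (q / b) (weight b n) (w1 n) x0 x1 => x s w w1n x0 x1 h1 h2.
  have s1 : r n.+1 - s <= (1 - x) * (r n - s) by lra.
  have wx : 0 <= w * (1 + x) by rewrite mulr_ge0 //; lra.
  apply: le_trans (ler_wpM2r wx s1) _.
  have -> : (1 - x) * (r n - s) * (w * (1 + x)) = (1 - x ^+ 2) * ((r n - s) * w) by ring.
  have x2 : 0 <= x ^+ 2 by exact: sqr_ge0.
  have x2' : x ^+ 2 <= 1 by rewrite expr_le1.
  apply: le_trans (ler_wpM2l _ h1) _; first by rewrite subr_ge0.
  by rewrite ler_piMl //; lra.
have [K hK] := ln_nat_infty (M / (e * b)).
exists (maxn n0 K) => // n /=; rewrite geq_max => /andP[n0n Kn].
have := hK n Kn; have nn0 : (0 < n)%N by exact: leq_trans n0n.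
have eb : 0 < e * b by rewrite mulr_gt0.
rewrite ler_pdivrMr // => hM.
have := DM n n0n; have := ln_le_weight (ltW b0) nn0; rewrite /D.
have := w1 n; move: (weight b n) (q / b) (ln n%:R : R) hM => w s L hM h1 h2 h3.
have Mw : M <= e * w by apply: le_trans hM _; rewrite mulrCA ler_wpM2l ?(ltW e0) //; lra.
have h4 : (r n - s) * w <= e * w by exact: le_trans Mw.
have w0 : 0 < w by lra.
by move: h4; rewrite ler_pM2r //; lra.
Qed.

End recursion.

Section lumped_dynamics.
Context {R : realType} (K : nat) (l phi : nat -> R) (lam : R).
Context (K_gt1 : (1 < K)%N) (lam_gt0 : 0 < lam).
Context (phi1 : phi 1%N = 1) (phi_gt0 : forall j, (1 <= j < K.+1)%N -> 0 < phi j).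
Context (l_ge0 : forall j, (0 < j)%N -> 0 <= l j) (lK : l K = 0).
Context (rate_ge0 : forall j, (1 <= j < K.+1)%N -> 0 <= birth_rate l phi lam j).
Let p := profile l lam.
Let Phi := wsum K phi.
Let norm := wnorm K phi.
Let tail K0 (u : nat -> R) := \sum_(K0.+1 <= j < K.+1) phi j * `|u j|.

Lemma wsum_profile_gt0 : 0 < Phi p.
Proof.
rewrite lt_neqAle; apply/andP; split; last first.
  by rewrite /Phi /wsum big_nat_cond; apply: sumr_ge0 => j; rewrite andbT => hj;
     rewrite mulr_ge0 ?(profile_ge0 lam_gt0) // ltW // phi_gt0.
apply/eqP => e0; have := sum_profile1 K_gt1 lam_gt0 l_ge0 lK.
rewrite big_nat_cond big1 ?(esym (oner_neq0 _)) => [/eqP|j].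
  by rewrite eq_sym oner_eq0.
rewrite andbT => hj; move/esym/eqP: e0; rewrite /Phi /wsum big_nat_cond psumr_eq0.
  move=> /allP/(_ j); rewrite mem_index_iota hj => /(_ isT) /=.
  by rewrite mulf_eq0 gt_eqF ?phi_gt0 // => /eqP.
move=> i; rewrite andbT => hi; rewrite mulr_ge0 ?(profile_ge0 lam_gt0) //.
by rewrite ltW // phi_gt0.
Qed.

(** The projection along the profile onto the kernel of [Phi], where the generator contracts. *)
Definition deviation (z : nat -> R) (j : nat) : R := z j - Phi z / Phi p * p j.

Lemma wsum_deviation z : Phi (deviation z) = 0.
Proof.
rewrite /Phi /wsum /deviation; under eq_bigr do rewrite mulrBr mulrCA.
by rewrite sumrB -mulr_sumr -/(wsum K phi p) divfK ?subrr // gt_eqF // wsum_profile_gt0.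
Qed.

Context (z : nat -> nat -> R) (t : nat -> R) (c0 t0 t1 tau e kappa : R) (K0 : nat).
Context (c0_gt0 : 0 < c0) (t0_gt0 : 0 < t0) (t1_gt0 : 0 < t1) (tau_ge0 : 0 <= tau)
  (e_ge0 : 0 <= e) (kappa_gt0 : 0 < kappa) (K0K : (K0 <= K)%N).
Context (rate_ge : forall j, (1 <= j < K0.+1)%N -> kappa * phi j <= birth_rate l phi lam j).
Let err n j := z n.+1 j - (z n j + t n * generator K l phi lam (z n) j).
Context (z_near : \forall n \near \oo,
  [/\ t0 / n%:R <= t n <= t1 / n%:R,
      c0 * n%:R <= Phi (z n) /\ norm (z n) <= 2 * Phi (z n),
      tail K0 (z n) <= tau * n%:R,
      Phi (z n) / Phi p * tail K0 p <= tau * n%:R &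
      norm (err n) <= e]).

(** Up to errors, a step multiplies the norm of the deviation by [1 + t * lam - t * kappa] and [Phi]
    by [1 + t * lam]. As [t * lam <= 1], their ratio shrinks at least by [1 - t * kappa / 2]; since
    [t] is of order [1 / n], [rate_recursion] applies with [b = kappa * t0 / 2]. The bound is
    [q / b]. *)
Lemma lumped_dynamics (eps : R) : 0 < eps -> \forall n \near \oo,
  norm (deviation (z n)) <=
    ((8 * t1 * tau + 10 * e / kappa) / (t0 * c0) + eps) * Phi (z n).
Proof.
move=> eps0; pose V n := norm (deviation (z n)); pose F n := Phi (z n).
pose q := (4 * kappa * t1 * tau + 5 * e) / c0; pose b := kappa * t0 / 2.
have qb : q / b = (8 * t1 * tau + 10 * e / kappa) / (t0 * c0).
  by rewrite /q /b; field; rewrite !gt_eqF.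
have b0 : 0 < b by rewrite /b divr_gt0 // mulr_gt0.
have q0 : 0 <= 4 * kappa * t1 * tau + 5 * e.
  by rewrite addr_ge0 ?mulr_ge0 // ltW.
pose L := \sum_(1 <= j < K.+1) l j + lam + kappa.
have Ll j : (1 <= j < K.+1)%N -> l j <= L.
  move=> hj; rewrite /L -addrA -[leLHS]addr0 lerD //; last by rewrite addr_ge0 // ltW.
  rewrite (bigD1_seq j) ?mem_index_iota ?iota_uniq //= lerDl.
  rewrite big_seq_cond; apply: sumr_ge0 => i /andP[]; rewrite mem_index_iota => /andP[i0 _] _.
  exact: l_ge0.
have sl0 : 0 <= \sum_(1 <= j < K.+1) l j.
  rewrite big_nat_cond; apply: sumr_ge0 => i /andP[/andP[i0 _] _]; exact: l_ge0.
have Lnear : \forall n \near \oo, t1 * L <= n%:R by exact: nbhs_infty_ger.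
have rec : \forall n \near \oo,
    V n.+1 / F n.+1 <= (1 - b / n%:R) * (V n / F n) + q / n%:R.
  have [N1 _ hN1] := z_near; have [N2 _ hN2] := Lnear.
  exists (maxn N1 N2).+1 => // n /= hn.
  have n_gt0 : (0 < n)%N by exact: leq_trans hn.
  have nN1 : (N1 <= n)%N by apply: leq_trans (ltnW hn); exact: leq_maxl.
  have nN2 : (N2 <= n)%N by apply: leq_trans (ltnW hn); exact: leq_maxr.
  have nR : 0 < n%:R :> R by rewrite ltr0n.
  have [/andP[tlo thi] [Fn Fn2] tailz tailp errn] := hN1 n nN1.
  have [_ [Fn' _] _ _ _] := hN1 n.+1 (leqW nN1).
  have tn0 : 0 <= t n by apply: le_trans tlo; rewrite divr_ge0 // ltW.
  have tL : t n * L <= 1.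
    apply: (@le_trans _ _ (t1 / n%:R * L)).
      by rewrite ler_wpM2r // /L !addr_ge0 // ltW.
    by rewrite mulrAC ler_pdivrMr // mul1r; exact: hN2.
  have tl j : (1 <= j < K.+1)%N -> t n * l j <= 1.
    by move=> hj; apply: le_trans tL; rewrite ler_wpM2l // Ll.
  have tlam : t n * lam <= 1.
    by apply: le_trans tL; rewrite ler_wpM2l // /L -addrA addrCA lerDl addr_ge0 // ltW.
  have tkap : t n * kappa <= 1.
    by apply: le_trans tL; rewrite ler_wpM2l // /L lerDr addr_ge0 // ltW.
  have pP := wsum_profile_gt0.
  pose u := deviation (z n); pose E j := err n j.
  have ES j : z n.+1 j = z n j + t n * generator K l phi lam (z n) j + E j.
    by rewrite /E /err addrC subrK.
  have FS : F n.+1 = (1 + t n * lam) * F n + Phi E.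
    have -> : F n.+1 = Phi (z n) + t n * Phi (generator K l phi lam (z n)) + Phi E.
      rewrite /F /Phi /wsum mulr_sumr -!big_split /=.
      by apply: eq_bigr => j _; rewrite ES; ring.
    by rewrite /Phi (wsum_generator lam K_gt1 phi1 lK) /F /Phi; ring.
  (* Projection commutes with the generator, the profile being an eigenvector for [lam]; what is
     left over is the projection of the error. *)
  have uS j : (1 <= j < K.+1)%N -> deviation (z n.+1) j =
      u j + t n * generator K l phi lam u j + (E j + - (Phi E / Phi p) * p j).
    move=> /andP[j0 _].
    have gu : generator K l phi lam u j =
       generator K l phi lam (z n) j - F n / Phi p * (lam * p j).
      rewrite -(generator_profile K_gt1 lam_gt0 phi1 l_ge0 lK j0) /generator /inflow /total_birth.
      have -> : \sum_(1 <= i < K.+1) birth_rate l phi lam i * u i =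
         \sum_(1 <= i < K.+1) birth_rate l phi lam i * z n i
         - F n / Phi p * \sum_(1 <= i < K.+1) birth_rate l phi lam i * p i.
        rewrite mulr_sumr -sumrB; apply: eq_bigr => i _.
        by rewrite /u /deviation -/(F n) mulrBr mulrCA.
      by case: eqP => _; rewrite /u /deviation -/(F n) -/p; ring.
    rewrite /deviation ES -/(F n.+1) FS gu /u /deviation -/(F n).
    by field; rewrite gt_eqF.
  have u0 : Phi u = 0 by exact: wsum_deviation.
  have contr := generator_contracts K_gt1 phi1 phi_gt0 l_ge0 lK rate_ge0
    (ltW kappa_gt0) K0K rate_ge u0 tn0 tl.
  have nE : `|Phi E| <= e by apply: le_trans errn; exact: normr_wsum.
  have VS : V n.+1 <= (1 + t n * lam - t n * kappa) * V n
      + 2 * t n * kappa * tail K0 u + 2 * e.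
    have -> : V n.+1 = norm (fun j => u j + t n * generator K l phi lam u j +
        (E j + - (Phi E / Phi p) * p j)).
      by apply: eq_big_nat => j hj; rewrite uS.
    apply: le_trans (wnormD phi_gt0 _ _) _; apply: lerD; first exact: contr.
    apply: le_trans (wnormD phi_gt0 _ _) _.
    rewrite (wnormZ K phi (- (Phi E / Phi p)) p) normrN normrM normfV (gtr0_norm pP).
    have -> : wnorm K phi p = Phi p.
      by apply: eq_bigr => j _; rewrite ger0_norm // (profile_ge0 lam_gt0).
    by rewrite divfK ?gt_eqF //; have : wnorm K phi E <= e by []; lra.
  have tail_u : tail K0 u <= 2 * tau * n%:R.
    apply: (@le_trans _ _ (tail K0 (z n) + F n / Phi p * tail K0 p)); last by rewrite /F; lra.
    rewrite /tail mulr_sumr -big_split /=; apply: ler_sum_nat => j /andP[j1 j2].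
    have hj : (1 <= j < K.+1)%N by rewrite j2 andbT (leq_trans _ j1).
    rewrite [X in _ + X]mulrCA -mulrDr ler_pM2l ?phi_gt0 //.
    apply: le_trans (ler_normB _ _) _; rewrite normrM ger0_norm //.
    by rewrite divr_ge0 // ?(ltW pP) // (le_trans _ Fn) // mulr_ge0 // ltW.
  have F0 : 0 < F n by apply: lt_le_trans Fn; rewrite mulr_gt0.
  have F0' : 0 < F n.+1 by apply: lt_le_trans Fn'; rewrite mulr_gt0 // ltr0n.
  have V0 : 0 <= V n by exact: wnorm_ge0.
  have V3 : V n <= 3 * F n.
    have -> : V n = norm (fun j => z n j + - (F n / Phi p) * p j).
      by apply: eq_bigr => j _; rewrite /deviation mulNr.
    apply: le_trans (wnormD phi_gt0 _ _) _.
    rewrite (wnormZ K phi (- (F n / Phi p)) p) normrN ger0_norm; last by rewrite divr_ge0 // ltW.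
    have -> : wnorm K phi p = Phi p.
      by apply: eq_bigr => j _; rewrite ger0_norm // (profile_ge0 lam_gt0).
    by rewrite divfK ?gt_eqF //; move: Fn2; rewrite -/(F n) /norm; lra.
  rewrite -/(F n) in Fn Fn2; rewrite -/(F n.+1) in Fn'.
  have [r rE] : exists r, V n = r * F n by exists (V n / F n); rewrite divfK // gt_eqF.
  have r0 : 0 <= r by move: V0; rewrite rE pmulr_lge0.
  have r3 : r <= 3 by move: V3; rewrite rE ler_pM2r.
  have tn1 : t n * n%:R <= t1 by rewrite -ler_pdivlMr.
  have FS' : (1 + t n * lam) * F n <= F n.+1 + e.
    by move: nE; rewrite FS ler_norml => /andP[lo _]; lra.
  have -> : V n / F n = r by rewrite rE mulfK // gt_eqF.
  clear uS contr; clearbody u; move: (V n.+1) (F n) (F n.+1) F0 F0' rE Fn Fn' FS' VS V0.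
  move=> V' G G' G0 G0' rE Gn Gn' GS VS V0.
  have tail2 : t n * kappa * tail K0 u <= 2 * kappa * t1 * tau.
    apply: le_trans (ler_wpM2l (mulr_ge0 tn0 (ltW kappa_gt0)) tail_u) _.
    have := ler_wpM2l (mulr_ge0 (ltW kappa_gt0) tau_ge0) tn1; lra.
  have half : 0 <= 1 - kappa * t n / 2 by lra.
  have V1 : V' <= (1 - kappa * t n / 2) * (r * (G' + e)) + 4 * kappa * t1 * tau + 2 * e.
    have rG : r * ((1 + t n * lam) * G) <= r * (G' + e) by rewrite ler_wpM2l.
    have := ler_wpM2l half rG.
    have tk0 : 0 <= t n * kappa * V n by rewrite !mulr_ge0 // ltW.
    have := mulr_ge0 tk0 (_ : 0 <= 1 - t n * lam); rewrite subr_ge0 => /(_ tlam).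
    by rewrite rE in VS *; lra.
  have re : (1 - kappa * t n / 2) * (r * e) <= 3 * e.
    rewrite mulrA ler_wpM2r // -[3]mul1r ler_pM //; rewrite lerBlDr lerDl.
    by rewrite divr_ge0 // mulr_ge0 // ltW.
  rewrite ler_pdivrMr // mulrDl.
  have QG : 4 * kappa * t1 * tau + 5 * e <= q / n%:R * G'.
    rewrite [leRHS]mulrAC ler_pdivlMr // /q [leRHS]mulrAC ler_pdivlMr // -[leLHS]mulrA.
    rewrite ler_wpM2l // mulrC; by apply: le_trans Gn'; rewrite ler_pM2l // ler_nat.
  have bt : b / n%:R <= kappa * t n / 2.
    rewrite /b; have := ler_wpM2l (ltW kappa_gt0) tlo.
    by rewrite mulrA; move: (t0 / n%:R) => ?; lra.
  have rG' : 0 <= r * G' by rewrite mulr_ge0 // ltW.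
  have := ler_wpM2r rG' bt; lra.
have [N _ hN] := z_near; have [N2 _ hN2] := rate_recursion b0 rec eps0.
exists (maxn (maxn N N2) 1) => // n /=; rewrite !geq_max => /andP[/andP[nN nN2] n0].
have [_ [Fn _] _ _ _] := hN n nN; have := hN2 n nN2.
rewrite ler_pdivrMr ?qb //; apply: lt_le_trans Fn; rewrite mulr_gt0 // ltr0n //.
Qed.

End lumped_dynamics.

(** * The tree as a perturbed lumped system *)

Lemma minn_eq_low d j K : (j < K)%N -> (minn d K == j) = (d == j).
Proof. by move=> jK; apply/idP/idP; lia. Qed.

Section lumped_path.
Context {R : realType} (f : nat -> R) (f_gt0 : forall k, (0 < k)%N -> 0 < f k).
Context (f_nd : forall k l, (0 < k)%N -> (k <= l)%N -> f k <= f l).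
Context (w : nat -> nat) (w_hist : forall n, is_history w n).
Context (M phi_min : R) (M_gt0 : 0 < M) (phi_min_gt0 : 0 < phi_min).
Context (f_leM : forall k, (0 < k)%N -> f k <= M * k%:R).
Context (K : nat) (lam : R) (phi : nat -> R) (K_gt1 : (1 < K)%N).
Context (lam_gt0 : 0 < lam) (lam_le : lam <= M) (phi1 : phi 1%N = 1).
Context (phi_ge : forall j, (1 <= j < K.+1)%N -> phi_min <= phi j).
Context (phi_le : forall j, (1 <= j < K.+1)%N -> phi j <= M * j%:R).
Context (phi_eq : forall j, (1 <= j < K)%N -> phi j * (f j + lam) = f j * (1 + phi j.+1)).

Definition leave_rate (j : nat) : R := if (j < K)%N then f j else 0.
Let l := leave_rate.
Let S n := node_sum f w n.
Let g := birth_rate l phi lam.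

Lemma phi_gt0_from_min j : (1 <= j < K.+1)%N -> 0 < phi j.
Proof. by move=> /phi_ge; exact: lt_le_trans. Qed.

Lemma leave_rate_ge0 j : (0 < j)%N -> 0 <= l j.
Proof. by rewrite /l /leave_rate => j0; case: ifP => // _; exact/ltW/f_gt0. Qed.

Lemma leave_rateK : l K = 0.
Proof. by rewrite /l /leave_rate ltnn. Qed.

Lemma birth_rate_low j : (1 <= j < K)%N -> g j = f j.
Proof.
move=> hj; have := phi_eq hj; rewrite /g /birth_rate /l /leave_rate; case/andP: hj => _ ->.
by lra.
Qed.

Lemma birth_rate_top : g K = lam * phi K.
Proof. by rewrite /g /birth_rate leave_rateK mulr0 subr0. Qed.

Lemma birth_rate_ge0 j : (1 <= j < K.+1)%N -> 0 <= g j.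
Proof.
move=> hj; case: (ltnP j K) => jK.
  by rewrite birth_rate_low ?jK ?andbT; case/andP: hj => // j0 _; exact/ltW/f_gt0.
have -> : j = K by apply/eqP; rewrite eqn_leq jK andbT; case/andP: hj.
by rewrite birth_rate_top mulr_ge0 ?ltW // phi_gt0_from_min // ltnS leqnn ltnW.
Qed.

Lemma birth_rate_leM j : (1 <= j < K.+1)%N -> g j <= (M + M ^+ 2) * j%:R.
Proof.
move=> hj; have j0 : 0 <= j%:R :> R by [].
have M2 : 0 <= M ^+ 2 by exact: sqr_ge0.
have Mj : 0 <= M * j%:R by rewrite mulr_ge0 // ltW.
have M2j : 0 <= M ^+ 2 * j%:R by rewrite mulr_ge0.
case: (ltnP j K) => jK.
  rewrite birth_rate_low ?jK ?andbT; case/andP: hj => // j1 _.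
  by have := f_leM j1; lra.
have jE : j = K by apply/eqP; rewrite eqn_leq jK andbT; case/andP: hj.
have := phi_le hj; rewrite jE in Mj M2j *; rewrite birth_rate_top => pK.
apply: (@le_trans _ _ (M * (M * K%:R))); last by lra.
by apply: ler_pM => //; rewrite ltW // phi_gt0_from_min // ltnS leqnn ltnW.
Qed.

Definition indicator_sum (j n : nat) : R := node_sum (fun d => (minn d K == j)%:R) w n.

(** The compensator of the number of steps that choose degree [j], that is, of the transitions from
    state [j] to the next one. *)
Definition predictable (j n : nat) : R :=
  \sum_(1 <= i < n) l j * node_sum (fun d => (d == j)%:R) w i / S i.

(* The lumped degree counts with the martingale part of the transitions removed,
   so that the increments are exact functions of the current tree. *)
Definition lumped (n j : nat) : R := inflow n%:R (fun j => predictable j n) j.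

Definition noise (j n : nat) : R :=
  if (j < K)%N then compensated f (fun d => (d == j)%:R) w n else 0.

Definition total_noise (n : nat) : R := \sum_(1 <= j < K.+1) `|noise j n|.

Lemma predictable_noise j n : (0 < n)%N -> (0 < j)%N -> (j < K)%N ->
  node_sum (fun d => (j < d)%N%:R) w n = predictable j n + noise j n.
Proof.
move=> n0 j0 jK; rewrite /noise jK.
rewrite (@node_sum_telescope _ _ (fun d => (d == j)%:R)) //; last 2 first.
- by rewrite ltnNge j0.
- by move=> d d0; rewrite ltnS; case: (ltngtP d j) => h; rewrite ?subrr ?subr0.
rewrite /predictable /compensated -big_split /=; apply: eq_bigr => i _.
rewrite addrCA -[LHS]addr0; congr (_ + _); apply/esym/eqP.
rewrite subr_eq0 /attach_mean /l /leave_rate jK; apply/eqP; congr (_ / _).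
rewrite -node_sumZ; apply: eq_node_sum => d _.
by case: eqP => [->|_]; rewrite ?mulr1 ?mul1r ?mulr0 ?mul0r.
Qed.

(** The occupation of a state is the number of entries minus the number of exits. Both are
    compensator plus noise, except that the entries into state 1 number exactly [n] and that nothing
    leaves state [K]. *)
Lemma indicator_sum_lumped j n : (0 < n)%N -> (1 <= j < K.+1)%N ->
  indicator_sum j n = lumped n j + inflow 0 (noise^~ n) j.
Proof.
move=> n0 /andP[j0 jK].
have pK : predictable K n + noise K n = 0.
  by rewrite /noise ltnn addr0 /predictable big1 // => i _; rewrite leave_rateK !mul0r.
have top : node_sum (fun d => ((j < K) && (j < d))%N%:R) w n = predictable j n + noise j n.
  move: jK; rewrite ltnS leq_eqVlt => /predU1P[->|jK].
    rewrite pK ltnn /= /node_sum big1 //.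
  by rewrite -predictable_noise // jK.
have bot : node_sum (fun d => (j <= d)%N%:R) w n =
    (if j == 1%N then n%:R else predictable j.-1 n + noise j.-1 n).
  case: (eqVneq j 1%N) => [->|j1].
    rewrite -[RHS]mulr1 -(node_sum_cst 1 w n); apply: eq_node_sum => d d0.
    by rewrite d0.
  have j1' : (0 < j.-1)%N by case: (j) j0 j1 => // -[].
  rewrite -predictable_noise //; last by rewrite -ltnS prednK.
  by apply: eq_node_sum => d _; rewrite prednK.
have -> : indicator_sum j n = node_sum (fun d => (j <= d)%N%:R) w n -
   node_sum (fun d => ((j < K) && (j < d))%N%:R) w n.
  rewrite -node_sumB; apply: eq_node_sum => d _.
  have -> : (minn d K == j) = (j <= d)%N && ~~ ((j < K) && (j < d))%N.
    by apply/idP/idP; move: jK; lia.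
  case: (leqP j d) => jd /=; last by rewrite [(j < d)%N]ltnNge (ltnW jd) andbF subrr.
  by case: ((j < K) && _)%N; rewrite ?subrr ?subr0.
rewrite top bot /lumped /inflow; case: eqP => _; by ring.
Qed.

Lemma normr_inflow_le (G : R) (x : nat -> R) j :
  `|inflow G x j| <= inflow `|G| (fun j => `|x j|) j + 2 * `|x j|.
Proof.
rewrite /inflow; apply: le_trans (ler_normB _ _) _.
by case: eqP => _; lra.
Qed.

Lemma sum_normr_inflow0 (x : nat -> R) : x K = 0 ->
  \sum_(1 <= j < K.+1) `|inflow 0 x j| <= 2 * \sum_(1 <= j < K.+1) `|x j|.
Proof.
move=> xK; have := @sum_inflow _ K K_gt1 (fun=> 1) `|0 : R| (fun j => `|x j|) (_ : _ = 0).
rewrite xK normr0 => /(_ erefl); rewrite mulr0 [X in _ = 0 + X]big1 ?addr0; last first.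
  by move=> j _; rewrite subrr mul0r.
under eq_bigr do rewrite mul1r.
move=> e; rewrite -[leRHS]add0r -[X in _ <= X + _]e mulr_sumr -big_split /=.
by apply: ler_sum => j _; have := normr_inflow_le 0 x j; rewrite normr0.
Qed.

Let m n := inflow 0 (noise^~ n).
Let z := lumped.
Let p := profile l lam.
Let Phi := wsum K phi.

Lemma sum_normr_defect n : \sum_(1 <= j < K.+1) `|m n j| <= 2 * total_noise n.
Proof. by apply: sum_normr_inflow0; rewrite /noise ltnn. Qed.

Lemma total_noise_ge0 n : 0 <= total_noise n.
Proof. exact: sumr_ge0. Qed.

Lemma sum_defect_le (psi : nat -> R) c n :
  (forall j, (1 <= j < K.+1)%N -> 0 <= psi j <= c) ->
  \sum_(1 <= j < K.+1) psi j * `|m n j| <= c * (2 * total_noise n).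
Proof.
move=> hpsi; have c0 : 0 <= c.
  have h1 : (1 <= 1 < K.+1)%N by rewrite /= ltnS ltnW.
  by have /andP[p0 pc] := hpsi 1%N h1; exact: le_trans pc.
apply: le_trans (ler_wpM2l c0 (sum_normr_defect n)); rewrite mulr_sumr.
by apply: ler_sum_nat => j /hpsi /andP[_ pc]; rewrite ler_wpM2r.
Qed.

Lemma sum_indicator_sum (psi : nat -> R) n :
  \sum_(1 <= j < K.+1) psi j * indicator_sum j n = node_sum (fun d => psi (minn d K)) w n.
Proof.
under eq_bigr do rewrite -node_sumZ; rewrite exchange_big /=; apply: eq_bigr => i _.
set d := deg w n i; have d0 : (0 < d)%N by [].
rewrite (bigD1_seq (minn d K)) ?mem_index_iota ?iota_uniq //=; last first.
  by rewrite leq_min d0 ltnW //= ltnS geq_minr.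
rewrite eqxx mulr1 big1 ?addr0 // => j; rewrite eq_sym => /negbTE ->.
by rewrite mulr0.
Qed.

Lemma phi_bound j : (1 <= j < K.+1)%N -> 0 <= phi j <= M * K%:R.
Proof.
move=> hj; rewrite ltW ?phi_gt0_from_min //=; apply: le_trans (phi_le hj) _.
by rewrite ler_pM2l // ler_nat -ltnS; case/andP: hj.
Qed.

Lemma minn_range d : (0 < d)%N -> (1 <= minn d K < K.+1)%N.
Proof. by move=> d0; rewrite leq_min d0 ltnW //= ltnS geq_minr. Qed.

Definition tail_sum (k n : nat) : R := node_sum (fun d => (k <= d)%N%:R * d%:R) w n.

Let Psi n := node_sum (fun d => phi (minn d K)) w n.

Lemma Psi_bounds n : (0 < n)%N -> phi_min * n%:R <= Psi n <= 2 * M * n%:R.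
Proof.
move=> n0; apply/andP; split.
  rewrite mulrC -(node_sum_cst phi_min w n); apply: ler_node_sum => d d0.
  exact/phi_ge/minn_range.
apply: (@le_trans _ _ (node_sum (fun d => M * d%:R) w n)).
  apply: ler_node_sum => d d0; apply: le_trans (phi_le (minn_range d0)) _.
  by rewrite ler_pM2l // ler_nat geq_minl.
by rewrite node_sumZ node_sum_id // [2 * M]mulrC -mulrA ler_pM2l //; lra.
Qed.

Lemma lumpedE n j : (0 < n)%N -> (1 <= j < K.+1)%N -> z n j = indicator_sum j n - m n j.
Proof. by move=> n0 hj; rewrite (indicator_sum_lumped n0 hj) addrK. Qed.

Lemma Phi_lumped n : (0 < n)%N ->
  `|Phi (z n) - Psi n| <= M * K%:R * (2 * total_noise n).
Proof.
move=> n0; rewrite /Psi -sum_indicator_sum /Phi /wsum -sumrB.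
apply: le_trans (ler_norm_sum _ _ _) _; apply: le_trans (sum_defect_le n phi_bound).
apply: ler_sum_nat => j hj; rewrite lumpedE // -mulrBr addrAC subrr add0r normrM normrN.
by rewrite ger0_norm //; case/andP: (phi_bound hj).
Qed.

Lemma indicator_sum_ge0 j n : 0 <= indicator_sum j n.
Proof. exact: node_sum_ge0. Qed.

Lemma weighted_lumped_le n (s : nat) : (0 < n)%N -> (0 < s)%N -> (s <= K.+1)%N ->
  \sum_(s <= j < K.+1) phi j * `|z n j| <=
  \sum_(s <= j < K.+1) phi j * indicator_sum j n + M * K%:R * (2 * total_noise n).
Proof.
move=> n0 s0 sK.
apply: (@le_trans _ _ (\sum_(s <= j < K.+1) phi j * indicator_sum j n +
    \sum_(s <= j < K.+1) phi j * `|m n j|)).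
  rewrite -big_split /=; apply: ler_sum_nat => j /andP[sj jK].
  have hj : (1 <= j < K.+1)%N by rewrite jK (leq_trans s0).
  rewrite -mulrDr lumpedE // ler_wpM2l //; first by case/andP: (phi_bound hj).
  by apply: le_trans (ler_normB _ _) _; rewrite (ger0_norm (indicator_sum_ge0 _ _)).
rewrite lerD2l; apply: le_trans (sum_defect_le n phi_bound).
rewrite (@big_cat_nat _ _ _ s 1 K.+1) //= lerDr big_nat_cond.
apply: sumr_ge0 => j /andP[/andP[j1 j2] _]; rewrite mulr_ge0 //.
by have /andP[] : 0 <= phi j <= M * K%:R by apply: phi_bound; rewrite j1 (leq_trans j2).
Qed.

Lemma wnorm_lumped n : (0 < n)%N ->
  wnorm K phi (z n) <= Psi n + M * K%:R * (2 * total_noise n).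
Proof.
move=> n0; rewrite /Psi -sum_indicator_sum.
exact: weighted_lumped_le.
Qed.

Lemma tail_lumped n K0 : (0 < n)%N -> (K0 <= K)%N ->
  \sum_(K0.+1 <= j < K.+1) phi j * `|z n j| <=
  M * tail_sum K0.+1 n + M * K%:R * (2 * total_noise n).
Proof.
move=> n0 K0K; apply: le_trans (weighted_lumped_le n0 (ltn0Sn _) _) _ => //.
rewrite lerD2r.
pose psi j := if (K0 < j)%N then phi j else 0.
have -> : \sum_(K0.+1 <= j < K.+1) phi j * indicator_sum j n =
    \sum_(1 <= j < K.+1) psi j * indicator_sum j n.
  rewrite (@big_cat_nat _ _ _ K0.+1 1 K.+1) //= [X in _ = X + _]big_nat_cond.
  rewrite [X in _ = X + _]big1 ?add0r.
    by apply: eq_big_nat => j /andP[K0j _]; rewrite /psi K0j.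
  by move=> j /andP[/andP[_ jK] _]; rewrite /psi ltnNge -ltnS jK mul0r.
rewrite sum_indicator_sum /tail_sum -node_sumZ; apply: ler_node_sum => d d0.
rewrite /psi /= leq_min; case: ifPn => [hd|_]; last by rewrite !mulr_ge0 // ltW.
apply: le_trans (phi_le (minn_range d0)) _.
case/andP: hd => -> _; rewrite mul1r ler_pM2l // ler_nat.
exact: geq_minl.
Qed.

Let err n j := z n.+1 j - (z n j + (S n)^-1 * generator K l phi lam (z n) j).

Lemma leave_rate_indicator n j : (1 <= j < K.+1)%N ->
  l j * node_sum (fun d => (d == j)%:R) w n = l j * indicator_sum j n.
Proof.
move=> /andP[j0 jK]; rewrite /l /leave_rate; case: ifP => jK'; last by rewrite !mul0r.
by congr (_ * _); apply: eq_node_sum => d _; rewrite minn_eq_low.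
Qed.

(** Two sources of error: each step makes one birth instead of [total_birth / S], and the
    transitions run at the rates of the true counts while the generator is evaluated at [lumped],
    which differs by [m n]. *)
Lemma err_inflow n j : (0 < n)%N -> (1 <= j < K.+1)%N ->
  err n j = inflow (1 - (S n)^-1 * total_birth K l phi lam (z n))
                   (fun i => (S n)^-1 * (l i * m n i)) j.
Proof.
move=> n0 hj.
have step i : (1 <= i < K.+1)%N -> predictable i n.+1 =
    predictable i n + (S n)^-1 * (l i * (z n i + m n i)).
  move=> hi; rewrite /predictable big_nat_recr //= lumpedE // subrK.
  by rewrite -leave_rate_indicator // [in RHS]mulrC.
have dz : z n.+1 j - z n j = inflow 1 (fun i => predictable i n.+1 - predictable i n) j.
  by rewrite /z /lumped /inflow -natr1; case: eqP => _; ring.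
rewrite /err opprD addrA dz /generator /inflow (step j hj).
case: eqP => [_|/eqP j1]; first by ring.
have hj' : (1 <= j.-1 < K.+1)%N.
  by case/andP: hj; case: (j) j1 => [//|[//|i]] _ _ /= /ltnW.
by rewrite (step _ hj'); ring.
Qed.

(** Below [K] the eigenvector equation makes [birth_rate] equal to [f], so the birth functional of
    the degree counts is the total weight up to the nodes of degree at least [K]. This makes
    [total_birth / S] close to 1. *)
Lemma node_sum_birth_rate n :
  `|S n - node_sum (fun d => g (minn d K)) w n| <= (M + M ^+ 2) * tail_sum K n.
Proof.
rewrite /S -node_sumB /tail_sum -node_sumZ; apply: le_trans (ler_norm_sum _ _ _) _.
apply: ler_sum => i _; set d := deg w n i; have d0 : (0 < d)%N by [].
have MM : 0 <= M + M ^+ 2 by rewrite addr_ge0 ?sqr_ge0 // ltW.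
case: (leqP K d) => Kd; last first.
  rewrite birth_rate_low ?d0 // subrr normr0.
  by rewrite mul0r mulr0.
rewrite birth_rate_top mul1r.
have hK : (1 <= K < K.+1)%N by rewrite ltnS leqnn ltnW.
have pK := phi_gt0_from_min hK; have := phi_le hK.
have dK : K%:R <= d%:R :> R by rewrite ler_nat.
have := f_leM d0; have fd := f_gt0 d0.
move=> h1 h2; apply: le_trans (ler_normB _ _) _.
rewrite (gtr0_norm fd) gtr0_norm ?mulr_gt0 // mulrDl lerD //.
apply: (@le_trans _ _ (M * (M * K%:R))).
  by apply: ler_pM => //; exact: ltW.
by rewrite expr2 -mulrA ler_pM2l // ler_pM2l.
Qed.

(** The first term comes from the birth functional, the second from the transitions: [3 * (M * K)]
    from [phi], [M * K] from the rates, and 2 from [sum_normr_defect]. *)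
Definition noise_const : R := 2 * (M + M ^+ 2) * K%:R + 6 * (M * K%:R) ^+ 2.

Lemma wnorm_err n : (0 < n)%N ->
  wnorm K phi (err n) <=
  ((M + M ^+ 2) * tail_sum K n + noise_const * total_noise n) / (f 1%N * n%:R).
Proof.
move=> n0; pose G := 1 - (S n)^-1 * total_birth K l phi lam (z n).
pose x i := (S n)^-1 * (l i * m n i).
have f1 := f_gt0 (isT : (0 < 1)%N); have nR : 0 < n%:R :> R by rewrite ltr0n.
have S1 : f 1%N * n%:R <= S n by exact: node_sum_f_ge.
have fn0 : 0 < f 1%N * n%:R by rewrite mulr_gt0.
have S0 : 0 < S n by exact: lt_le_trans S1.
have Si : (S n)^-1 <= (f 1%N * n%:R)^-1 by rewrite lef_pV2 ?posrE.
have Si0 : 0 <= (S n)^-1 by rewrite invr_ge0 ltW.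
have MK0 : 0 <= M * K%:R by rewrite mulr_ge0 // ltW.
have N0 := total_noise_ge0 n.
have xK : x K = 0 by rewrite /x leave_rateK mul0r mulr0.
have err_le : wnorm K phi (err n) <= `|G| + 3 * (M * K%:R) * \sum_(1 <= j < K.+1) `|x j|.
  apply: (@le_trans _ _ (\sum_(1 <= j < K.+1)
      phi j * (inflow `|G| (fun i => `|x i|) j + 2 * `|x j|))).
    apply: ler_sum_nat => j hj; rewrite err_inflow // ler_wpM2l //.
      by case/andP: (phi_bound hj).
    exact: normr_inflow_le.
  under eq_bigr do rewrite mulrDr; rewrite big_split /= sum_inflow ?xK ?normr0 //.
  rewrite phi1 mul1r -addrA lerD2l -big_split /= mulr_sumr; apply: ler_sum_nat => j hj.
  have x0 := normr_ge0 (x j).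
  have /andP[p0 pj] := phi_bound hj.
  case: (ltnP j K) => jK; last first.
    have -> : j = K by apply/eqP; rewrite eqn_leq jK andbT; case/andP: hj.
    by rewrite xK normr0 !mulr0 addr0.
  have hj1 : (1 <= j.+1 < K.+1)%N by [].
  have /andP[p0' pj'] := phi_bound hj1.
  have -> : (phi j.+1 - phi j) * `|x j| + phi j * (2 * `|x j|) = (phi j.+1 + phi j) * `|x j|.
    by ring.
  by rewrite ler_wpM2r //; lra.
have x_le : \sum_(1 <= j < K.+1) `|x j| <= (S n)^-1 * (M * K%:R * (2 * total_noise n)).
  rewrite /x; under eq_bigr do rewrite normrM (ger0_norm Si0) normrM.
  rewrite -mulr_sumr ler_wpM2l //.
  have lj j : (1 <= j < K.+1)%N -> 0 <= l j <= M * K%:R.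
    move=> /andP[j0 jK]; rewrite leave_rate_ge0 //= /l /leave_rate; case: ifP => // _.
    by apply: le_trans (f_leM j0) _; rewrite ler_pM2l // ler_nat -ltnS.
  apply: le_trans (sum_defect_le n lj); apply: ler_sum_nat => j /lj /andP[l0 _].
  by rewrite (ger0_norm l0).
have G_le : `|G| <= (S n)^-1 *
    ((M + M ^+ 2) * tail_sum K n + (M + M ^+ 2) * K%:R * (2 * total_noise n)).
  have -> : G = (S n)^-1 * (S n - total_birth K l phi lam (z n)).
    by rewrite /G mulrBr mulVf // gt_eqF.
  rewrite normrM (ger0_norm Si0) ler_wpM2l //.
  have -> : S n - total_birth K l phi lam (z n) =
      (S n - node_sum (fun d => g (minn d K)) w n) + \sum_(1 <= j < K.+1) g j * m n j.
    rewrite -sum_indicator_sum -addrA; congr (_ + _).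
    rewrite addrC -opprB -sumrB; congr (- _).
    by apply: eq_big_nat => j hj; rewrite lumpedE // -/g mulrBr.
  apply: le_trans (ler_normD _ _) _; apply: lerD; first exact: node_sum_birth_rate.
  apply: le_trans (ler_norm_sum _ _ _) _.
  have gj j : (1 <= j < K.+1)%N -> 0 <= g j <= (M + M ^+ 2) * K%:R.
    move=> hj; rewrite birth_rate_ge0 //=; apply: le_trans (birth_rate_leM hj) _.
    rewrite ler_wpM2l ?addr_ge0 ?sqr_ge0 //; first exact: ltW.
    by rewrite ler_nat -ltnS; case/andP: hj.
  apply: le_trans (sum_defect_le n gj); apply: ler_sum_nat => j /gj /andP[g0 _].
  by rewrite normrM (ger0_norm g0).
apply: le_trans err_le _.
apply: (@le_trans _ _ ((S n)^-1 *
   ((M + M ^+ 2) * tail_sum K n + noise_const * total_noise n))).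
  have MK3 : 0 <= 3 * (M * K%:R) by rewrite mulr_ge0.
  have := ler_wpM2l MK3 x_le; move: G_le; rewrite /noise_const.
  by move: (S n)^-1 (tail_sum K n) (total_noise n) => s t N; lra.
have A0 : 0 <= M + M ^+ 2 by rewrite addr_ge0 ?sqr_ge0 // ltW.
have tail0 : 0 <= tail_sum K n by apply: node_sum_ge0 => d _; rewrite mulr_ge0.
have nc0 : 0 <= noise_const.
  apply: addr_ge0; apply: mulr_ge0 => //; [exact: mulr_ge0 | exact: sqr_ge0].
by rewrite mulrC ler_wpM2l // addr_ge0 // mulr_ge0.
Qed.

Context (K0 : nat) (kappa tau e : R) (K0K : (K0 <= K)%N).
Context (kappa_gt0 : 0 < kappa) (tau_gt0 : 0 < tau) (e_gt0 : 0 < e).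
Context (rate_ge : forall j, (1 <= j < K0.+1)%N -> kappa * phi j <= g j).
Context (noise_small : forall s, 0 < s -> \forall n \near \oo, total_noise n <= s * n%:R).
Context (tail_small : forall n, (0 < n)%N -> M * tail_sum K0.+1 n <= tau / 2 * n%:R).
Context (top_small : forall n, (0 < n)%N ->
  (M + M ^+ 2) * tail_sum K n <= e / 2 * (f 1%N * n%:R)).
Context (profile_tail : 3 * M / phi_min * \sum_(K0.+1 <= j < K.+1) phi j * p j <= tau).

Lemma profile_bounds j : (1 <= j < K.+1)%N -> 0 <= p j <= 1.
Proof.
move=> hj; have pj i : 0 <= p i by apply: profile_ge0 => //; exact: leave_rate_ge0.
rewrite pj /= -(sum_profile1 K_gt1 lam_gt0 leave_rate_ge0 leave_rateK).
rewrite (bigD1_seq j) ?mem_index_iota ?iota_uniq //= lerDl.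
exact: sumr_ge0.
Qed.

Lemma profile_mean_ge : phi_min <= Phi p.
Proof.
rewrite -[leLHS]mulr1 -(sum_profile1 K_gt1 lam_gt0 leave_rate_ge0 leave_rateK).
rewrite mulr_sumr; apply: ler_sum_nat => j hj.
by rewrite ler_wpM2r ?phi_ge //; case/andP: (profile_bounds hj).
Qed.

Lemma lumped_near (eps : R) : 0 < eps -> \forall n \near \oo,
  [/\ Phi (z n) <= 3 * M * n%:R, total_noise n <= eps * n%:R &
      wnorm K phi (deviation K l phi lam (z n)) <=
    ((8 * (f 1%N)^-1 * tau + 10 * e / kappa) / ((2 * M)^-1 * (phi_min / 2)) + eps) * Phi (z n)].
Proof.
move=> eps0.
have f1 := f_gt0 (isT : (0 < 1)%N).
have MK0 : 0 < M * K%:R by rewrite mulr_gt0 // ltr0n ltnW.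
have nc0 : 0 < noise_const.
  by rewrite /noise_const addr_gt0 // !mulr_gt0 ?exprn_gt0 ?addr_gt0 ?exprn_gt0 // ltr0n ltnW.
(* The first condition keeps [Phi (z n)] of order [n] and the norm below twice [Phi]: the defect
   enters the norm once and twice [Phi] twice, whence 6 after the factor 2. The others leave half of
   [tau] and half of [e] to the tails. *)
have [s [s0 sK stau se]] : exists s : R, [/\ 0 < s, 6 * (M * K%:R) * s <= Num.min M (phi_min / 2),
    2 * (M * K%:R) * s <= tau / 2 & noise_const * s <= e / 2 * f 1%N].
  pose s1 := Num.min M (phi_min / 2) / (6 * (M * K%:R)).
  pose s2 := tau / 2 / (2 * (M * K%:R)).
  pose s3 := e / 2 * f 1%N / noise_const.
  have MK6 : 0 < 6 * (M * K%:R) by rewrite pmulr_rgt0.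
  have MK2 : 0 < 2 * (M * K%:R) by rewrite pmulr_rgt0.
  have ef : 0 < e / 2 * f 1%N by rewrite mulr_gt0 ?divr_gt0.
  have s10 : 0 < s1 by rewrite /s1 divr_gt0 // lt_min M_gt0 divr_gt0.
  have s20 : 0 < s2 by rewrite /s2 !divr_gt0.
  have s30 : 0 < s3 by rewrite /s3 divr_gt0.
  exists (Num.min s1 (Num.min s2 s3)); split.
  - by rewrite !lt_min s10 s20 s30.
  - by rewrite mulrC -ler_pdivlMr // ge_min lexx.
  - by rewrite mulrC -ler_pdivlMr // !ge_min lexx !orbT.
  - by rewrite mulrC -ler_pdivlMr // !ge_min lexx !orbT.
have near_small : \forall n \near \oo, (0 < n)%N /\ total_noise n <= s * n%:R.
  by have := noise_small s0; apply: filterS2 (nbhs_infty_gt 0) => n.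
have zb n : (0 < n)%N -> total_noise n <= s * n%:R ->
   [/\ phi_min / 2 * n%:R <= Phi (z n), Phi (z n) <= 3 * M * n%:R &
     wnorm K phi (z n) <= 2 * Phi (z n)].
  move=> n0 hs; have /andP[P1 P2] := Psi_bounds n0.
  have := Phi_lumped n0; have := wnorm_lumped n0.
  have nR : 0 <= n%:R :> R by [].
  move: sK; rewrite le_min => /andP[sM sf].
  have h := ler_wpM2l (ltW MK0) hs.
  have hM := ler_wpM2r nR sM; have hf := ler_wpM2r nR sf.
  rewrite ler_norml => wz /andP[lo hi].
  by split; lra.
have dyn := lumped_dynamics K_gt1 lam_gt0 phi1 phi_gt0_from_min leave_rate_ge0 leave_rateK
  birth_rate_ge0 (z := z) (t := fun n => (S n)^-1) (c0 := phi_min / 2) (t0 := (2 * M)^-1)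
  (t1 := (f 1%N)^-1) (tau := tau) (e := e) (kappa := kappa) (K0 := K0).
have {}dyn := dyn _ _ _ (ltW tau_gt0) (ltW e_gt0) kappa_gt0 K0K rate_ge _ eps eps0.
have hnear : \forall n \near \oo,
    [/\ (2 * M)^-1 / n%:R <= (S n)^-1 <= (f 1%N)^-1 / n%:R,
      phi_min / 2 * n%:R <= Phi (z n) /\ wnorm K phi (z n) <= 2 * Phi (z n),
      \sum_(K0.+1 <= j < K.+1) phi j * `|z n j| <= tau * n%:R,
      Phi (z n) / Phi p * (\sum_(K0.+1 <= j < K.+1) phi j * `|p j|) <= tau * n%:R &
      wnorm K phi (err n) <= e].
  apply: filterS near_small => n [n0 hs].
  have nR : 0 < n%:R :> R by rewrite ltr0n.
  have [z1 z2 z3] := zb n n0 hs.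
  have f1n : 0 < f 1%N * n%:R by rewrite mulr_gt0.
  have S1 : f 1%N * n%:R <= S n by exact: node_sum_f_ge.
  have S0 : 0 < S n by exact: lt_le_trans S1.
  have S2 : S n <= 2 * M * n%:R.
    apply: (@le_trans _ _ (node_sum (fun d => M * d%:R) w n)).
      by apply: ler_node_sum => d d0; exact: f_leM.
    by rewrite node_sumZ node_sum_id // [2 * M]mulrC -mulrA ler_pM2l //; lra.
  split.
  - by rewrite -!invfM !lef_pV2 ?posrE ?mulr_gt0 // S2 S1.
  - by split.
  - apply: le_trans (tail_lumped n0 K0K) _; have := tail_small n0.
    have := ler_wpM2l (ltW MK0) hs; have := ler_wpM2r (ltW nR) stau; lra.
  - have -> : \sum_(K0.+1 <= j < K.+1) phi j * `|p j| = \sum_(K0.+1 <= j < K.+1) phi j * p j.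
      apply: eq_big_nat => j /andP[j1 j2]; rewrite ger0_norm //.
      have hj : (1 <= j < K.+1)%N by rewrite j2 (leq_trans _ j1).
      by case/andP: (profile_bounds hj).
    have pt0 : 0 <= \sum_(K0.+1 <= j < K.+1) phi j * p j.
      rewrite big_nat_cond; apply: sumr_ge0 => j /andP[/andP[j1 j2] _].
      have hj : (1 <= j < K.+1)%N by rewrite j2 (leq_trans _ j1).
      rewrite mulr_ge0 //; first by case/andP: (phi_bound hj).
      by case/andP: (profile_bounds hj).
    have pm := profile_mean_ge.
    apply: (@le_trans _ _ (3 * M / phi_min * n%:R * \sum_(K0.+1 <= j < K.+1) phi j * p j)).
      rewrite ler_wpM2r // mulrAC ler_pM ?invr_ge0 //.
      - by rewrite (le_trans _ z1) // mulr_ge0 // divr_ge0 // ltW.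
      - by rewrite (le_trans (ltW phi_min_gt0)).
      - by rewrite lef_pV2 ?posrE // (lt_le_trans phi_min_gt0).
    by rewrite mulrAC ler_pM2r.
  - apply: le_trans (wnorm_err n0) _; rewrite ler_pdivrMr //.
    have := top_small n0; have := ler_wpM2l (ltW nc0) hs.
    have := ler_wpM2r (ltW nR) se; lra.
have {}dyn : \forall n \near \oo, wnorm K phi (deviation K l phi lam (z n)) <=
    ((8 * (f 1%N)^-1 * tau + 10 * e / kappa) / ((2 * M)^-1 * (phi_min / 2)) + eps) * Phi (z n).
  by apply: dyn => //; rewrite ?divr_gt0 ?invr_gt0 ?mulr_gt0.
have noise_eps := noise_small eps0.
apply: filterS3 dyn near_small noise_eps => n h1 [n0 hs] h2.
by have [_ z2 _] := zb n n0 hs; split.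
Qed.

(** Undoes the lumping and the normalization: counts differ from [lumped] by noise, [lumped] from a
    multiple of the profile by the deviation, and that multiple is close to [n]. *)
Lemma lumped_close (eps : R) : 0 < eps -> \forall n \near \oo, forall j, (1 <= j < K.+1)%N ->
  `|indicator_sum j n - p j * n%:R| <=
  (6 * M / phi_min * ((8 * (f 1%N)^-1 * tau + 10 * e / kappa) / ((2 * M)^-1 * (phi_min / 2)) + eps)
    + 2 * eps) * n%:R.
Proof.
move=> eps0; have f1 := f_gt0 (isT : (0 < 1)%N).
set rho := (X in _ * X + _).
have rho0 : 0 <= rho.
  rewrite /rho addr_ge0 ?(ltW eps0) // divr_ge0 ?addr_ge0 ?mulr_ge0 ?divr_ge0 //;
    by rewrite ?invr_ge0 ?mulr_ge0 ?ltW.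
have := lumped_near eps0; apply: filterS2 (nbhs_infty_gt 0) => n n0 [h1 h2 h3] j hj.
set u := deviation K l phi lam (z n) in h3.
have sum_u : \sum_(1 <= i < K.+1) `|u i| <= rho * (3 * M * n%:R) / phi_min.
  rewrite ler_pdivlMr // mulrC.
  apply: le_trans (ler_wpM2l rho0 h1); apply: le_trans h3; rewrite /wnorm mulr_sumr.
  by apply: ler_sum_nat => i hi; rewrite ler_wpM2r ?phi_ge.
have uj : `|u j| <= \sum_(1 <= i < K.+1) `|u i|.
  rewrite (bigD1_seq j) ?mem_index_iota ?iota_uniq //= lerDl; exact: sumr_ge0.
have mj : `|m n j| <= 2 * total_noise n.
  apply: le_trans (sum_normr_defect n).
  rewrite (bigD1_seq j) ?mem_index_iota ?iota_uniq //= lerDl; exact: sumr_ge0.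
pose c := Phi (z n) / Phi p.
(* [lumped] has total mass exactly [n] and the profile mass 1, so [n - c] is the mass of the
   deviation. *)
have cn : `|n%:R - c| <= \sum_(1 <= i < K.+1) `|u i|.
  have -> : n%:R - c = \sum_(1 <= i < K.+1) u i.
    rewrite /u /deviation sumrB -mulr_sumr.
    rewrite (sum_profile1 K_gt1 lam_gt0 leave_rate_ge0 leave_rateK) mulr1; congr (_ - _).
    have := @sum_inflow _ K K_gt1 (fun=> 1) n%:R (predictable^~ n).
    have -> : predictable K n = 0.
      by rewrite /predictable big1 // => i _; rewrite leave_rateK !mul0r.
    move=> /(_ erefl); rewrite mul1r [X in _ = _ + X]big1 ?addr0.
      by move=> <-; apply: eq_bigr => i _; rewrite mul1r.
    by move=> i _; rewrite subrr mul0r.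
  exact: ler_norm_sum.
have /andP[p0 p1] := profile_bounds hj.
have -> : indicator_sum j n - p j * n%:R = m n j + u j - (n%:R - c) * p j.
  have -> : u j = z n j - c * p j by [].
  by rewrite (lumpedE n0 hj); ring.
apply: le_trans (ler_normB _ _) _; rewrite normrM (ger0_norm p0).
have cp : `|n%:R - c| * p j <= `|n%:R - c| by rewrite ler_piMr.
have := ler_normD (m n j) (u j).
have -> : 6 * M / phi_min * rho = 2 * (rho * (3 * M) / phi_min) by field; rewrite gt_eqF.
have e1 : rho * (3 * M * n%:R) / phi_min = rho * (3 * M) / phi_min * n%:R by field; rewrite gt_eqF.
rewrite e1 in sum_u; rewrite mulrDl.
move: sum_u uj mj cn cp h2.
move: (rho * (3 * M) / phi_min) => X; lra.
Qed.

End lumped_path.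

(** * Convergence of the degree fractions *)

Section path_limit.
Context {R : realType} (f : nat -> R) (f_gt0 : forall k, (0 < k)%N -> 0 < f k).
Context (f_nd : forall k l, (0 < k)%N -> (k <= l)%N -> f k <= f l).
Context (a b s1 eta : R) (a_ge0 : 0 <= a) (b_ge0 : 0 <= b).
Context (f_le : forall k, (0 < k)%N -> f k <= a * k%:R + b).
Context (eta_gt0 : 0 < eta) (eta_le1 : eta <= 1) (gap : a * (1 + eta) < s1).
Context (M phi_min : R) (M_gt0 : 0 < M) (phi_min_gt0 : 0 < phi_min).
Context (f_leM : forall k, (0 < k)%N -> f k <= M * k%:R).
Context (eigen : forall K, (1 < K)%N -> exists (lam : R) (phi : nat -> R),
  [/\ s1 <= lam <= M, phi 1%N = 1,
      forall j, (1 <= j < K.+1)%N -> phi_min <= phi j <= M * j%:R &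
      forall j, (1 <= j < K)%N -> phi j * (f j + lam) = f j * (1 + phi j.+1)]).
Context (w : nat -> nat) (w_regular : regular_path f eta w).

(** The primitive weight is superlinear while its node sum is [O(n)], so large degrees carry a small
    share of the total degree, uniformly in [n]. *)
Lemma tail_sum_small (d : R) : 0 < d -> exists K, forall k n, (K <= k)%N -> (0 < n)%N ->
  tail_sum w k n <= d * n%:R.
Proof.
move=> d0; have [_ _ [C hC]] := w_regular.
have C1 : 0 < `|C| + 1 by rewrite ltr_wpDl.
have [K hK] := cum_weight_dominates_id eta_gt0 eta_le1 (divr_gt0 d0 C1).
exists K => k n Kk n0.
apply: (@le_trans _ _ (node_sum (fun i => d / (`|C| + 1) * cum_weight eta i) w n)).
  apply: ler_node_sum => i i0; case: leqP => [ki|_]; rewrite /= ?mul1r ?mul0r.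
    exact/hK/(leq_trans Kk).
  by rewrite mulr_ge0 ?(divr_ge0 (ltW d0) (ltW C1)) // cum_weight_ge0 // ltW.
rewrite node_sumZ; apply: le_trans (ler_wpM2l _ (hC n n0)) _.
  by rewrite divr_ge0 ?(ltW d0) ?(ltW C1).
rewrite mulrA ler_wpM2r // mulrAC ler_pdivrMr // ler_pM2l //.
by rewrite (le_trans (ler_norm C)) // lerDl.
Qed.

(** The analogue for the profile of the moment bound on the tree, with the same gap: [sum_profile]
    tested on [cum_weight]. The bound does not depend on [K], so [K0] can be chosen first. *)
Lemma profile_moment K lam (phi : nat -> R) : (1 < K)%N -> s1 <= lam -> phi 1%N = 1 ->
  (forall j, (1 <= j < K.+1)%N -> 0 < phi j) ->
  (forall j, (1 <= j < K)%N -> phi j * (f j + lam) = f j * (1 + phi j.+1)) ->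
  \sum_(1 <= j < K.+1) cum_weight eta j * profile (leave_rate f K) lam j
    <= 2 * (a + b) / (s1 - a * (1 + eta)).
Proof.
move=> K1 s1lam phi1 phi0 phi_eq; set l := leave_rate f K; set p := profile l lam.
have a1 : 0 <= a * (1 + eta) by rewrite mulr_ge0 // addr_ge0 // ltW.
have s10 : 0 < s1 by exact: le_lt_trans gap.
have lam0 : 0 < lam by exact: lt_le_trans s1lam.
have l0 := leave_rate_ge0 f_gt0 K; have lK := leave_rateK f K.
have p0 j : 0 <= p j by apply: profile_ge0.
(* Tested on the identity, [sum_profile] gives [lam] plus the mean of [l]; as [l <= birth_rate],
   whose mean is [lam], the sum is at most [2 * lam]. *)
have moment1 : \sum_(1 <= j < K.+1) j%:R * p j <= 2.
  rewrite -(ler_pM2l lam0) (sum_profile K1 lam0 l0 lK).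
  have -> : lam * 2 = 1 * lam + lam by ring.
  rewrite lerD2l -[leRHS](total_birth_profile K1 lam0 phi1 l0 lK).
  apply: ler_sum_nat => j hj; rewrite -natrB // subSnn mul1r ler_wpM2r //.
  case: (ltnP j K) => jK.
    rewrite (birth_rate_low phi_eq) ?jK ?andbT //; last by case/andP: hj.
    by rewrite /l /leave_rate jK.
  rewrite /l /leave_rate ltnNge jK /=.
  have -> : j = K by apply/eqP; rewrite eqn_leq jK andbT; case/andP: hj.
  rewrite birth_rate_top mulr_ge0 ?ltW // phi0 // ltnS leqnn ltnW //.
have gap0 : 0 < s1 - a * (1 + eta) by rewrite subr_gt0.
rewrite ler_pdivlMr //.
set H := \sum_(_ <= _ < _) _.
have H0 : 0 <= H.
  by apply: sumr_ge0 => j _; rewrite mulr_ge0 // cum_weight_ge0 // ltW.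
have e1 : lam * H <= a * (1 + eta) * H + (a + b) * \sum_(1 <= j < K.+1) j%:R * p j.
  rewrite /H (sum_profile K1 lam0 l0 lK) cum_weight1 mul0r add0r.
  rewrite !mulr_sumr -big_split /=; apply: ler_sum_nat => j /andP[j0 jK].
  rewrite cum_weightS // !mulrA -mulrDl ler_wpM2r //.
  apply: le_trans (weight_affine_le (ltW eta_gt0) eta_le1 a_ge0 b_ge0 j0).
  have w0 : 0 <= weight eta j by exact: le_trans ler01 (weight_ge1 j (ltW eta_gt0)).
  rewrite ler_wpM2l // /l /leave_rate; case: ifP => _; first exact: f_le.
  by rewrite addr_ge0 ?mulr_ge0.
have ab : 0 <= a + b by rewrite addr_ge0.
have := ler_wpM2l ab moment1; have := ler_wpM2r H0 s1lam; lra.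
Qed.

Lemma total_noise_small K (s : R) : 0 < s ->
  \forall n \near \oo, total_noise f w K n <= s * n%:R.
Proof.
move=> s0; have [_ hN _] := w_regular.
have hu k : (0 < k)%N -> (fun n => noise f w K k n / n%:R) @ \oo --> 0.
  move=> k0; rewrite /noise; case: ltnP => _; first exact: hN.
  under eq_fun do rewrite mul0r.
  exact: cvg_cst.
apply: filterS2 (nbhs_infty_gt 0) (near_sum_norm_le K.+1 hu s0) => n n0 h.
rewrite -ler_pdivrMr ?ltr0n // mulr_suml; apply: le_trans h; apply: ler_sum => j _.
by rewrite normrM [`|_^-1|]gtr0_norm ?invr_gt0 ?ltr0n.
Qed.

(** The order of choice is what matters: [tau] from [eps], [K0] from [tau], [kappa] from [K0], [e]
    from [kappa], and [K] last, from [e]. It avoids a circle because [M], [phi_min] and the moment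
    bounds are uniform in [K]. *)
Lemma degree_fraction_close k (eps : R) : (0 < k)%N -> 0 < eps ->
  exists x, \forall n \near \oo, `|node_sum (fun d => (d == k)%:R) w n - x * n%:R| <= eps * n%:R.
Proof.
move=> k0 eps0.
have f1 := f_gt0 (isT : (0 < 1)%N).
have [B BE] : exists x : R, x = 6 * M / phi_min by eexists.
have [D DE] : exists x : R, x = (2 * M)^-1 * (phi_min / 2) by eexists.
have B0 : 0 < B by rewrite BE divr_gt0 ?mulr_gt0.
have D0 : 0 < D by rewrite DE mulr_gt0 ?invr_gt0 ?mulr_gt0 // divr_gt0.
(* [tau] and [e] are such that each contributes [eps / (4 * B)] to the relative deviation in
   [lumped_close]. *)
have [tau tauE] : exists x : R, x = eps * D * f 1%N / (32 * B) by eexists.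
have tau0 : 0 < tau by rewrite tauE divr_gt0 ?mulr_gt0.
have [Cp CpE] : exists x : R, x = 2 * (a + b) / (s1 - a * (1 + eta)) + 1 by eexists.
have Cp0 : 0 < Cp.
  by rewrite CpE ltr_wpDl // divr_ge0 ?subr_ge0 ?(ltW gap) // mulr_ge0 // addr_ge0.
have [K1 hK1] := tail_sum_small (divr_gt0 tau0 (mulr_gt0 (ltr0n R 2) M_gt0)).
have dp0 : 0 < tau * phi_min / (3 * M ^+ 2 * Cp).
  by rewrite divr_gt0 ?mulr_gt0 // exprn_gt0.
have [K2 hK2] := cum_weight_dominates_id eta_gt0 eta_le1 dp0.
pose K0 := maxn k (maxn K1 K2).
(* On states up to [K0] the birth rate is at least [f 1] and [phi] is at most [M * K0.+1]. *)
have [kappa kappaE] : exists x : R, x = f 1%N / (M * K0.+1%:R) by eexists.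
have kappa0 : 0 < kappa by rewrite kappaE divr_gt0 // mulr_gt0 // ltr0n.
have [e eE] : exists x : R, x = kappa * D * eps / (40 * B) by eexists.
have e0 : 0 < e by rewrite eE divr_gt0 ?mulr_gt0.
have MM0 : 0 < M + M ^+ 2 by rewrite addr_gt0 // exprn_gt0.
have [K3 hK3] := tail_sum_small (divr_gt0 (mulr_gt0 (divr_gt0 e0 (ltr0n R 2)) f1) MM0).
pose K := maxn K0.+2 K3.
have K0K : (K0 < K)%N by rewrite /K leq_max leqW.
have K1_gt : (1 < K)%N by rewrite /K leq_max.
have [lam [phi [/andP[lam_lo lam_hi] phi1 phi_b phi_eq]]] := eigen K1_gt.
have s10 : 0 < s1.
  by apply: le_lt_trans gap; rewrite mulr_ge0 // addr_ge0 // ltW.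
have lam0 : 0 < lam by exact: lt_le_trans lam_lo.
have phi_lo j : (1 <= j < K.+1)%N -> phi_min <= phi j by move=> /phi_b /andP[].
have phi_hi j : (1 <= j < K.+1)%N -> phi j <= M * j%:R by move=> /phi_b /andP[].
have phi0 j : (1 <= j < K.+1)%N -> 0 < phi j by move=> /phi_lo; exact: lt_le_trans.
have rate j : (1 <= j < K0.+1)%N -> kappa * phi j <= birth_rate (leave_rate f K) phi lam j.
  move=> /andP[j0 jK0]; have jK : (j < K)%N by exact: leq_ltn_trans K0K.
  rewrite (birth_rate_low phi_eq) ?j0 //; apply: le_trans (f_nd _ j0) => //.
  rewrite kappaE mulrAC ler_pdivrMr ?mulr_gt0 ?ltr0n // ler_pM2l //.
  have hj : (1 <= j < K.+1)%N by rewrite j0 leqW.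
  by apply: le_trans (phi_hi j hj) _; rewrite ler_pM2l // ler_nat ltnW.
have tailA n : (0 < n)%N -> M * tail_sum w K0.+1 n <= tau / 2 * n%:R.
  move=> n0; have := hK1 K0.+1 n _ n0.
  rewrite (leqW (leq_trans (leq_maxl K1 K2) (leq_maxr k _))) => /(_ isT).
  move/(ler_wpM2l (ltW M_gt0)) => /le_trans; apply.
  by rewrite mulrA ler_wpM2r // le_eqVlt; apply/orP; left; apply/eqP; field; rewrite gt_eqF.
have tailB n : (0 < n)%N -> (M + M ^+ 2) * tail_sum w K n <= e / 2 * (f 1%N * n%:R).
  move=> n0; have := hK3 K n (leq_maxr _ _) n0.
  move/(ler_wpM2l (ltW MM0)) => /le_trans; apply.
  rewrite le_eqVlt; apply/orP; left; apply/eqP.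
  by move: MM0; move: (M + M ^+ 2) => x x0; field; rewrite gt_eqF.
have ptail : 3 * M / phi_min * \sum_(K0.+1 <= j < K.+1) phi j * profile (leave_rate f K) lam j
    <= tau.
  have mom := profile_moment K1_gt lam_lo phi1 phi0 phi_eq.
  have p0 j : 0 <= profile (leave_rate f K) lam j.
    by apply: profile_ge0 => //; apply: leave_rate_ge0.
  have [del delE] : exists x : R, x = tau * phi_min / (3 * M ^+ 2 * Cp) by eexists.
  rewrite -delE in dp0 hK2.
  apply: (@le_trans _ _ (3 * M / phi_min * (M * (del * Cp)))).
    rewrite ler_wpM2l //; first by rewrite divr_ge0 ?mulr_ge0 ?ltW.
    apply: (@le_trans _ _ (\sum_(K0.+1 <= j < K.+1)
        M * (del * (cum_weight eta j * profile (leave_rate f K) lam j)))).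
      apply: ler_sum_nat => j /andP[jK0 jK].
      rewrite !mulrA ler_wpM2r //; apply: le_trans (phi_hi j _) _.
        by rewrite jK (leq_trans _ jK0).
      rewrite -mulrA ler_pM2l // hK2 //.
      by rewrite (leq_trans _ (ltnW jK0)) // /K0 !leq_max leqnn !orbT.
    rewrite -!mulr_sumr ler_pM2l // ler_pM2l //.
    apply: le_trans (_ : _ <= \sum_(1 <= j < K.+1)
      cum_weight eta j * profile (leave_rate f K) lam j) _.
      rewrite [leRHS](@big_cat_nat _ _ _ K0.+1) //=; last by rewrite ltnW.
      rewrite lerDr; apply: sumr_ge0 => j _.
      by rewrite mulr_ge0 // cum_weight_ge0 // ltW.
    by apply: le_trans mom _; rewrite CpE lerDl.
  rewrite delE le_eqVlt; apply/orP; left; apply/eqP.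
  by field; rewrite !gt_eqF.
have B2 : 0 < B + 2 by rewrite addr_gt0.
have [ee eeE] : exists x : R, x = eps / (4 * (B + 2)) by eexists.
have ee0 : 0 < ee by rewrite eeE divr_gt0 // mulr_gt0.
have hist := w_regular; case: hist => hist _ _.
have close := lumped_close f_gt0 f_nd hist M_gt0 phi_min_gt0 f_leM K1_gt lam0 lam_hi phi1
  phi_lo phi_hi phi_eq (ltnW K0K) kappa0 tau0 e0 rate (total_noise_small K)
  tailA tailB ptail ee0.
exists (profile (leave_rate f K) lam k).
have kK : (k < K)%N by apply: leq_ltn_trans K0K; rewrite leq_maxl.
move: close; apply: filterS => n /(_ k).
rewrite k0 ltnS (ltnW kK) => /(_ isT).
have -> : indicator_sum w K k n = node_sum (fun d => (d == k)%:R) w n :> R.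
  by rewrite /indicator_sum; apply: eq_node_sum => d _; rewrite minn_eq_low.
move=> /le_trans; apply; rewrite ler_wpM2r // -BE -DE.
have -> : (8 / f 1%N * tau + 10 * e / kappa) / D = eps / (2 * B).
  by rewrite tauE eE; field; rewrite !gt_eqF.
have -> : B * (eps / (2 * B) + ee) + 2 * ee = eps / 2 + (B + 2) * ee.
  by field; rewrite gt_eqF.
have -> : (B + 2) * ee = eps / 4.
  by rewrite eeE; field; rewrite gt_eqF.
by lra.
Qed.

(** The centre [x] depends on the precision through [K]; the Cauchy criterion asks for one centre
    per radius only. *)
Lemma degree_fraction_cvg k : (0 < k)%N ->
  cvgn (fun n => node_sum (fun d => (d == k)%:R) w n / n%:R : R).
Proof.
move=> k0; apply: cauchy_cvg; apply: cauchy_exP => e e0.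
have e2 : 0 < e / 2 by rewrite divr_gt0.
have [x hx] := degree_fraction_close k0 e2.
exists x; apply: filterS2 (nbhs_infty_gt 0) hx => n n0 hn.
rewrite /ball /= distrC; apply: (@le_lt_trans _ _ (e / 2)); last by lra.
have nR : 0 < n%:R :> R by rewrite ltr0n.
rewrite -(ler_pM2r nR) -[X in _ * X <= _](gtr0_norm nR) -normrM mulrBl divfK ?gt_eqF //.
Qed.

End path_limit.

(* [ergodic_path] is what the estimator sees of the tree: the fraction of steps that
   choose a node of degree [k] is asymptotically the current weight of degree [k]. *)
Definition choice_freq {R : realType} (w : nat -> nat) (k n : nat) : R :=
  (\sum_(1 <= i < n) (chosen_deg w i == k)%:R) / n%:R.

Definition degree_weight {R : realType} (f : nat -> R) (w : nat -> nat) (k n : nat) : R :=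
  attach_mean f (fun d => (d == k)%:R) w n.

Definition ergodic_path {R : realType} (f : nat -> R) (eta : R) (w : nat -> nat) : Prop :=
  [/\ regular_path f eta w,
      forall k, (0 < k)%N ->
        (fun n => choice_freq w k n - degree_weight f w k n) @ \oo --> 0 &
      forall k, (0 < k)%N -> exists2 c : R, 0 < c &
        \forall n \near \oo, c <= degree_weight f w k n].

(** * Limits of the total weight and of the choice frequencies *)

Section ergodic.
Context {R : realType} (f : nat -> R) (f_gt0 : forall k, (0 < k)%N -> 0 < f k).
Context (f_nd : forall k l, (0 < k)%N -> (k <= l)%N -> f k <= f l).
Context (M eta : R) (M_gt0 : 0 < M) (f_leM : forall k, (0 < k)%N -> f k <= M * k%:R).
Context (eta_gt0 : 0 < eta) (eta_le1 : eta <= 1).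
Context (w : nat -> nat) (w_regular : regular_path f eta w).
Context (frac_cvg : forall k, (0 < k)%N ->
  cvgn (fun n => node_sum (fun d => (d == k)%:R) w n / n%:R : R)).

Let frac k n : R := node_sum (fun d => (d == k)%:R) w n / n%:R.
Let S n := node_sum f w n.

(** Finitely many degrees converge one by one, and the rest is at most [M * tail_sum], uniformly in
    time. *)
Lemma total_weight_cvg : exists2 s : R, 0 < s & (fun n => S n / n%:R) @ \oo --> s.
Proof.
have f1 := f_gt0 (isT : (0 < 1)%N).
have Scvg : cvgn (fun n => S n / n%:R : R).
  apply: cauchy_cvg; apply: cauchy_exP => e e0.
  have eM : 0 < e / (4 * M) by rewrite divr_gt0 ?mulr_gt0.
  have [K hK] := tail_sum_small eta_gt0 eta_le1 w_regular eM.
  have lowE n : node_sum (fun d => if (d < K)%N then f d else 0) w n / n%:R =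
      \sum_(1 <= j < K) f j * frac j n.
    by rewrite -sum_node_sum_indicator mulr_suml; apply: eq_bigr => j _; rewrite mulrA.
  have lowcvg m : cvgn (fun n => \sum_(1 <= j < m.+1) f j * frac j n).
    elim: m => [|m IHm].
      under eq_fun do rewrite big_geq //.
      exact: is_cvg_cst.
    under eq_fun do rewrite big_nat_recr //=.
    apply: is_cvgD => //; apply: is_cvgM; first exact: is_cvg_cst.
    exact: frac_cvg.
  have := lowcvg K.-1 => /cvgrPdist_le/(_ (e / 4)).
  set x := lim _ => /(_ _)/= hx; exists x.
  have e4 : 0 < e / 4 by rewrite divr_gt0.
  apply: filterS2 (nbhs_infty_gt 0) (hx e4) => n n0 hn.
  have nR : 0 < n%:R :> R by rewrite ltr0n.
  rewrite /ball /=.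
  have -> : S n / n%:R = \sum_(1 <= j < K.-1.+1) f j * frac j n +
      node_sum (fun d => (K <= d)%N%:R * f d) w n / n%:R.
    have -> : \sum_(1 <= j < K.-1.+1) f j * frac j n = \sum_(1 <= j < K) f j * frac j n.
      by case: (K) => //=; rewrite !big_geq.
    rewrite -lowE -mulrDl -node_sumD; congr (_ / _); apply: eq_node_sum => d _.
    by case: ltnP => _; rewrite ?mul1r ?add0r ?mul0r ?addr0.
  have t0 : 0 <= node_sum (fun d => (K <= d)%N%:R * f d) w n / n%:R.
    rewrite divr_ge0 //; apply: node_sum_ge0 => d d0; rewrite mulr_ge0 //.
    exact/ltW/f_gt0.
  have t1 : node_sum (fun d => (K <= d)%N%:R * f d) w n / n%:R <= e / 4.
    rewrite ler_pdivrMr //; apply: (@le_trans _ _ (M * tail_sum w K n)).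
      rewrite /tail_sum -node_sumZ; apply: ler_node_sum => d d0.
      by rewrite mulrCA ler_wpM2l // f_leM.
    have := ler_wpM2l (ltW M_gt0) (hK K n (leqnn _) n0) => /le_trans; apply.
    rewrite le_eqVlt; apply/orP; left; apply/eqP; field; rewrite gt_eqF //.
  apply: (@le_lt_trans _ _ (e / 4 + e / 4)); last by lra.
  rewrite opprD addrA; apply: le_trans (ler_normB _ _) _; rewrite lerD //.
  by rewrite ger0_norm.
exists (lim ((fun n => S n / n%:R) @ \oo)) => //.
apply: (lt_le_trans f1); apply: limr_ge => //.
apply: filterS (nbhs_infty_gt 0) => n n0; rewrite ler_pdivlMr ?ltr0n //.
exact: node_sum_f_ge.
Qed.

Lemma cesaro_nat (u : nat -> R) (x : R) : u @ \oo --> x ->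
  (fun n => (\sum_(1 <= i < n) u i) / n%:R) @ \oo --> x.
Proof.
move=> ux; pose v i := if i is 0%N then 0 else u i.
have vx : v @ \oo --> x.
  apply: cvg_trans ux; apply: near_eq_cvg.
  by apply: filterS (nbhs_infty_gt 0) => -[].
rewrite -(cvg_shiftn 1) /=; apply: cvg_trans (cesaro vx); apply: near_eq_cvg.
apply: nearW => n; rewrite /arithmetic_mean /series /= addn1 mulrC.
rewrite big_ltn // add0r; congr (_ * _).
by apply: eq_big_nat => -[].
Qed.

(** The current weights converge to [q k], so do their Cesaro means, and the strong law carries this
    limit over to the choice frequencies. *)
Lemma ergodicity : ergodic_path f eta w.
Proof.
have [hist noise_cvg moment] := w_regular.
have [s s0 Ss] := total_weight_cvg.
pose p k : R := lim (frac k @ \oo); pose q k := f k * p k / s.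
have weight_cvg k : (0 < k)%N -> (fun n => degree_weight f w k n) @ \oo --> q k.
  move=> k0.
  have -> : q k = p k * f k * s^-1 by rewrite /q (mulrC (p k)).
  have h : (fun n => frac k n * f k * (S n / n%:R)^-1) @ \oo --> p k * f k * s^-1.
    apply: cvgM; first by apply: cvgM; [exact: frac_cvg | exact: cvg_cst].
    by apply: cvgV => //; rewrite gt_eqF.
  apply: cvg_trans h; apply: near_eq_cvg; apply: filterS (nbhs_infty_gt 0) => n n0.
  have nR : n%:R != 0 :> R by rewrite pnatr_eq0 -lt0n.
  have SnR : S n != 0 by rewrite gt_eqF // node_sum_gt0.
  rewrite /degree_weight /attach_mean -/(S n).
  have -> : node_sum (fun d => (d == k)%:R * f d) w n =
     f k * node_sum (fun d => (d == k)%:R) w n.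
    rewrite -node_sumZ; apply: eq_node_sum => d _.
    by case: eqP => [->|]; rewrite ?mul0r ?mulr0 ?mulr1 ?mul1r.
  by rewrite /frac; field; rewrite SnR nR.
have freq_cvg k : (0 < k)%N -> choice_freq w k @ \oo --> q k.
  move=> k0; have h := cvgD (noise_cvg k k0) (cesaro_nat (weight_cvg k k0)).
  rewrite add0r in h; suff -> : choice_freq w k =
    (fun n => compensated f (fun d => (d == k)%:R) w n / n%:R) \+
    (fun n => (\sum_(1 <= i < n) degree_weight f w k i) / n%:R) :> (nat -> R) by exact: h.
  apply/funext => n /=; rewrite /choice_freq -mulrDl; congr (_ / _).
  rewrite /compensated -big_split /=.
  by apply: eq_bigr => i _; rewrite subrK.
(* A node exceeds degree [j] exactly when it has been chosen at degree [j], so [q j] is also the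
   limiting fraction of degrees above [j]. For [j = 0] this fraction is 1. *)
pose q' k := if k is 0%N then 1 else q k.
have frac_diff k : (0 < k)%N -> p k = q' k.-1 - q' k.
  move=> k0.
  have above j : (0 < j)%N -> (fun n => node_sum (fun d => (j < d)%N%:R) w n / n%:R) @ \oo --> q j.
    move=> j0; apply: cvg_trans (freq_cvg j j0); apply: near_eq_cvg.
    apply: filterS (nbhs_infty_gt 0) => n n0.
    by rewrite /choice_freq -(Pdeg_gt_chosen n0 (hist n) j0) Pdeg_gtE.
  have above' j : (fun n => node_sum (fun d => (j < d)%N%:R) w n / n%:R) @ \oo --> q' j.
    case: j => [|j]; last exact: above.
    apply: cvg_trans (_ : (fun=> 1) @ \oo --> _); last exact: cvg_cst.
    apply: near_eq_cvg; apply: filterS (nbhs_infty_gt 0) => n n0.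
    have -> : node_sum (fun d => (0 < d)%N%:R) w n = n%:R :> R.
      by rewrite -[RHS]mulr1 -(node_sum_cst _ w n); apply: eq_node_sum => d ->.
    by rewrite divff // pnatr_eq0 -lt0n.
  apply/cvg_lim => //; apply: cvg_trans (cvgB (above' k.-1) (above' k)).
  apply: near_eq_cvg; apply: nearW => n /=.
  transitivity (node_sum (fun d => (k.-1 < d)%N%:R) w n / n%:R -
    node_sum (fun d => (k < d)%N%:R) w n / n%:R : R); first by [].
  rewrite -mulrBl -node_sumB /frac; congr (_ / _); apply: eq_node_sum => d _.
  rewrite prednK //; case: (ltngtP d k) => dk; rewrite ?subrr ?subr0 //.
(* Combining [q k * s = f k * p k] with [p k = q' k.-1 - q' k] gives a first-order recursion with
   positive coefficients. *)
have q_gt0 k : 0 < q' k.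
  elim: k => [|k IHk]; first exact: ltr01.
  have := frac_diff k.+1 isT; rewrite /= => pk.
  have fk := f_gt0 (isT : (0 < k.+1)%N).
  have qE : q k.+1 * (s + f k.+1) = f k.+1 * q' k.
    have : q k.+1 * s = f k.+1 * p k.+1 by rewrite /q divfK // gt_eqF.
    by rewrite pk; lra.
  have : 0 < q k.+1 * (s + f k.+1) by rewrite qE mulr_gt0.
  by rewrite pmulr_lgt0 // addr_gt0.
split => // k k0.
- by rewrite -(subrr (q k)); apply: cvgB; [exact: freq_cvg | exact: weight_cvg].
- have qk : 0 < q k by case: k k0 (q_gt0 k).
  exists (q k / 2); first by rewrite divr_gt0.
  have := weight_cvg k k0; move/cvgr_ge => /(_ (q k / 2)); apply.
  by lra.
Qed.

End ergodic.

(** * Truncated eigenvectors, and the two growth regimes *)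

Section truncated_eigenvector.
Context {R : realType} (f : nat -> R) (f_gt0 : forall k, (0 < k)%N -> 0 < f k).
Context (f_nd : forall k l, (0 < k)%N -> (k <= l)%N -> f k <= f l).
Context (a b : R) (a_ge0 : 0 <= a) (b_ge0 : 0 <= b) (a_lt : a < f 1%N).
Context (f_le : forall k, (0 < k)%N -> f k <= a * k%:R + b).
Context (K : nat) (K_gt0 : (0 < K)%N).

(* The eigenvector equation [phi j (f j + lam) = f j (1 + phi (j + 1))] solved from
   [phi K = f K / lam] downwards: [backward lam m] is [phi (K - m)].  The growth rate
   [lam] is the one for which [phi 1 = 1], found by the intermediate value theorem. *)
Fixpoint backward (s : R) (m : nat) : R :=
  if m is m'.+1 then f (K - m) / (f (K - m) + s) * (1 + backward s m') else f K / s.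

(** The constant [f 1 / s] is a lower solution of the recursion, because [f j >= f 1]. *)
Lemma backward_ge s m : 0 < s -> (m < K)%N -> f 1%N / s <= backward s m.
Proof.
move=> s0; elim: m => [|m IHm] mK /=; first by rewrite ler_pM2r ?invr_gt0 // f_nd.
have j0 : (0 < K - m.+1)%N by rewrite subn_gt0.
have fj := f_nd (isT : (0 < 1)%N) j0; have f1 := f_gt0 (isT : (0 < 1)%N).
have := IHm (ltnW mK); rewrite ler_pdivrMr // => h.
have f0 : 0 < f (K - m.+1) by exact: f_gt0.
rewrite ler_pdivrMr // -[leRHS]mulrA [leRHS]mulrAC ler_pdivlMr ?addr_gt0 //.
have h2 : f 1%N * s <= f (K - m.+1) * s by rewrite ler_pM2r.
have h3 : f (K - m.+1) * f 1%N <= f (K - m.+1) * (backward s m * s) by rewrite ler_pM2l.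
by lra.
Qed.

(** [(a * j + b) / (s - a)] is an upper solution, by [f j <= a * j + b]. Both bounds are independent
    of [K]. *)
Lemma backward_le s m : a < s -> (m < K)%N ->
  backward s m <= (a * (K - m)%:R + b) / (s - a).
Proof.
move=> as_; have s0 : 0 < s by exact: le_lt_trans as_.
have sa : 0 < s - a by rewrite subr_gt0.
elim: m => [|m IHm] mK /=.
  rewrite subn0 ler_pM //; first exact/ltW/f_gt0; last 2 first.
  - exact: f_le.
  - by rewrite lef_pV2 ?posrE // gerBl.
  by rewrite invr_ge0 ltW.
have j0 : (0 < K - m.+1)%N by rewrite subn_gt0.
have := IHm (ltnW mK); rewrite -(subnSK (ltnW mK)) -natr1.
move: (K - m.+1)%N j0 => j j0.
have := f_le j0; have := f_gt0 j0; move: (f j) (j%:R : R) => x y x0 xB hX.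
rewrite ler_pdivlMr // in hX.
rewrite ler_pdivlMr // -[leLHS]mulrA [leLHS]mulrAC ler_pdivrMr ?addr_gt0 //.
have y1 : (1 + backward s m) * (s - a) <= a * y + b + s by lra.
have xs : 0 <= x * s by rewrite mulr_ge0 ?ltW.
have := ler_wpM2l (ltW x0) y1; have := ler_wpM2r (ltW s0) xB; lra.
Qed.

Lemma continuous_backward m (s : R) : (m < K)%N -> 0 < s ->
  {for s, continuous (backward ^~ m)}.
Proof.
move=> + s0; elim: m => [|m IHm] mK /=.
  apply: cvgM; first exact: cvg_cst.
  by apply: cvgV; [rewrite gt_eqF | exact: cvg_id].
have j0 : (0 < K - m.+1)%N by rewrite subn_gt0.
apply: cvgM; last by apply: cvgD; [exact: cvg_cst | exact/IHm/ltnW].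
apply: cvgM; first exact: cvg_cst.
apply: cvgV; first by rewrite gt_eqF // addr_gt0 // f_gt0.
by apply: cvgD; [exact: cvg_cst | exact: cvg_id].
Qed.

Lemma truncated_eigenvector : exists (lam : R) (phi : nat -> R),
  [/\ f 1%N <= lam <= 2 * a + b, phi 1%N = 1,
      forall j, (1 <= j < K.+1)%N -> f 1%N / lam <= phi j <= (a * j%:R + b) / (lam - a) &
      forall j, (1 <= j < K)%N -> phi j * (f j + lam) = f j * (1 + phi j.+1)].
Proof.
have f1 := f_gt0 (isT : (0 < 1)%N).
have fab : f 1%N <= a + b by have := f_le (isT : (0 < 1)%N); rewrite mulr1.
have low_high : f 1%N <= 2 * a + b.
  by apply: le_trans fab _; rewrite lerD2r mulr_natl mulr2n lerDl.
have s0 : 0 < 2 * a + b by exact: lt_le_trans low_high.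
have K1 : (K.-1 < K)%N by rewrite prednK.
(* At [s = f 1] the lower solution is 1, and at [s = 2 * a + b] the upper solution at state 1 is
   1. *)
have [lam] : exists2 s, s \in `[f 1%N, 2 * a + b] & backward s K.-1 = 1.
  apply: IVT => //.
    apply: continuous_in_subspaceT => s; rewrite inE /= in_itv /= => /andP[fs _].
    by apply: continuous_backward => //; exact: lt_le_trans fs.
  have g1 : 1 <= backward (f 1%N) K.-1.
    by apply: le_trans (backward_ge f1 K1); rewrite divff // gt_eqF.
  have g2 : backward (2 * a + b) K.-1 <= 1.
    apply: le_trans (backward_le _ K1) _; first by lra.
    have -> : (K - K.-1 = 1)%N by rewrite -{1}(prednK K_gt0) subSnn.
    by rewrite mulr1 ler_pdivrMr; lra.
  by rewrite ge_min g2 orbT le_max g1.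
rewrite in_itv /= => /andP[lam1 lam2] lamE.
have lam0 : 0 < lam by exact: lt_le_trans lam1.
exists lam, (fun j => backward lam (K - j)); split; rewrite ?lam1 //.
- by rewrite subn1.
- move=> j /andP[j0 jK]; have jm : (K - j < K)%N by rewrite ltn_subrL j0.
  rewrite backward_ge //=; apply: le_trans (backward_le _ jm) _; first exact: lt_le_trans lam1.
  by rewrite subKn.
- move=> j /andP[j0 jK]; rewrite -(subnSK jK) /= subnSK // subKn; last exact: ltnW.
  by field; rewrite gt_eqF // addr_gt0 // f_gt0.
Qed.

End truncated_eigenvector.

Section ae_ergodic.
Context {R : realType} {disp : measure_display} {T : measurableType disp}.
Context (P : probability T R) (f : nat -> R) (f_gt0 : forall k, (0 < k)%N -> 0 < f k).
Context (f_nd : forall k l, (0 < k)%N -> (k <= l)%N -> f k <= f l).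
Context (A : nat -> T -> nat) (A_PA : PA_tree P f A).

Lemma powR_affine_le (C beta a : R) : 0 <= C -> beta < 1 -> 0 < a ->
  exists2 b : R, 0 <= b & forall k, (0 < k)%N -> C * k%:R `^ beta <= a * k%:R + b.
Proof.
move=> C0 b1 a0; have g0 : 0 < 1 - beta by rewrite subr_gt0.
(* The crossover of [C * x ^ beta] and [a * x]: beyond it the linear term suffices, below it
   [k ^ beta <= k < x]. *)
pose x := (C / a) `^ (1 - beta)^-1.
have x0 : 0 <= x by exact: powR_ge0.
have Ca : 0 <= C / a by rewrite divr_ge0 // ltW.
exists (C * x); first exact: mulr_ge0.
move=> k k0; have kR : 0 < k%:R :> R by rewrite ltr0n.
have k1 : 1 <= k%:R :> R by rewrite ler1n.
have [xk|kx] := leP x k%:R.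
  have : C / a <= k%:R `^ (1 - beta).
    have <- : x `^ (1 - beta) = C / a by rewrite /x -powRrM mulVf ?gt_eqF // powRr1.
    by rewrite ge0_ler_powR ?nnegrE // ltW.
  rewrite ler_pdivrMr // => h.
  apply: (@le_trans _ _ (a * k%:R)); last by rewrite lerDl mulr_ge0.
  have kE : k%:R `^ (1 - beta) * k%:R `^ beta = k%:R :> R.
    by rewrite -powRD ?subrK ?powRr1 ?ltW // (gt_eqF kR) implybT.
  by rewrite -[X in a * X]kE mulrA ler_wpM2r ?powR_ge0 // mulrC.
apply: (@le_trans _ _ (C * x)); last by rewrite lerDr mulr_ge0 // ltW.
rewrite ler_wpM2l // (le_trans _ (ltW kx)) // -[leRHS](powRr1 (ltW kR)).
by rewrite ler_powR // ltW.
Qed.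

Lemma ae_ergodic_path (C beta : R) : beta < 1 ->
  (forall k, (0 < k)%N -> f k <= C * k%:R `^ beta) \/
  (exists2 alpha : R, -1 < alpha & forall k, (0 < k)%N -> f k = k%:R + alpha) ->
  exists eta, [/\ 0 < eta, eta <= 1 & {ae P, forall w, ergodic_path f eta (A^~ w)}].
Proof.
move=> b1 growth; have f1 := f_gt0 (isT : (0 < 1)%N).
suff [a [b [s1 [s2 [M [phi_min [[a0 b0 as1] f_le S_ge [M0 phi_min0 f_leM] eig]]]]]]] :
  exists a b s1 s2 M phi_min : R, [/\ [/\ 0 <= a, 0 <= b & a < s1],
    forall k, (0 < k)%N -> f k <= a * k%:R + b,
    forall p n, (0 < n)%N -> is_history p n -> s1 * n%:R - s2 <= node_sum f p n,
    [/\ 0 < M, 0 < phi_min & forall k, (0 < k)%N -> f k <= M * k%:R] &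
    forall K, (1 < K)%N -> exists (lam : R) (phi : nat -> R),
      [/\ s1 <= lam <= M, phi 1%N = 1,
        forall j, (1 <= j < K.+1)%N -> phi_min <= phi j <= M * j%:R &
        forall j, (1 <= j < K)%N -> phi j * (f j + lam) = f j * (1 + phi j.+1)]].
  have [eta [eta0 eta1 gap reg]] := ae_regular_path f_gt0 f_nd A_PA a0 b0 as1 f_le S_ge.
  exists eta; split => //; apply: filterS reg => w wreg.
  apply: (ergodicity f_gt0 f_nd M0 f_leM eta0 eta1 wreg) => k k0.
  exact: (degree_fraction_cvg f_gt0 f_nd a0 b0 f_le eta0 eta1 gap M0 phi_min0 f_leM eig wreg).
case: growth => [f_sub|[alpha alpha1 f_lin]]; last first.
  have al : 0 < 1 + alpha by lra.
  pose M := 2 + `|alpha| + (1 + `|alpha|) / (1 + alpha).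
  have q0 : 0 <= (1 + `|alpha|) / (1 + alpha).
    by rewrite divr_ge0 ?(ltW al) ?(addr_ge0 ler01 (normr_ge0 _)).
  have na := ler_norm alpha; have na0 := normr_ge0 alpha.
  have M0 : 0 < M by rewrite /M; lra.
  exists 1, `|alpha|, (2 + alpha), 1, M, 1; split.
  - by split => //; lra.
  - by move=> k k0; rewrite f_lin // mul1r lerD2l.
  - move=> p n n0 hp; rewrite (@eq_node_sum _ _ (fun k => k%:R + alpha)) //.
    by rewrite node_sumD node_sum_id // node_sum_cst; lra.
  - split => // k k0; rewrite f_lin //.
    have k1 : 1 <= k%:R :> R by rewrite ler1n.
    have := ler_wpM2l na0 k1; have := ler_wpM2r (le_trans ler01 k1) q0.
    by rewrite /M mul0r; move: (_ / _) => q; lra.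
  move=> K K1; exists (2 + alpha), (fun j => (j%:R + alpha) / (1 + alpha)); split.
  - by rewrite lexx /M /=; move: q0; move: (_ / _) => q; lra.
  - by rewrite divff // gt_eqF.
  - move=> j /andP[j0 _]; have j1 : 1 <= j%:R :> R by rewrite ler1n.
    rewrite ler_pdivlMr // mul1r; apply/andP; split; first by lra.
    apply: (@le_trans _ _ ((1 + `|alpha|) / (1 + alpha) * j%:R)).
      rewrite mulrAC ler_pM2r ?invr_gt0 //; have := ler_wpM2l na0 j1; lra.
    by rewrite ler_wpM2r //; move: q0; rewrite /M; move: (_ / _) => q; lra.
  - move=> j /andP[j0 _]; rewrite f_lin // -natr1; field; rewrite gt_eqF //.
have C0 : 0 <= C.
  by have := f_sub 1%N isT; rewrite powR1 mulr1 => /(le_trans (ltW f1)).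
(* The total weight is only known to be at least [f 1 * n], so the slope is taken below [f 1]. *)
pose a := f 1%N / 2; have a0 : 0 < a by rewrite divr_gt0.
have [b b0 hb] := powR_affine_le C0 b1 a0.
have f_le k : (0 < k)%N -> f k <= a * k%:R + b.
  by move=> k0; exact: le_trans (f_sub k k0) (hb k k0).
have fab : f 1%N <= a + b by have := f_le 1%N isT; rewrite mulr1.
have af : a < f 1%N by rewrite /a; lra.
have q0 : 0 <= (a + b) / a by rewrite divr_ge0 ?addr_ge0 // ltW.
pose M := 2 * a + b + (a + b) / a.
have M0 : 0 < M by rewrite /M; lra.
have affine_le k : (0 < k)%N -> a * k%:R + b <= (a + b) * k%:R.
  move=> k0; have k1 : 1 <= k%:R :> R by rewrite ler1n.
  have := ler_wpM2l b0 k1; lra.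
exists a, b, (f 1%N), 0, M, (f 1%N / M); split => //.
- by split => //; exact: ltW.
- by move=> p n _ _; rewrite subr0; exact: node_sum_f_ge.
- split => //; first by rewrite divr_gt0.
  move=> k k0; apply: le_trans (f_le k k0) _; apply: le_trans (affine_le k k0) _.
  by rewrite ler_wpM2r // /M; lra.
move=> K K1; have K0 := ltnW K1.
have [lam [phi [/andP[lam1 lam2] phi1 phib phie]]] :=
  truncated_eigenvector f_gt0 f_nd (ltW a0) af f_le K0.
have lam0 : 0 < lam by exact: lt_le_trans lam1.
have lamM : lam <= M by apply: le_trans lam2 _; rewrite /M; lra.
exists lam, phi; split; rewrite ?lam1 ?lamM //.
move=> j hj; have /andP[lo hi] := phib j hj; apply/andP; split.
  by apply: le_trans lo; rewrite ler_pM2l // lef_pV2 ?posrE.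
apply: le_trans hi _; have j0 : (0 < j)%N by case/andP: hj.
apply: (@le_trans _ _ ((a + b) * j%:R / a)).
  have la : a <= lam - a by move: lam1; rewrite /a; lra.
  have la0 : 0 < lam - a by exact: lt_le_trans la.
  apply: ler_pM; first by rewrite addr_ge0 // mulr_ge0 // ltW.
  - by rewrite invr_ge0 ltW.
  - exact: affine_le.
  - by rewrite lef_pV2.
rewrite mulrAC ler_wpM2r // /M; lra.
Qed.

End ae_ergodic.

(** * Gibbs' inequality with a gap, uniformly over a class of [g] *)

Lemma sum_chosen_low {R : realType} (c : nat -> R) w m n :
  (\sum_(1 <= i < n) if (chosen_deg w i < m)%N then c (chosen_deg w i) else 0) / n%:R =
  \sum_(1 <= k < m) choice_freq w k n * c k.
Proof.
rewrite /choice_freq; under [RHS]eq_bigr do rewrite mulrAC mulr_suml.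
rewrite -mulr_suml exchange_big /=; congr (_ / _); apply: eq_bigr => i _.
set d := chosen_deg w i; case: ltnP => dm.
  rewrite (bigD1_seq d) ?mem_index_iota ?iota_uniq //= eqxx mul1r big1 ?addr0 //.
  by move=> j; rewrite eq_sym => /negbTE ->; rewrite mul0r.
rewrite big_nat_cond big1 // => j /andP[/andP[_ jm] _].
by case: eqP => [dj|_]; rewrite ?mul0r //; move: jm; rewrite -dj ltnNge dm.
Qed.

Section gap.
Context {R : realType}.

Lemma ln_le_sub1 (y : R) : 0 < y -> ln y <= y - 1.
Proof.
move=> y0; have {1}-> : y = 1 + (y - 1) by ring.
by apply: le_ln1Dx; lra.
Qed.

(* [ln y = 2 ln (sqrt y) <= 2 (sqrt y - 1)], so [y - 1 - ln y >= (sqrt y - 1)^2]. *)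
Lemma ln_gap (y g : R) : 0 < y -> 0 < g -> g <= `|y - 1| ->
  ln y <= y - 1 - Num.min 1 (g / 3) ^+ 2.
Proof.
move=> y0 g0 gy; set s := Num.min 1 _.
have s0 : 0 < s by rewrite lt_min ltr01 divr_gt0.
have [s1 sg] : s <= 1 /\ s <= g / 3 by rewrite !ge_min !lexx orbT.
pose t := Num.sqrt y; have t0 : 0 < t by rewrite sqrtr_gt0.
have ty : t ^+ 2 = y by rewrite sqr_sqrtr // ltW.
have lnt : ln y = 2 * ln t.
  by rewrite -ty expr2 lnM ?posrE //; ring.
have := ln_le_sub1 t0; rewrite lnt -ty => h.
have st : s <= `|t - 1|.
  rewrite leNgt; apply/negP => ts.
  have : `|y - 1| = `|t - 1| * (t + 1).
    rewrite -[t + 1]gtr0_norm; last by rewrite addr_gt0.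
    by rewrite -normrM -ty; congr (`|_|); ring.
  move: gy ts; have := ler_norm (t - 1); move: (`|t - 1|) (normr_ge0 (t - 1)) => x x0 hx.
  by move=> hg ts e; rewrite e in hg; nra.
have : s ^+ 2 <= (t - 1) ^+ 2.
  by rewrite -[leRHS]real_normK ?num_real // lerXn2r ?nnegrE ?(ltW s0).
by move: h; move: (ln t) => lt; lra.
Qed.

End gap.

Lemma degree_weightE {R : realType} (g0 : nat -> R) w k n :
  degree_weight g0 w k n =
  g0 k / node_sum g0 w n * node_sum (fun d => (d == k)%:R) w n.
Proof.
rewrite /degree_weight /attach_mean mulrAC -node_sumZ; congr (_ / _).
by apply: eq_node_sum => d _; case: eqP => [->|]; rewrite ?mul0r ?mulr0 ?mulr1 ?mul1r.
Qed.

(* With [b] the ratio of the total weights and [y k = g k / (g0 k * b)], the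
   difference of the criteria is [mean of ln y over the chosen degrees - ln b / n];
   the current weights satisfy [sum_k W k * y k = 1]. *)
Lemma separation {R : realType} (g0 : nat -> R) (C0 eta : R) (w : nat -> nat)
    (mlo Cg gam : R) (k1 : nat) :
  (forall k, (0 < k)%N -> 0 < g0 k) ->
  (forall k l, (0 < k)%N -> (k <= l)%N -> g0 k <= g0 l) ->
  0 < C0 -> (forall k, (0 < k)%N -> g0 k <= C0 * k%:R) ->
  0 < eta -> eta <= 1 -> ergodic_path g0 eta w ->
  0 < mlo -> 0 < Cg -> 0 < gam -> (0 < k1)%N ->
  \forall n \near \oo, forall g : nat -> R,
  (forall k, (0 < k)%N -> mlo <= g k <= Cg * k%:R) ->
  gam <= `|g k1 / g0 k1 - g 1%N / g0 1%N| ->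
  pseudo_loglik g w n < pseudo_loglik g0 w n.
Proof.
move=> g0_gt0 g0_nd C0_gt0 g0_le eta_gt0 eta_le1 w_erg.
pose S0 n := node_sum g0 w n; pose Q k n : R := choice_freq w k n.
pose W k n : R := degree_weight g0 w k n.
have hist n : is_history w n by case: w_erg => -[].
move=> mlo0 Cg0 gam0 k1_gt0; have [w_reg QW Wlow] := w_erg.
have m00 := g0_gt0 1%N isT; set m0 := g0 1%N in m00.
(* [blo] and [bhi] bound the ratio [b] of the total weights for all admissible [g], since both
   totals are of order [n]. *)
have [blo bloE] : exists x : R, x = mlo / (2 * C0) by eexists.
have [bhi bhiE] : exists x : R, x = 2 * Cg / m0 by eexists.
have blo0 : 0 < blo by rewrite bloE divr_gt0 // mulr_gt0.
have bhi0 : 0 < bhi by rewrite bhiE divr_gt0 // mulr_gt0.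
have [A AE] : exists x : R, x = Cg / (m0 * blo) by eexists.
have A0 : 0 < A by rewrite AE divr_gt0 // mulr_gt0.
have [c1 c10 Wc1] := Wlow 1%N isT; have [c2 c20 Wc2] := Wlow k1 k1_gt0.
(* The loss in [ln_gap] at a degree where [y] is at least [gam / (2 * bhi)] away from 1. Weighted by
   the limiting chance of that degree it gives [gap], of which four errors will each use a fifth. *)
pose psi := Num.min 1 (gam / (2 * bhi) / 3) ^+ 2.
have [gap gapE] : exists x : R, x = Num.min c1 c2 * psi by eexists.
have psi0 : 0 < psi.
  by rewrite /psi exprn_gt0 // lt_min ltr01 !divr_gt0 // mulr_gt0.
have gap0 : 0 < gap by rewrite gapE mulr_gt0 // lt_min c10.
have [_ _ [CW hCW]] := w_reg.
have [CW1 CW1E] : exists x : R, x = `|CW| + 1 by eexists.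
have CW10 : 0 < CW1 by rewrite CW1E ltr_wpDl.
have [lA lAE] : exists x : R, x = `|ln A| + 1 by eexists.
have lA0 : 0 < lA by rewrite lAE ltr_wpDl.
have [K1 hK1] := weight_dominates_ln eta_gt0 eta_le1
  (divr_gt0 gap0 (mulr_gt0 (mulr_gt0 (ltr0n R 5) lA0) CW10)).
have [K2 hK2] := tail_sum_small eta_gt0 eta_le1 w_reg
  (divr_gt0 (mulr_gt0 gap0 m00) (mulr_gt0 (ltr0n R 5) C0_gt0)).
(* Beyond [m] the logarithms are a small multiple of [weight eta] and the weights [W] sum to at most
   [gap / 5]; below [m] finitely many frequencies are compared. *)
pose m := (maxn k1 (maxn K1 K2)).+1.
have m_gt0 : 0 < m%:R :> R by rewrite ltr0n.
have [B BE] : exists x : R, x = `|ln (mlo / (C0 * m%:R * bhi))| + `|ln (A * m%:R)| + 1 by eexists.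
have B0 : 0 < B by rewrite BE ltr_wpDl // addr_ge0.
have QWsmall : \forall n \near \oo, \sum_(1 <= k < m) `|Q k n - W k n| <= gap / (5 * B).
  by apply: near_sum_norm_le => //; rewrite divr_gt0 // mulr_gt0.
have nlarge : \forall n \near \oo, `|ln blo| * 5 / gap <= n%:R by exact: nbhs_infty_ger.
have [N1 _ hN1] := QWsmall; have [N2 _ hN2] := nlarge.
have [N3 _ hN3] := Wc1; have [N4 _ hN4] := Wc2.
exists (maxn (maxn N1 N2) (maxn N3 N4)).+1 => // n /= hn g gb gsep.
have nN1 : (N1 <= n)%N by apply: leq_trans (ltnW hn); rewrite !leq_max leqnn ?orbT.
have nN2 : (N2 <= n)%N by apply: leq_trans (ltnW hn); rewrite !leq_max leqnn ?orbT.
have nN3 : (N3 <= n)%N by apply: leq_trans (ltnW hn); rewrite !leq_max leqnn ?orbT.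
have nN4 : (N4 <= n)%N by apply: leq_trans (ltnW hn); rewrite !leq_max leqnn ?orbT.
have n0 : (0 < n)%N by exact: leq_trans hn.
have {}hN1 := hN1 n nN1; have {}hN2 := hN2 n nN2.
have {}hN3 := hN3 n nN3; have {}hN4 := hN4 n nN4.
have nR : 0 < n%:R :> R by rewrite ltr0n.
have g_gt0 k : (0 < k)%N -> 0 < g k by move=> /gb /andP[+ _]; exact: lt_le_trans.
pose Sg := node_sum g w n; pose S := S0 n.
have Slo : m0 * n%:R <= S by exact: (node_sum_f_ge g0_nd).
have linear_le (h : nat -> R) c : (forall k, (0 < k)%N -> h k <= c * k%:R) -> 0 <= c ->
    node_sum h w n <= 2 * c * n%:R.
  move=> hh c0; apply: (@le_trans _ _ (node_sum (fun d => c * d%:R) w n)).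
    exact: ler_node_sum.
  rewrite node_sumZ (node_sum_id n0 (hist n)); clear -c0; lra.
have Shi : S <= 2 * C0 * n%:R by apply: linear_le => //; exact: ltW.
have Sghi : Sg <= 2 * Cg * n%:R.
  by apply: linear_le; [move=> k /gb /andP[]|exact: ltW].
have Sglo : mlo * n%:R <= Sg.
  rewrite mulrC -(node_sum_cst mlo w n); apply: ler_node_sum => k /gb.
  by case/andP.
have S_gt0 : 0 < S by apply: lt_le_trans Slo; rewrite mulr_gt0.
have Sg_gt0 : 0 < Sg by apply: lt_le_trans Sglo; rewrite mulr_gt0.
have [b bE] : exists x : R, x = Sg / S by eexists.
have b0 : 0 < b by rewrite bE divr_gt0.
have b_lo : blo <= b.
  rewrite bE ler_pdivlMr // bloE mulrAC ler_pdivrMr ?mulr_gt0 //.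
  apply: le_trans (ler_wpM2l (ltW mlo0) Shi) _.
  have := ler_wpM2r (ltW (mulr_gt0 (ltr0n R 2) C0_gt0)) Sglo; clear; lra.
have b_hi : b <= bhi.
  rewrite bE ler_pdivrMr // bhiE mulrAC ler_pdivlMr //.
  apply: le_trans (ler_wpM2r (ltW m00) Sghi) _.
  have := ler_wpM2l (ltW (mulr_gt0 (ltr0n R 2) Cg0)) Slo; clear; lra.
pose y k := g k / g0 k / b.
have y0 k : (0 < k)%N -> 0 < y k by move=> k0; rewrite /y !divr_gt0 // ?g_gt0 ?g0_gt0.
have y_hi k : (0 < k)%N -> y k <= A * k%:R.
  move=> k0; have /andP[_ gk] := gb k k0; have g0k := g0_gt0 k k0.
  have mk := g0_nd 1%N k isT k0.
  rewrite /y -mulrA -invfM AE mulrAC; apply: ler_pM => //; first exact/ltW/g_gt0.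
    by rewrite invr_ge0 ltW // mulr_gt0.
  by rewrite lef_pV2 ?posrE ?mulr_gt0 //; apply: ler_pM => //; exact: ltW.
have y_lo k : (0 < k)%N -> (k < m)%N -> mlo / (C0 * m%:R * bhi) <= y k.
  move=> k0 km; have /andP[gk _] := gb k k0; have g0k := g0_gt0 k k0.
  rewrite /y -[leRHS]mulrA -invfM; apply: ler_pM => //; first exact: ltW.
    by rewrite invr_ge0 ltW // !mulr_gt0.
  rewrite lef_pV2 ?posrE ?mulr_gt0 //; apply: ler_pM => //; try exact: ltW.
  apply: le_trans (g0_le k k0) _; rewrite ler_pM2l // ler_nat; exact: ltnW.
have gy k : (0 < k)%N -> g k = y k * g0 k * b.
  by move=> k0; rewrite /y; field; rewrite !gt_eqF ?g0_gt0.
have W0 k : (0 < k)%N -> 0 <= W k n.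
  move=> k0; rewrite /W degree_weightE mulr_ge0 ?node_sum_ge0 //.
  by rewrite divr_ge0 ?(ltW S_gt0) // ltW // g0_gt0.
have Wy : \sum_(1 <= k < m) W k n * y k <= 1.
  have -> : \sum_(1 <= k < m) W k n * y k =
      \sum_(1 <= k < m) Sg^-1 * g k * node_sum (fun d => (d == k)%:R) w n.
    apply: eq_big_nat => k /andP[k0 _]; rewrite /W degree_weightE -/(S0 n) gy // bE -/S.
    by field; rewrite !gt_eqF.
  rewrite (sum_node_sum_indicator (fun k => Sg^-1 * g k)).
  rewrite -[leRHS](mulVf (lt0r_neq0 Sg_gt0)) -node_sumZ; apply: ler_node_sum => d d0.
  case: ifP => // _; rewrite mulr_ge0 ?invr_ge0 ?(ltW Sg_gt0) //.
  exact/ltW/g_gt0.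
have Wsum : 1 - gap / 5 <= \sum_(1 <= k < m) W k n.
  have -> : \sum_(1 <= k < m) W k n =
      \sum_(1 <= k < m) S^-1 * g0 k * node_sum (fun d => (d == k)%:R) w n.
    by apply: eq_bigr => k _; rewrite /W degree_weightE -/S (mulrC S^-1).
  rewrite (sum_node_sum_indicator (fun k => S^-1 * g0 k)).
  have tl : tail_sum w m n <= gap * m0 / (5 * C0) * n%:R.
    by apply: hK2 => //; rewrite /m leqW // !leq_max leqnn !orbT.
  have sg : S^-1 * C0 * tail_sum w m n <= gap / 5.
    rewrite -mulrA mulrC ler_pdivrMr //.
    have h := ler_wpM2l (ltW C0_gt0) tl.
    have e1 : C0 * (gap * m0 / (5 * C0) * n%:R) = gap / 5 * (m0 * n%:R).
      by field; rewrite gt_eqF.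
    apply: le_trans h _; rewrite e1 ler_pM2l ?divr_gt0 //.
  apply: (@le_trans _ _ (1 - S^-1 * C0 * tail_sum w m n)); first by rewrite lerB.
  rewrite -[X in X - _](mulVf (lt0r_neq0 S_gt0)) /tail_sum -!node_sumZ -node_sumB.
  apply: ler_node_sum => d d0; case: leqP => dm; last by rewrite mul0r mulr0 subr0.
  by rewrite mul1r subr_le0 -mulrA ler_wpM2l ?invr_ge0 ?(ltW S_gt0) // g0_le.
have m1 : (1 < m)%N by rewrite /m ltnS leq_max k1_gt0.
have k1m : (k1 < m)%N by rewrite /m ltnS leq_maxl.
(* [y 1] and [y k1] differ by at least [gam / bhi], so one of them is far from 1. *)
have [kk [/andP[kk0 kkm] ykk Wkk]] : exists kk, [/\ (1 <= kk < m)%N,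
    gam / (2 * bhi) <= `|y kk - 1| & Num.min c1 c2 <= W kk n].
  case: (leP (gam / (2 * bhi)) `|y 1%N - 1|) => [h|h1].
    by exists 1%N; split => //; rewrite ge_min hN3.
  exists k1; split; first by rewrite k1_gt0.
    have yd : gam / bhi <= `|y k1 - y 1%N|.
      rewrite /y -mulrBl normrM [`|b^-1|]gtr0_norm ?invr_gt0 //.
      apply: ler_pM => //; [exact: ltW | by rewrite invr_ge0 ltW | by rewrite lef_pV2 ?posrE].
    have := ler_distD 1 (y k1) (y 1%N); rewrite (distrC 1 (y 1%N)).
    have e2 : gam / (2 * bhi) = gam / bhi / 2 by field; rewrite gt_eqF.
    by move: h1 yd; rewrite e2; move: (gam / bhi) => x; clear; lra.
  by rewrite ge_min hN4 orbT.
have Wln : \sum_(1 <= k < m) W k n * ln (y k) <= gap / 5 - gap.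
  apply: (@le_trans _ _ (\sum_(1 <= k < m) (W k n * y k - W k n) - gap)); last first.
    by rewrite sumrB; move: Wy Wsum; clear; lra.
  rewrite !(bigD1_seq kk) ?mem_index_iota ?iota_uniq ?kk0 //= addrAC lerD //.
    have h1 : ln (y kk) <= y kk - 1 - psi.
      by apply: ln_gap => //; [exact: y0 | rewrite divr_gt0 // mulr_gt0].
    have h2 := ler_wpM2l (W0 kk kk0) h1; have h3 := ler_wpM2r (ltW psi0) Wkk.
    by move: h2 h3; rewrite gapE; clear; lra.
  rewrite big_seq_cond [leRHS]big_seq_cond; apply: ler_sum => k.
  rewrite mem_index_iota => /andP[/andP[k0 _] _].
  by have := ler_wpM2l (W0 k k0) (ln_le_sub1 (y0 k k0)); clear; lra.
have Qln : \sum_(1 <= k < m) Q k n * ln (y k) <= gap / 5 + (gap / 5 - gap).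
  apply: (@le_trans _ _ (\sum_(1 <= k < m) `|Q k n - W k n| * B +
      \sum_(1 <= k < m) W k n * ln (y k))).
    rewrite -big_split /=; apply: ler_sum_nat => k /andP[k0 km].
    have lb : `|ln (y k)| <= B.
      have l1 : ln (mlo / (C0 * m%:R * bhi)) <= ln (y k).
        by rewrite ler_ln ?posrE ?y0 ?y_lo // divr_gt0 // !mulr_gt0.
      have l2 : ln (y k) <= ln (A * m%:R).
        rewrite ler_ln ?posrE ?y0 ?mulr_gt0 //; apply: le_trans (y_hi k k0) _.
        by rewrite ler_pM2l // ler_nat ltnW.
      rewrite BE ler_norml.
      have n1 := ler_norm (- ln (mlo / (C0 * m%:R * bhi))); have n2 := ler_norm (ln (A * m%:R)).
      have n3 := normr_ge0 (ln (mlo / (C0 * m%:R * bhi))); have n4 := normr_ge0 (ln (A * m%:R)).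
      rewrite normrN in n1; clear -l1 l2 n1 n2 n3 n4; apply/andP; split; lra.
    have h := ler_wpM2l (normr_ge0 (Q k n - W k n)) lb.
    have h' := ler_norm ((Q k n - W k n) * ln (y k)); rewrite normrM in h'.
    clear -h h'; lra.
  rewrite lerD // -mulr_suml; apply: le_trans (ler_wpM2r (ltW B0) hN1) _.
  by rewrite le_eqVlt; apply/orP; left; apply/eqP; field; rewrite gt_eqF.
have tail_ln : (\sum_(1 <= i < n)
    (if (chosen_deg w i < m)%N then 0 else ln (y (chosen_deg w i)))) / n%:R <= gap / 5.
  rewrite ler_pdivrMr //.
  apply: (@le_trans _ _ (\sum_(1 <= i < n) gap / (5 * CW1) * weight eta (chosen_deg w i))).
    apply: ler_sum => i _; set d := chosen_deg w i; have d0 : (0 < d)%N by [].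
    have w0 : 0 <= weight eta d by exact: le_trans ler01 (weight_ge1 d (ltW eta_gt0)).
    have gc : 0 < gap / (5 * CW1) by rewrite divr_gt0 // mulr_gt0.
    case: ltnP => md; first by rewrite mulr_ge0 // ltW.
    have dR : 0 < d%:R :> R by rewrite ltr0n.
    have ld : 0 <= ln d%:R :> R by rewrite ln_ge0 // ler1n.
    have lh : ln (y d) <= lA * (1 + ln d%:R).
      apply: (@le_trans _ _ (ln (A * d%:R))).
        by rewrite ler_ln ?posrE ?y0 ?mulr_gt0 // y_hi.
      rewrite lnM ?posrE // lAE.
      have := ler_norm (ln A); have := mulr_ge0 (normr_ge0 (ln A)) ld.
      by move: (`|ln A|) (ln A) (ln d%:R) ld => x x' z z0; clear -z0; lra.
    have K1d : (K1 <= d)%N by apply: leq_trans (ltnW md); rewrite !leq_max leqnn ?orbT.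
    have := ler_wpM2l (ltW lA0) (hK1 d K1d).
    have -> : lA * (gap / (5 * lA * CW1) * weight eta d) = gap / (5 * CW1) * weight eta d.
      by field; rewrite !gt_eqF.
    exact: le_trans.
  rewrite -mulr_sumr -(node_sum_telescope n0 (hist n) (cum_weight1 eta) (@cum_weightS _ eta)).
  have hC : node_sum (cum_weight eta) w n <= CW1 * n%:R.
    apply: le_trans (hCW n n0) _; rewrite ler_pM2r // CW1E.
    by apply: le_trans (ler_norm _) _; rewrite lerDl.
  have gc : 0 < gap / (5 * CW1) by rewrite divr_gt0 // mulr_gt0.
  apply: le_trans (ler_wpM2l (ltW gc) hC) _.
  by rewrite le_eqVlt; apply/orP; left; apply/eqP; field; rewrite gt_eqF.
have lnb : - ln b / n%:R <= gap / 5.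
  rewrite ler_pdivrMr //.
  have l1 : ln blo <= ln b by rewrite ler_ln ?posrE.
  have l2 := ler_norm (- ln blo); rewrite normrN in l2.
  by move: hN2; rewrite ler_pdivrMr //; clear -l1 l2; lra.
rewrite !(pseudo_loglikE _ n0 (hist n)) -/Sg -/(S0 n) -/S -subr_lt0.
have lnSg : ln Sg = ln b + ln S.
  by rewrite -lnM ?posrE // bE divfK // gt_eqF.
(* There are [n - 1] choices but division by [n], so [ln b] does not cancel entirely: [- ln b / n]
   remains. *)
have sumE : \sum_(1 <= i < n) ln (g (chosen_deg w i)) =
    \sum_(1 <= i < n) (if (chosen_deg w i < m)%N then ln (y (chosen_deg w i)) else 0) +
    \sum_(1 <= i < n) (if (chosen_deg w i < m)%N then 0 else ln (y (chosen_deg w i))) +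
    (\sum_(1 <= i < n) ln (g0 (chosen_deg w i)) + (n%:R - 1) * ln b).
  have -> : (n%:R - 1) * ln b = \sum_(1 <= i < n) ln b.
    by rewrite sumr_const_nat -[RHS]mulr_natl natrB.
  rewrite -!big_split /=; apply: eq_bigr => i _; set d := chosen_deg w i.
  have d0 : (0 < d)%N by [].
  rewrite gy //; move: (y d) (g0 d) (y0 d d0) (g0_gt0 d d0) => x x' x0 x'0.
  have xx : 0 < x * x' by exact: mulr_gt0.
  rewrite lnM ?posrE // lnM ?posrE //.
  by case: ifP => _; ring.
have low := sum_chosen_low (fun d => ln (y d)) w m n; rewrite sumE lnSg.
move: tail_ln Qln lnb; rewrite -low.
move: (\sum_(1 <= i < n) (if _ then _ else 0)) => X.
move: (\sum_(1 <= i < n) (if _ then 0 else _)) => Y.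
move: (\sum_(1 <= i < n) ln (g0 _)) => Z hY hX hb.
have -> : n%:R^-1 * (X + Y + (Z + (n%:R - 1) * ln b)) - (ln b + ln S) - (n%:R^-1 * Z - ln S) =
   X / n%:R + Y / n%:R + - ln b / n%:R by field; rewrite gt_eqF.
by clear -hX hY hb gap0; lra.
Qed.

(** * Continuity and derivatives of finite sums and logarithms *)

Section calculus.
Context {R : realType}.

Lemma continuous_sum {T : topologicalType} {I : Type} (s : seq I) (F : I -> T -> R) (x : T) :
  (forall i, {for x, continuous (F i)}) ->
  {for x, continuous (fun t => \sum_(i <- s) F i t)}.
Proof.
move=> hF; elim: s => [|i s IHs].
  rewrite (_ : (fun _ => _) = cst 0); first exact: cst_continuous.
  by apply/funext => t; rewrite big_nil.
rewrite (_ : (fun _ => _) = F i \+ (fun t => \sum_(j <- s) F j t)).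
  exact: continuousD.
by apply/funext => t; rewrite big_cons.
Qed.

Lemma is_derive_sum_seq {I : Type} (s : seq I) (h : I -> R -> R) (dh : I -> R) (t : R) :
  (forall i, is_derive t 1 (h i) (dh i)) ->
  is_derive t 1 (fun u => \sum_(i <- s) h i u) (\sum_(i <- s) dh i).
Proof.
move=> hh; elim: s => [|i s IHs].
  rewrite big_nil (_ : (fun _ => _) = cst 0); first exact: is_derive_cst.
  by apply/funext => u; rewrite big_nil.
rewrite big_cons (_ : (fun _ => _) = h i \+ (fun u => \sum_(j <- s) h j u)).
  exact: is_deriveD.
by apply/funext => u; rewrite big_cons.
Qed.

Lemma is_derive_line {d : nat} (g : 'rV[R]_d -> R) (x v : 'rV[R]_d) (t : R) :
  derivable g (x + t *: v) v ->
  is_derive t 1 (fun s => g (x + s *: v)) ('D_v g (x + t *: v)).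
Proof.
have E : (fun h : R => h^-1 *: (((fun s => g (x + s *: v)) \o shift t) (h *: 1) -
                               g (x + t *: v))) =
         (fun h : R => h^-1 *: ((g \o shift (x + t *: v)) (h *: v) - g (x + t *: v))).
  apply/funext => h /=; congr (_ *: (g _ - _)).
  by rewrite [h *: 1]mulr1 scalerDl addrCA.
by move=> gd; split; [rewrite /derivable E | rewrite /derive E].
Qed.

Lemma is_derive_ln (g : R -> R) (t dg : R) : 0 < g t -> is_derive t 1 g dg ->
  is_derive t 1 (fun s => ln (g s)) ((g t)^-1 * dg).
Proof.
move=> g0 gd; exact: (@is_derive1_comp R (@ln R) g t (g t)^-1 dg (is_derive1_ln g0) gd).
Qed.

End calculus.

(** * Localization of maximizers and of score zeros *)

Section maximizer.
Context {R : realType} {d : nat} (Theta : set 'rV[R]_d) (f : 'rV[R]_d -> nat -> R).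
Context (f_gt0 : forall theta k, Theta theta -> (1 <= k)%N -> 0 < f theta k).
Context (f_nd : forall theta k l, Theta theta -> (1 <= k)%N ->
  (k <= l)%N -> f theta k <= f theta l).
Context (Theta_compact : compact Theta).
Context (f_diff : forall k theta, (1 <= k)%N -> Theta theta ->
  differentiable (f^~ k) theta).
Context (C beta : R) (beta_lt1 : beta < 1).
Context (f_growth : forall theta, Theta theta ->
  (forall k, (1 <= k)%N -> f theta k <= C * k%:R `^ beta) \/
  (exists2 alpha : R, -1 < alpha & forall k, (1 <= k)%N -> f theta k = k%:R + alpha)).
Context (theta0 : 'rV[R]_d) (theta0_in : Theta theta0).
Context (identifiable : forall theta, Theta theta ->
  ((exists c : R, forall k, (1 <= k)%N -> f theta k = c * f theta0 k) <-> theta = theta0)).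
Context (eta : R) (eta_gt0 : 0 < eta) (eta_le1 : eta <= 1).
Context (w : nat -> nat) (w_erg : ergodic_path (f theta0) eta w).

(** [alpha] may vary with [theta], but it is [f theta 1 - 1]. The bound thus depends on [theta] only
    through [f theta 1], which is continuous, so it is locally uniform. *)
Lemma growth_linear theta k : Theta theta -> (1 <= k)%N ->
  f theta k <= (`|C| + 1 + f theta 1%N) * k%:R.
Proof.
move=> th k0; have k1 : 1 <= k%:R :> R by rewrite ler1n.
have f1 := f_gt0 th (leqnn 1); have k00 : 0 <= k%:R :> R by [].
case: (f_growth th) => [fk|[alpha _ fk]].
  apply: le_trans (fk k k0) _; apply: (@le_trans _ _ (`|C| * k%:R)).
    apply: (@le_trans _ _ (`|C| * k%:R `^ beta)).
      by rewrite ler_wpM2r ?powR_ge0 // ler_norm.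
    by rewrite ler_wpM2l // -[leRHS]powRr1 // ler_powR // ltW.
  by rewrite ler_wpM2r // -addrA lerDl addr_ge0 // ltW.
have f1E := fk 1%N isT; rewrite (fk k k0).
have -> : k%:R + alpha = (k%:R - 1) + f theta 1%N by rewrite f1E; ring.
have := mulr_ge0 (normr_ge0 C) k00; have := ler_wpM2l (ltW f1) k1; lra.
Qed.

Lemma f_cvg k theta : (1 <= k)%N -> Theta theta -> (f^~ k) x @[x --> theta] --> f theta k.
Proof. by move=> k0 th; exact/differentiable_continuous/f_diff. Qed.

Lemma not_proportional theta : Theta theta -> theta <> theta0 ->
  exists2 k, (1 <= k)%N & f theta k / f theta0 k - f theta 1%N / f theta0 1%N != 0.
Proof.
move=> th ne; apply: contrapT => hk; apply: ne; apply/(identifiable th).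
exists (f theta 1%N / f theta0 1%N) => k k0; apply/eqP.
rewrite -subr_eq0; apply/negPn/negP => h; apply: hk; exists k => //.
apply: contra_neq h => h; have fk := f_gt0 theta0_in k0.
apply: (mulIf (invr_neq0 (lt0r_neq0 fk))).
by rewrite mul0r mulrBl mulfK ?gt_eqF.
Qed.

(** Continuity at the degrees 1 and [k] is enough: monotonicity and [growth_linear] turn control of
    [f t 1] into the bounds at all degrees required by [separation], whose uniformity in [g] covers
    the neighbourhood at once. *)
Lemma loglik_separated theta : Theta theta -> theta <> theta0 ->
  exists2 V, nbhs theta V & \forall n \near \oo, forall t, Theta t -> V t ->
    pseudo_loglik (f t) w n < pseudo_loglik (f theta0) w n.
Proof.
move=> th ne; have [k k0 dne] := not_proportional th ne.
set dl := _ - _ in dne; have d0 : 0 < `|dl| by rewrite normr_gt0.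
have f1 := f_gt0 th (leqnn 1).
pose V t := f theta 1%N / 2 <= f t 1%N /\ (f t 1%N <= 2 * f theta 1%N /\
  `|dl| / 2 <= `|f t k / f theta0 k - f t 1%N / f theta0 1%N|).
have f1c := f_cvg (leqnn 1) th.
have dc : (fun t => `|f t k / f theta0 k - f t 1%N / f theta0 1%N|) x @[x --> theta] --> `|dl|.
  have q j : (1 <= j)%N -> {for theta, continuous (fun t => f t j / f theta0 j)}.
    by move=> j0; apply: continuousM; [exact: f_cvg | exact: cst_continuous].
  have qq := continuousB (q k k0) (q 1%N (leqnn 1)).
  exact: (cvg_norm qq).
exists V.
  have n1 : \forall x \near theta, f theta 1%N / 2 <= f x 1%N.
    by move/cvgr_ge: f1c; apply; lra.
  have n2 : \forall x \near theta, f x 1%N <= 2 * f theta 1%N.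
    by move/cvgr_le: f1c; apply; lra.
  have n3 : \forall x \near theta,
      `|dl| / 2 <= `|f x k / f theta0 k - f x 1%N / f theta0 1%N|.
    by move/cvgr_ge: dc; apply; lra.
  by apply: filterS3 n1 n2 n3 => x h1 h2 h3; split.
have C0 : 0 < `|C| + 1 + f theta0 1%N by rewrite addr_gt0 ?f_gt0 // ltr_wpDl.
have Cg0 : 0 < `|C| + 1 + 2 * f theta 1%N by rewrite addr_gt0 ?mulr_gt0 // ltr_wpDl.
have m0 : 0 < f theta 1%N / 2 by rewrite divr_gt0.
have gam0 : 0 < `|dl| / 2 by rewrite divr_gt0.
have := separation (fun k => @f_gt0 theta0 k theta0_in)
  (fun k l => @f_nd theta0 k l theta0_in) C0 (fun k => @growth_linear theta0 k theta0_in)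
  eta_gt0 eta_le1 w_erg m0 Cg0 gam0 k0.
apply: filterS => n sep t tth [V1 [V2 V3]]; apply: sep => // j j0.
rewrite (le_trans V1 (f_nd tth (leqnn 1) j0)) /=.
by apply: le_trans (growth_linear tth j0) _; rewrite ler_wpM2r // lerD2l.
Qed.

Lemma maximizer_cvg (t : nat -> 'rV[R]_d) :
  (\forall n \near \oo, is_maximizer f Theta w n (t n)) -> t @ \oo --> theta0.
Proof.
move=> tmax; apply: contrapT => ncvg.
have [U nU FU] : exists2 U, nbhs theta0 U & ~ (t @ \oo) U.
  apply: contrapT => h; apply: ncvg => U nU; apply: contrapT => FU; apply: h.
  by exists U.
(* The filter generated by the times at which the sequence lies outside [U]. A cluster point cannot
   be [theta0], since the complement of [U] belongs to [F], nor any other point, by separation. *)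
pose F : set_system 'rV[R]_d := fun S => (t @ \oo) (S `|` U).
have FF : ProperFilter F.
  split; first by rewrite /F set0U.
  split.
  - by rewrite /F setTU; exact: filterT.
  - move=> A B FA FB; rewrite /F setUIl; exact: filterI.
  - by move=> A B AB; rewrite /F; apply: filterS => x [/AB|]; [left|right].
have FT : F Theta by apply: filterS tmax => n [tn _]; left.
have [p [pT pcl]] := Theta_compact FF FT.
have FcU : F (~` U) by rewrite /F setvU; exact: filterT.
have [pU|pne] := pselect (p = theta0).
  by rewrite pU in pcl; have [x [nx]] := pcl _ _ FcU nU; apply: nx.
have [V nV sep] := loglik_separated pT pne.
have FcV : F (~` V).
  apply: filterS2 tmax sep => n [tn tmaxn] sepn; left => Vt.
  by have := lt_le_trans (sepn _ tn Vt) (tmaxn _ theta0_in); rewrite ltxx.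
by have [x [nx]] := pcl _ _ FcV nV; apply: nx.
Qed.

Let hist n : is_history w n.
Proof. by case: w_erg => -[]. Qed.

Lemma continuous_loglik n theta : (0 < n)%N -> Theta theta ->
  {for theta, continuous (fun t => pseudo_loglik (f t) w n)}.
Proof.
move=> n0 th.
have -> : (fun t => pseudo_loglik (f t) w n) = (fun t => n%:R^-1 *
    \sum_(1 <= i < n) ln (f t (chosen_deg w i)) - ln (node_sum (f t) w n)).
  by apply/funext => t; rewrite (pseudo_loglikE _ n0 (@hist n)).
apply: continuousB.
  apply: continuousM; first exact: cst_continuous.
  apply: continuous_sum => i.
  apply: (@continuous_comp _ _ _ (f^~ (chosen_deg w i)) (@ln R)); first exact: f_cvg.
  by apply: continuous_ln; exact: f_gt0.
apply: (@continuous_comp _ _ _ (fun t => node_sum (f t) w n) (@ln R)).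
  by apply: continuous_sum => i; exact: f_cvg.
by apply: continuous_ln; apply: node_sum_gt0 => // k; exact: f_gt0.
Qed.

Lemma maximizer_exists n : (0 < n)%N -> exists t, is_maximizer f Theta w n t.
Proof.
move=> n0; have T0 : Theta !=set0 by exists theta0.
have [|c cT cmax] := @compact_EVT_max _ R (fun t => pseudo_loglik (f t) w n) _ T0 Theta_compact.
  apply: continuous_in_subspaceT => t; rewrite inE => tT.
  exact: continuous_loglik.
exists c; split; first by move: cT; rewrite inE.
by move=> t tT; apply: cmax; rewrite inE.
Qed.

Lemma pseudo_scoreE n theta : (0 < n)%N -> pseudo_score f w n theta =
  n%:R^-1 *: \sum_(1 <= i < n) ((f theta (chosen_deg w i))^-1 *: grad f theta (chosen_deg w i))
  - (node_sum (f theta) w n)^-1 *: node_sum (grad f theta) w n.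
Proof.
move=> n0; rewrite /pseudo_score !Sdeg_node_sum //.
by rewrite (Pdeg_gt_series (fun k => (f theta k)^-1 *: grad f theta k) n0 (@hist n)).
Qed.

Lemma loglik_is_derive n theta i t : (0 < n)%N -> Theta (theta + t *: 'e_i) ->
  is_derive t 1 (fun s => pseudo_loglik (f (theta + s *: 'e_i)) w n)
    (pseudo_score f w n (theta + t *: 'e_i) 0 i).
Proof.
move=> n0 th; set x := theta + t *: 'e_i in th *.
have -> : (fun s => pseudo_loglik (f (theta + s *: 'e_i)) w n) = (fun s => n%:R^-1 *
    \sum_(1 <= j < n) ln (f (theta + s *: 'e_i) (chosen_deg w j)) -
    ln (node_sum (f (theta + s *: 'e_i)) w n)).
  by apply/funext => s; rewrite (pseudo_loglikE _ n0 (@hist n)).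
have fd k : (0 < k)%N -> is_derive t 1 (fun s => f (theta + s *: 'e_i) k) (grad f x k 0 i).
  move=> k0; rewrite mxE; apply: (@is_derive_line R d (f^~ k)).
  by apply: diff_derivable; exact: f_diff.
have -> : pseudo_score f w n x 0 i =
    n%:R^-1 * (\sum_(1 <= j < n) (f x (chosen_deg w j))^-1 * grad f x (chosen_deg w j) 0 i)
    - (node_sum (f x) w n)^-1 * node_sum (fun k => grad f x k 0 i) w n.
  rewrite pseudo_scoreE // /node_sum !mxE !summxE; congr (_ * _ - _).
  by apply: eq_bigr => j _; rewrite mxE.
apply: is_deriveB.
  apply: is_deriveZ; apply: is_derive_sum_seq => j.
  by apply: is_derive_ln; [exact: f_gt0 | exact: fd].
apply: is_derive_ln; first by apply: node_sum_gt0 => // k; exact: f_gt0.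
by apply: is_derive_sum_seq => j; exact: fd.
Qed.

(** Fermat's rule on each coordinate line through [theta], a segment of which stays in [Theta]. *)
Lemma interior_maximizer_score n theta : (0 < n)%N -> is_maximizer f Theta w n theta ->
  interior Theta theta -> pseudo_score f w n theta = 0.
Proof.
move=> n0 [th tmax] int_theta; apply/rowP => i; rewrite [RHS]mxE.
have line_cvg : (fun t : R => theta + t *: 'e_i) x @[x --> (0 : R)] --> theta.
  rewrite -[X in _ --> X]addr0 -(scale0r ('e_i : 'rV[R]_d)).
  by apply: cvgD; [exact: cvg_cst | apply: cvgZ; [exact: cvg_id | exact: cvg_cst]].
have /nbhs_ballP[e /= e0 be] := line_cvg _ int_theta.
have in_ball t : t \in `](- e), e[ -> Theta (theta + t *: 'e_i).
  rewrite in_itv /= => te; apply: be.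
  by rewrite /ball /= sub0r normrN ltr_norml.
have zz : 0 \in `](- e), e[ by rewrite in_itv /= oppr_lt0 e0.
have h0 : is_derive (0 : R) 1 (fun s => pseudo_loglik (f (theta + s *: 'e_i)) w n) 0.
  apply: (@derive1_at_max R _ (- e) e 0) => //.
  - by apply: (@le_trans _ _ 0); rewrite ?oppr_le0 ltW.
  - by move=> t /in_ball ht; have [] := loglik_is_derive n0 ht.
  by move=> t /in_ball ht; rewrite scale0r addr0; exact: tmax.
have h1 := @loglik_is_derive n theta i 0 n0 (in_ball 0 zz).
have := @derive_val _ _ _ _ _ _ _ h1; rewrite (@derive_val _ _ _ _ _ _ _ h0).
by rewrite scale0r addr0 => <-.
Qed.

Lemma score_zero_cvg (t : nat -> 'rV[R]_d) : interior Theta theta0 ->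
  (\forall n \near \oo, is_score_zero f Theta w n (t n)) -> t @ \oo --> theta0.
Proof.
move=> int0 tzero; apply: maximizer_cvg.
(* Maximizers [m n] are needed for comparison: near [theta0] they are zeros of the score, hence
   competitors of [t n]. At [n = 0] the value [theta0] is a dummy. *)
have [m mmax] : exists m : nat -> 'rV[R]_d, forall n, (0 < n)%N -> is_maximizer f Theta w n (m n).
  have /choice[m hm] : forall n, exists t, (0 < n)%N -> is_maximizer f Theta w n t.
    move=> n; case: (posnP n) => [->|n0]; first by exists theta0.
    by have [x hx] := maximizer_exists n0; exists x.
  by exists m.
have mcvg : m @ \oo --> theta0.
  by apply: maximizer_cvg; apply: filterS (nbhs_infty_gt 0) => n; exact: mmax.
have mint : \forall n \near \oo, interior Theta (m n).
  by apply: mcvg; apply: open_nbhs_nbhs; split => //; exact: open_interior.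
apply: filterS3 (nbhs_infty_gt 0) tzero mint => n n0 [tn _ tmax] mn.
have [mT mM] := mmax n n0.
have ms := interior_maximizer_score n0 (mmax n n0) mn.
by split => // x xT; apply: le_trans (mM x xT) (tmax _ mT ms).
Qed.

End maximizer.

Theorem theorem6p1 (R : realType) (d : nat) (Theta : set 'rV[R]_d)
  (f : 'rV[R]_d -> nat -> R)
  (f_gt0 : forall theta k, Theta theta -> (1 <= k)%N -> 0 < f theta k)
  (f_nondecreasing : forall theta k l, Theta theta -> (1 <= k)%N ->
     (k <= l)%N -> f theta k <= f theta l)
  (Theta_compact : compact Theta)
  (f_C2 : forall k, (1 <= k)%N -> exists U : set 'rV[R]_d,
     [/\ open U, Theta `<=` U & C2_on U (f^~ k)])
  (C beta : R) (beta_lt1 : beta < 1)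
  (f_growth : forall theta, Theta theta ->
     (forall k, (1 <= k)%N -> f theta k <= C * k%:R `^ beta) \/
     (exists2 alpha : R, -1 < alpha &
        forall k, (1 <= k)%N -> f theta k = k%:R + alpha))
  (theta0 : 'rV[R]_d) (theta0_in : Theta theta0)
  (identifiable : forall theta, Theta theta ->
     ((exists c : R, forall k, (1 <= k)%N -> f theta k = c * f theta0 k) <->
      theta = theta0))
  (disp : measure_display) (T : measurableType disp) (P : probability T R)
  (A : nat -> T -> nat) (A_PA : PA_tree P (f theta0) A)
  (theta_hat : nat -> T -> 'rV[R]_d) :
  ({ae P, forall w, \forall n \near \oo,
      is_maximizer f Theta (A^~ w) n (theta_hat n w)} ->
   {ae P, forall w, theta_hat n w @[n --> \oo] --> theta0}) /\
  (interior Theta theta0 ->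
   {ae P, forall w, \forall n \near \oo,
      is_score_zero f Theta (A^~ w) n (theta_hat n w)} ->
   {ae P, forall w, theta_hat n w @[n --> \oo] --> theta0}).
Proof.
have f_diff k theta : (1 <= k)%N -> Theta theta -> differentiable (f^~ k) theta.
  move=> k0 th; have [U [_ TU [Ud _ _]]] := f_C2 k k0.
  exact/Ud/TU.
have [eta [eta0 eta1 erg]] := ae_ergodic_path (fun k => f_gt0 theta0 k theta0_in)
  (fun k l => f_nondecreasing theta0 k l theta0_in) A_PA beta_lt1 (f_growth _ theta0_in).
split=> [hmax|int0 hzero].
  apply: filterS2 erg hmax => w werg; exact: (maximizer_cvg f_gt0 f_nondecreasing
    Theta_compact f_diff beta_lt1 f_growth theta0_in identifiable eta0 eta1 werg).
apply: filterS2 erg hzero => w werg; exact: (score_zero_cvg f_gt0 f_nondecreasing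
  Theta_compact f_diff beta_lt1 f_growth theta0_in identifiable eta0 eta1 werg).
Qed.
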